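(* Let $\ell>0$ and let $\rho,\sigma\in H^2(0,\ell)$ and $q\in H^1(0,\ell)$ be real-valued functions such that, for some constants $\rho_0,\sigma_0>0$, $\rho(x)\ge\rho_0$, $\sigma(x)\ge\sigma_0$ and $q(x)\ge 0$ for all $x\in[0,\ell]$. Then all the eigenvalues $(\lambda_n)_{n\in\mathbb N^*}$ of the spectral problem $$ \begin{cases} (\sigma(x)\phi'')''-(q(x)\phi')'=\lambda\rho(x)\phi, & x\in(0,\ell),\\ \phi(0)=\phi'(0)=\phi(\ell)=\phi'(\ell)=0, \end{cases} $$ are simple, so that $$0<\lambda_1<\lambda_2<\dots<\lambda_n<\cdots\underset{n\to+\infty}{\longrightarrow}+\infty .$$ Moreover, the corresponding eigenfunctions $(\Phi_n)_{n\in\mathbb N^*}$ satisfy $\Phi_n''(\ell)\neq0$ for all $n\in\mathbb N^*$.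
   Context: $\mathbb N^*=\{1,2,3,\dots\}$. The spectral problem is the eigenvalue problem $\mathcal A\phi=\lambda\phi$, $\phi\in\mathcal D(\mathcal A)$, for the operator $\mathcal Ay=\rho^{-1}\big((\sigma y'')''-(qy')'\big)$ with domain $\mathcal D(\mathcal A)=H^4(0,\ell)\cap H^2_0(0,\ell)$ in the space $L^2_\rho(0,\ell)$ of complex-valued functions with $\int_0^\ell|y|^2\rho\,dx<\infty$, where $H^2_0(0,\ell)=\{y\in H^2(0,\ell): y(0)=y'(0)=y(\ell)=y'(\ell)=0\}$. The eigenvalues are listed in nondecreasing order, and $\Phi_n$ denotes an eigenfunction associated with $\lambda_n$. *)

(* Defs.v *)
From HB Require Import structures.
From mathcomp Require Import all_boot all_order all_algebra.
From mathcomp Require Import complex.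
From mathcomp Require Import all_classical all_reals all_analysis.

Set Implicit Arguments.
Unset Strict Implicit.
Unset Printing Implicit Defensive.

Import Order.TTheory GRing.Theory Num.Theory.
Import numFieldNormedType.Exports.

Local Open Scope classical_set_scope.
Local Open Scope ring_scope.
Local Open Scope complex_scope.

(** Functions on [[0, l]] are total functions [R -> R[i]]; their values outside
    [[0, l]] are irrelevant.  Real coefficients are embedded by [%:C]. *)

Section Sobolev.
Variable R : realType.
Implicit Types (l : R) (f g h : R -> R[i]).

Definition toC (u : R -> R) : R -> R[i] := fun x => (u x)%:C.

Definition L2 l f : Prop :=
  [/\ measurable_fun `]0, l[ (fun x => complex.Re (f x)),
      measurable_fun `]0, l[ (fun x => complex.Im (f x)) &
      (\int[lebesgue_measure]_(x in `]0%R, l[) ((Normc.normc (f x)) ^+ 2)%:E < +oo)%E].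

Definition Cintegral l f : R[i] :=
  (\int[lebesgue_measure]_(x in `]0, l[) complex.Re (f x))%R +i*
  (\int[lebesgue_measure]_(x in `]0, l[) complex.Im (f x))%R.

(** Test functions of class C^1 with compact support in [(0, l)], extended by
    zero to the whole line.  Requiring C^oo instead would define the same weak
    derivatives (Brezis, Functional Analysis, Sobolev Spaces and PDEs, ch. 8). *)
Definition test_function l (phi : R -> R) : Prop :=
  [/\ forall x, derivable phi x 1,
      continuous (derive1 phi) &
      exists a b : R, [/\ 0 < a, b < l &
        forall x, phi x != 0 -> a <= x <= b]].

Definition weak_derivative l f g : Prop :=
  [/\ L2 l f, L2 l g &
      forall phi, test_function l phi ->
        Cintegral l (fun x => f x * (derive1 phi x)%:C) =
        - Cintegral l (fun x => g x * (phi x)%:C)].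

Definition continuous_on_itv l f : Prop :=
  {within `[0, l], continuous (fun x => complex.Re (f x))} /\
  {within `[0, l], continuous (fun x => complex.Im (f x))}.

Fixpoint sobolev l (k : nat) f : Prop :=
  if k is k'.+1 then exists2 g, weak_derivative l f g & sobolev l k' g
  else L2 l f.

(** Membership in H^k(0, l) for [k >= 1]: as usual in dimension one, an element
    is identified with its continuous representative on [[0, l]], which is what
    gives a meaning to pointwise bounds and boundary values. *)
Definition Hsp l (k : nat) f : Prop := sobolev l k f /\ continuous_on_itv l f.

(** The weak derivative of [f], and its continuous representative on [[0, l]]
    whenever there is one (e.g. for [f] in H^2).  It is unique up to equality
    a.e., resp. on [[0, l]]; the default value [0] is used only if [f] has no
    weak derivative in L^2. *)
Definition wD l f : R -> R[i] :=
  xget (fun=> 0) [set g | weak_derivative l f g /\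
    ((exists h, weak_derivative l f h /\ continuous_on_itv l h) ->
     continuous_on_itv l g)].

Definition H20 l f : Prop :=
  Hsp l 2 f /\ [/\ f 0 = 0, wD l f 0 = 0, f l = 0 & wD l f l = 0].

End Sobolev.

Section Operator.
Variable R : realType.
Variables (l : R) (rho sigma q : R -> R).
Implicit Types (y phi psi : R -> R[i]) (lam : R[i]).

Definition domA y : Prop := Hsp l 4 y /\ H20 l y.

Definition opA y : R -> R[i] := fun x =>
  (toC rho x)^-1 *
  (wD l (wD l (fun t => toC sigma t * wD l (wD l y) t)) x
   - wD l (fun t => toC q t * wD l y t) x).

(** Since [rho] is bounded and bounded below by a positive constant, equality in
    L^2_rho is equality a.e. for the Lebesgue measure. *)
Definition in_eigenspace lam phi : Prop :=
  domA phi /\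
  {ae (@lebesgue_measure R), forall x, x \in `]0, l[ ->
     opA phi x = lam * phi x}.

(** [phi] is continuous on [[0, l]], so it is nonzero in L^2_rho iff it is
    nonzero at some point. *)
Definition eigenfunction lam phi : Prop :=
  in_eigenspace lam phi /\ exists2 x, x \in `[0, l] & phi x != 0.

Definition is_eigenvalue lam : Prop := exists phi, eigenfunction lam phi.

Definition simple_eigenvalue lam : Prop :=
  exists2 phi, eigenfunction lam phi &
    forall psi, in_eigenspace lam psi ->
      exists c : R[i], forall x, x \in `[0, l] -> psi x = c * phi x.

End Operator.

(* Main.v *)
Require Import Defs.
From mathcomp Require Import all_boot all_order all_algebra.
From mathcomp Require Import complex.
From mathcomp Require Import all_classical all_reals all_analysis.
From mathcomp Require Import measurable_realfun ring lra.

(** With [u = y'], [w = sigma y''] and [v = w' - q u], the equation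
    [(sigma y'')'' - (q y')' = lam rho y] becomes the linear system [y' = u],
    [u' = w / sigma], [w' = v + q u], [v' = lam rho y], whose coefficients are
    continuous; eigenfunctions are its classical solutions with [y = u = 0] at
    both ends, and integrating by parts shows that [lam] is real and positive.

    For [lam >= 0] the coefficients of the system are nonnegative.  Hence the
    solution starting from [(0, 0, 0, 1)] has [y > 0] on [(0, l]], and no
    eigenfunction can have [w = 0] at an endpoint (reflect [x] into [l - x] for
    the endpoint [l]): this gives both [y''(l) != 0] and simplicity.

    The eigenvalues are the zeros of the determinant formed by the values of
    [y] and [u] at [l] for the two solutions starting from [(0, 0, 1, 0)] and
    [(0, 0, 0, 1)].  A zero is isolated because the eigenfunctions normalised by
    [w(0) = 1] depend continuously on the eigenvalue, while those of distinct
    eigenvalues are orthogonal.  The zeros are unbounded: if there were none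
    above [L], the solution [y_lam] with a fixed forcing [g] would exist for all
    [lam >= L], and [m(lam) = int g y_lam] would satisfy
    [m' = int rho y_lam^2 >= m^2 / C]; a positive [m] blows up in finite time,
    and [m > 0] is achieved at any given [lam] by a [y] supported in a short
    interval, whose Rayleigh quotient is large. *)

(** The unknowns [w = sigma y''] and [v = w' - q u] are chosen so that no derivative of a
    coefficient enters the system. This matches the hypotheses: [q] has only an L^2 weak derivative,
    so [w'] and [q u] have L^2 weak derivatives that may both be discontinuous, whereas
    [v' = lam rho y] is continuous. The eigenvalue problem, stated with weak derivatives and almost
    everywhere, thus becomes classical. The price is paid in the bridge: a continuous function with
    a continuous weak derivative has to be shown differentiable, and conversely a classical solution
    has to be shown to lie in H^4, where the second derivative of [sigma] is again only weak.

    Neither compactness of the resolvent nor analyticity in [lam] is used. To list the eigenvalues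
    it is enough that the zeros of the determinant are positive and unbounded, and that every real
    number has a neighbourhood containing no zero other than possibly itself. In the classical part,
    Cauchy-Schwarz inequalities appear as completed squares with a free parameter. *)

Set Implicit Arguments.
Unset Strict Implicit.
Unset Printing Implicit Defensive.

Import Order.TTheory GRing.Theory Num.Theory.
Import numFieldNormedType.Exports.
Local Open Scope classical_set_scope.
Local Open Scope ring_scope.

(** * Calculus on a segment *)

Section Calculus.
Variable R : realType.
Implicit Types (l x y z t : R) (f g h : R -> R).
Local Notation mu := (@lebesgue_measure R).

Definition cont_on l f : Prop := {within `[0, l], continuous f}.

(** No derivative is asked at the endpoints, so values outside [[0, l]] never matter; continuity up
    to the endpoints is what the mean value theorem needs there. *)
Definition deriv_on l f f' : Prop :=
  cont_on l f /\ forall x, 0 < x < l -> is_derive x 1 f (f' x).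

Lemma cont_on_cst l (c : R) : cont_on l (fun=> c).
Proof. by move=> x; exact: cvg_cst. Qed.

Lemma cont_on0 l : cont_on l (fun=> 0).
Proof. exact: cont_on_cst. Qed.

Lemma continuous_cont_on l f : continuous f -> cont_on l f.
Proof. exact: continuous_subspaceT. Qed.

Lemma cont_on_id l : cont_on l id.
Proof. by apply: continuous_cont_on => x; exact: cvg_id. Qed.

Lemma cont_onD l f g : cont_on l f -> cont_on l g ->
  cont_on l (fun x => f x + g x).
Proof. by move=> cf cg x; apply: cvgD; [exact: cf|exact: cg]. Qed.

Lemma cont_onM l f g : cont_on l f -> cont_on l g ->
  cont_on l (fun x => f x * g x).
Proof. by move=> cf cg x; apply: cvgM; [exact: cf|exact: cg]. Qed.

Lemma cont_onN l f : cont_on l f -> cont_on l (fun x => - f x).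
Proof. by move=> cf x; apply: cvgN; exact: cf. Qed.

Lemma cont_onB l f g : cont_on l f -> cont_on l g ->
  cont_on l (fun x => f x - g x).
Proof. by move=> cf cg; apply: cont_onD => //; exact: cont_onN. Qed.

Lemma cont_on_sum l n (F : 'I_n -> R -> R) : (forall i, cont_on l (F i)) ->
  cont_on l (fun x => \sum_(i < n) F i x).
Proof.
elim: n F => [|n IH] F cF.
  rewrite (_ : (fun _ => _) = (fun=> 0)); first exact: cont_on_cst.
  by apply/funext => x; rewrite big_ord0.
rewrite (_ : (fun _ => _) =
    fun x => F ord0 x + \sum_(i < n) F (lift ord0 i) x).
  by apply: cont_onD => //; exact: IH.
by apply/funext => x; rewrite big_ord_recl.
Qed.

Lemma cont_onP l f : cont_on l f <->
  forall x, 0 <= x <= l -> f @ within `[0, l] (nbhs x) --> f x.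
Proof.
rewrite /cont_on; split.
  by move/subspace_continuousP => H x xl; apply: H; rewrite /= in_itv.
by move=> H; apply/subspace_continuousP => x; rewrite /= in_itv; exact: H.
Qed.

Lemma eq_cont_on l f g : (forall x, 0 <= x <= l -> f x = g x) ->
  cont_on l f -> cont_on l g.
Proof.
move=> fg; rewrite !cont_onP => H x xl; rewrite -(fg x xl).
apply: cvg_trans (H x xl); apply: near_eq_cvg.
rewrite near_withinE; near=> y => yl; apply: fg.
by move: yl; rewrite /= in_itv.
Unshelve. all: by end_near. Qed.

Lemma cont_onV l f : (forall x, 0 <= x <= l -> f x != 0) ->
  cont_on l f -> cont_on l (fun x => (f x)^-1).
Proof.
move=> f0; rewrite !cont_onP => H x xl.
by apply: cvgV; [exact: f0|exact: H].
Qed.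

Lemma cont_on_sub l l' f : l' <= l -> cont_on l f -> cont_on l' f.
Proof.
move=> ll; apply: continuous_subspaceW => x /=.
by rewrite !in_itv/= => /andP[-> /le_trans->].
Qed.

Lemma cont_on_at l f x : 0 < x < l -> cont_on l f -> {for x, continuous f}.
Proof.
move=> xl cf; apply: within_continuous_continuous cf _; last by rewrite in_itv.
by case/andP: xl; exact: lt_trans.
Qed.

Lemma cont_on_bounded l f : 0 < l -> cont_on l f ->
  exists2 K, 0 < K & forall x, 0 <= x <= l -> `|f x| <= K.
Proof.
move=> l0 cf.
have cn : cont_on l (fun x => `|f x|).
  by move=> x; apply: cvg_norm; exact: cf.
have [c cl cM] := EVT_max (ltW l0) cn.
exists (`|f c| + 1); first by rewrite ltr_wpDl.
by move=> x xl; rewrite (le_trans (cM _ _)) ?lerDl// in_itv.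
Qed.

Lemma cont_on_unif_limit l f :
  (forall e, 0 < e -> exists2 g, cont_on l g &
    forall x, 0 <= x <= l -> `|f x - g x| <= e) -> cont_on l f.
Proof.
move=> H; apply/cont_onP => x xl; apply/cvgrPdist_le => e e0.
have e3 : 0 < e / 3 by rewrite divr_gt0.
have [g /cont_onP /(_ x xl) /cvgrPdist_le /(_ _ e3) cg fg] := H _ e3.
move: cg; rewrite !near_withinE => cg; near=> y => yl.
have cgy : `|g x - g y| <= e / 3 by apply: (near cg y).
move: yl; rewrite /= in_itv => yl.
rewrite (_ : f x - f y = (f x - g x) + (g x - g y) - (f y - g y)); last by ring.
rewrite (le_trans (ler_normB _ _))// (_ : e = e / 3 + e / 3 + e / 3); last by field.
by rewrite lerD ?fg// (le_trans (ler_normD _ _))// lerD ?fg.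
Unshelve. all: by end_near. Qed.

Lemma deriv_on_cont l f f' : deriv_on l f f' -> cont_on l f.
Proof. by case. Qed.

Lemma eq_deriv_on l f f' g' : (forall x, 0 < x < l -> f' x = g' x) ->
  deriv_on l f f' -> deriv_on l f g'.
Proof. by move=> e [cf df]; split=> // x xl; rewrite -e//; exact: df. Qed.

Lemma deriv_on_sub l l' f f' : l' <= l -> deriv_on l f f' -> deriv_on l' f f'.
Proof.
move=> ll [cf df]; split; first exact: cont_on_sub cf.
by move=> x /andP[x0 xl]; apply: df; rewrite x0 (lt_le_trans xl).
Qed.

Lemma deriv_on_cst l (c : R) : deriv_on l (fun=> c) (fun=> 0).
Proof. by split=> [|x _]; [exact: cont_on_cst|exact: is_derive_cst]. Qed.

Lemma deriv_on_id l : deriv_on l id (fun=> 1).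
Proof. by split=> [|x _]; [exact: cont_on_id|exact: is_derive_id]. Qed.

Lemma deriv_onD l f f' g g' : deriv_on l f f' -> deriv_on l g g' ->
  deriv_on l (fun x => f x + g x) (fun x => f' x + g' x).
Proof.
move=> [cf df] [cg dg]; split; first exact: cont_onD.
by move=> x xl; have := df x xl; have := dg x xl => ? ?; exact: is_deriveD.
Qed.

Lemma deriv_onN l f f' : deriv_on l f f' ->
  deriv_on l (fun x => - f x) (fun x => - f' x).
Proof.
move=> [cf df]; split; first exact: cont_onN.
by move=> x xl; have := df x xl => ?; exact: is_deriveN.
Qed.

Lemma deriv_onB l f f' g g' : deriv_on l f f' -> deriv_on l g g' ->
  deriv_on l (fun x => f x - g x) (fun x => f' x - g' x).
Proof. by move=> df dg; apply: deriv_onD => //; exact: deriv_onN. Qed.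

Lemma deriv_onM l f f' g g' : deriv_on l f f' -> deriv_on l g g' ->
  deriv_on l (fun x => f x * g x) (fun x => f' x * g x + f x * g' x).
Proof.
move=> [cf df] [cg dg]; split; first exact: cont_onM.
move=> x xl; have := df x xl; have := dg x xl => dgx dfx.
apply: (is_derive_eq (is_deriveM dfx dgx)).
by rewrite /GRing.scale /=; ring.
Qed.

Lemma deriv_onZ l (c : R) f f' : deriv_on l f f' ->
  deriv_on l (fun x => c * f x) (fun x => c * f' x).
Proof.
move=> df; apply: eq_deriv_on (deriv_onM (deriv_on_cst l c) df) => x _.
by rewrite mul0r add0r.
Qed.

Lemma deriv_on_sum l n (F F' : 'I_n -> R -> R) :
  (forall i, deriv_on l (F i) (F' i)) ->
  deriv_on l (fun x => \sum_(i < n) F i x) (fun x => \sum_(i < n) F' i x).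
Proof.
elim: n F F' => [|n IH] F F' dF.
  rewrite (_ : (fun x => \sum_(i < 0) F i x) = (fun=> 0)); last first.
    by apply/funext => x; rewrite big_ord0.
  by apply: eq_deriv_on (deriv_on_cst l 0) => x _; rewrite big_ord0.
rewrite (_ : (fun x => \sum_(i < n.+1) F i x) =
    fun x => F ord0 x + \sum_(i < n) F (lift ord0 i) x); last first.
  by apply/funext => x; rewrite big_ord_recl.
apply: eq_deriv_on (deriv_onD (dF ord0) (IH _ _ (fun i => dF (lift ord0 i)))).
by move=> x _; rewrite big_ord_recl.
Qed.

Lemma deriv_on_MVT l f f' x y : deriv_on l f f' -> 0 <= x -> x < y -> y <= l ->
  exists2 c, x < c < y & f y - f x = f' c * (y - x).
Proof.
move=> [cf df] x0 xy yl.
have [||c cxy e] := @MVT _ f f' x y xy.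
- move=> z; rewrite in_itv/= => /andP[xz zy]; apply: df.
  by rewrite (le_lt_trans x0 xz) (lt_le_trans zy yl).
- apply: continuous_subspaceW cf => z /=; rewrite !in_itv/= => /andP[xz zy].
  by rewrite (le_trans x0 xz) (le_trans zy yl).
- by exists c => //; move: cxy; rewrite in_itv.
Qed.

Lemma deriv_on_le l f f' x y : deriv_on l f f' -> 0 <= x -> x <= y -> y <= l ->
  (forall z, x < z < y -> 0 <= f' z) -> f x <= f y.
Proof.
move=> df x0; rewrite le_eqVlt => /predU1P[->//|xy] yl f'0.
have [c cxy e] := deriv_on_MVT df x0 xy yl.
by rewrite -subr_ge0 e mulr_ge0 ?f'0// subr_ge0 ltW.
Qed.

Lemma deriv_on_lt l f f' x y : deriv_on l f f' -> 0 <= x -> x < y -> y <= l ->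
  (forall z, x < z < y -> 0 < f' z) -> f x < f y.
Proof.
move=> df x0 xy yl f'0.
have [c cxy e] := deriv_on_MVT df x0 xy yl.
by rewrite -subr_gt0 e mulr_gt0 ?f'0// subr_gt0.
Qed.

Lemma deriv_on_le_le l f f' g g' x : deriv_on l f f' -> deriv_on l g g' ->
  0 <= x <= l -> f 0 <= g 0 -> (forall z, 0 < z < l -> f' z <= g' z) ->
  f x <= g x.
Proof.
move=> df dg /andP[x0 xl] fg0 fg'.
have := @deriv_on_le _ _ _ 0 x (deriv_onB dg df) (lexx 0) x0 xl.
have /[swap]/[apply] : forall z, 0 < z < x -> 0 <= g' z - f' z.
  by move=> z /andP[z0 zx]; rewrite subr_ge0 fg'// z0 (lt_le_trans zx).
by move=> ?; lra.
Qed.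

(** Estimates of integrals are replaced by comparison with an explicit majorant [g]; both the Picard
    increments and [prim_abs_le] are bounded in this way. *)
Lemma deriv_on_abs_le l f f' g g' x : deriv_on l f f' -> deriv_on l g g' ->
  0 <= x <= l -> `|f 0| <= g 0 -> (forall z, 0 < z < l -> `|f' z| <= g' z) ->
  `|f x| <= g x.
Proof.
move=> df dg xl; rewrite !ler_norml lerNl => /andP[fg0 fg1] fg'; apply/andP; split.
  rewrite lerNl; apply: (deriv_on_le_le (deriv_onN df) dg xl) => // z zl.
  by move: (fg' z zl); rewrite ler_norml lerNl => /andP[].
apply: (deriv_on_le_le df dg xl) => // z zl.
by move: (fg' z zl); rewrite ler_norml => /andP[].
Qed.

Lemma deriv_on_eq l f g f' x : deriv_on l f f' -> deriv_on l g f' ->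
  f 0 = g 0 -> 0 <= x <= l -> f x = g x.
Proof.
move=> df dg e xl; apply/le_anti/andP; split.
  by apply: (deriv_on_le_le df dg xl); rewrite ?e.
by apply: (deriv_on_le_le dg df xl); rewrite ?e.
Qed.

Lemma deriv_on_cst_eq0 l f f' (c x : R) : deriv_on l f f' ->
  (forall y, 0 < y < l -> f y = c) -> 0 < x < l -> f' x = 0.
Proof.
move=> [_ df] fc xl; have fx := df x xl.
have <- : 'D_1 f x = f' x by apply: derive_val.
rewrite -(derive_cst c (x : R) (1 : R)).
apply: near_eq_derive.
have : x \in `]0, l[ by rewrite in_itv.
move/near_in_itvoo; apply: filterS => y; rewrite in_itv/= => yl; exact: fc.
Qed.

Definition prim f : R -> R := fun x => \int[mu]_(t in `[0, x]) f t.

Lemma prim0 f : prim f 0 = 0.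
Proof. by rewrite /prim set_itv1 Rintegral_set1. Qed.

Lemma cont_on_integrable l f : cont_on l f -> mu.-integrable `[0, l] (EFin \o f).
Proof. by apply: continuous_compact_integrable; exact: segment_compact. Qed.

Lemma prim_deriv l f : cont_on l f -> deriv_on l (prim f) f.
Proof.
move=> cf; have fi := cont_on_integrable cf; split.
  case: (leP 0 l) => [l0|l0]; first exact: parameterized_integral_continuous.
  by apply/cont_onP => x /andP[x0 xl]; move: (le_trans x0 xl); rewrite leNgt l0.
move=> x /andP[x0 xl].
have xl' : 0 < x < l by rewrite x0.
have [d <-] := continuous_FTC1_closed xl fi x0 (cont_on_at xl' cf).
by rewrite derive1E; exact: derivableP.
Qed.

Lemma prim_cont l f : cont_on l f -> cont_on l (prim f).
Proof. by move/prim_deriv/deriv_on_cont. Qed.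

Lemma primE l f f' x : deriv_on l f f' -> cont_on l f' -> 0 <= x <= l ->
  prim f' x = f x - f 0.
Proof.
move=> df cf'; apply: (deriv_on_eq (prim_deriv cf') (g := fun x => f x - f 0)).
- apply: eq_deriv_on (deriv_onB df (deriv_on_cst l (f 0))) => y _.
  by rewrite subr0.
- by rewrite prim0 subrr.
Qed.

Lemma primD l f g x : cont_on l f -> cont_on l g -> 0 <= x <= l ->
  prim (fun t => f t + g t) x = prim f x + prim g x.
Proof.
move=> cf cg xl.
have d := deriv_onD (prim_deriv cf) (prim_deriv cg).
by rewrite (primE d (cont_onD cf cg) xl) !prim0 addr0 subr0.
Qed.

Lemma primZ l c f x : cont_on l f -> 0 <= x <= l ->
  prim (fun t => c * f t) x = c * prim f x.
Proof.
move=> cf xl.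
have d := deriv_onZ c (prim_deriv cf).
by rewrite (primE d (cont_onM (@cont_on_cst l c) cf) xl) prim0 mulr0 subr0.
Qed.

Lemma primB l f g x : cont_on l f -> cont_on l g -> 0 <= x <= l ->
  prim (fun t => f t - g t) x = prim f x - prim g x.
Proof.
move=> cf cg xl.
have d := deriv_onB (prim_deriv cf) (prim_deriv cg).
by rewrite (primE d (cont_onB cf cg) xl) !prim0 !subr0.
Qed.

Lemma eq_prim f g x : (forall t, 0 <= t <= x -> f t = g t) -> prim f x = prim g x.
Proof. by move=> fg; apply: eq_Rintegral => t; rewrite inE/= in_itv; exact: fg. Qed.

Lemma prim_ge0 l f x : cont_on l f -> 0 <= x <= l ->
  (forall t, 0 < t < l -> 0 <= f t) -> 0 <= prim f x.
Proof.
move=> cf xl f0; rewrite -(prim0 f); case/andP: xl => x0 xl.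
apply: (deriv_on_le (prim_deriv cf)) => // z /andP[z0 zx].
by rewrite f0// z0 (lt_le_trans zx).
Qed.

Lemma prim_abs_le l f (K : R) x : cont_on l f -> 0 <= x <= l ->
  (forall t, 0 < t < l -> `|f t| <= K) -> `|prim f x| <= K * x.
Proof.
move=> cf xl fK.
apply: (@deriv_on_abs_le l (prim f) f (fun x => K * x) (fun=> K)) => //.
- exact: prim_deriv.
- apply: eq_deriv_on (deriv_onZ K (deriv_on_id l)) => y _.
  by rewrite mulr1.
- by rewrite prim0 normr0 mulr0.
Qed.

(** The primitive is nondecreasing from 0 to 0, hence constant, so its derivative [f] vanishes. *)
Lemma prim_eq0 l f x : cont_on l f -> (forall t, 0 < t < l -> 0 <= f t) ->
  prim f l = 0 -> 0 < x < l -> f x = 0.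
Proof.
move=> cf f0 e; apply: (deriv_on_cst_eq0 (prim_deriv cf) (c := 0)) => y /andP[y0 yl].
apply/le_anti; rewrite (prim_ge0 cf)//; last by rewrite !ltW.
rewrite andbT -e; apply: (deriv_on_le (prim_deriv cf)) => //; try exact: ltW.
by move=> z /andP[yz zl]; rewrite f0// (lt_trans y0).
Qed.

Lemma deriv_on_eq_cst l f f' x : deriv_on l f f' ->
  (forall t, 0 < t < l -> f' t = 0) -> 0 <= x <= l -> f x = f 0.
Proof.
move=> df f'0; apply: (deriv_on_eq df (g := fun=> f 0)) => //.
by apply: eq_deriv_on (deriv_on_cst l (f 0)) => y /f'0.
Qed.

Lemma cont_on_eq0 l f x : 0 < l -> cont_on l f ->
  (forall t, 0 < t < l -> f t = 0) -> 0 <= x <= l -> f x = 0.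
Proof.
move=> l0 cf f0.
have pf t : 0 <= t <= l -> prim f t = 0.
  by move=> tl; rewrite (deriv_on_eq_cst (prim_deriv cf) f0 tl) prim0.
have ends (F : set_system R) : ProperFilter F -> f @ F --> f x ->
    (\forall y \near F, 0 < y < l) -> f x = 0.
  move=> FF fF Fl; apply: (norm_cvg_unique fF).
  have : (fun=> 0 : R) @ F --> (0 : R) by exact: cvg_cst.
  apply: cvg_trans; apply: near_eq_cvg.
  by apply: filterS Fl => y yl; rewrite f0.
have /continuous_within_itvP-/(_ l0)[_ f0r flr] := cf.
case/andP; rewrite le_eqVlt => /predU1P[x0 _|x0].
  apply: (ends (0 : R)^'+); first by rewrite -x0.
  by near=> y; apply/andP; split; near: y; [exact: nbhs_right_gt|exact: nbhs_right_lt].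
rewrite le_eqVlt => /predU1P[xl|xl]; last by rewrite f0 ?x0.
apply: (ends l^'-); first by rewrite xl.
by near=> y; apply/andP; split; near: y; [exact: nbhs_left_gt|exact: nbhs_left_lt].
Unshelve. all: by end_near. Qed.

(** The bound is asked only within distance 1, where the flow will be Lipschitz in the spectral
    parameter with a single constant. *)
Lemma lipschitz_continuous_at f x (C : R) :
  (forall y, `|y - x| <= 1 -> `|f y - f x| <= C * `|y - x|) ->
  {for x, continuous f}.
Proof.
move=> fC; apply/cvgrPdist_le => e e0.
have C0 : 0 < `|C| + 1 by rewrite ltr_wpDl.
have d0 : 0 < Num.min 1 (e / (`|C| + 1)) by rewrite lt_min ltr01 divr_gt0.
near=> y; rewrite distrC.
have : `|y - x| <= Num.min 1 (e / (`|C| + 1)).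
  rewrite distrC; near: y.
  by exists (Num.min 1 (e / (`|C| + 1))) => //= y /=; exact: ltW.
rewrite le_min ler_pdivlMr// => /andP[y1 ye].
apply: (le_trans (fC y y1)); apply: le_trans ye.
by rewrite mulrC ler_wpM2l// (le_trans (ler_norm C))// lerDl.
Unshelve. all: by end_near. Qed.

Lemma cont_on_reflect l f : cont_on l f -> cont_on l (fun x => f (l - x)).
Proof.
rewrite !cont_onP => cf x /andP[x0 xl].
have xl' : 0 <= l - x <= l by rewrite subr_ge0 xl lerBlDr lerDl.
apply/cvgrPdist_le => e e0.
have /cvgrPdist_le/(_ e e0) := cf (l - x) xl'.
rewrite !near_withinE => -[d d0 H]; exists d => // y /= xy yl.
apply: (H (l - y)) => /=.
  by rewrite (_ : l - x - (l - y) = - (x - y)) ?normrN//; ring.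
move: yl; rewrite !in_itv/= => /andP[y0 yl].
by rewrite subr_ge0 yl lerBlDr lerDl.
Qed.

Lemma deriv_on_reflect l f f' : deriv_on l f f' ->
  deriv_on l (fun x => f (l - x)) (fun x => - f' (l - x)).
Proof.
move=> [cf df]; split; first exact: cont_on_reflect.
move=> x /andP[x0 xl].
have d1 : is_derive x 1 (fun y : R => l - y) (-1).
  apply: (is_derive_eq (is_deriveB (is_derive_cst l x 1) (is_derive_id x 1))).
  by rewrite sub0r.
have xl' : 0 < l - x < l by rewrite subr_gt0 xl ltrBlDr ltrDl.
have := @is_derive1_comp _ f (fun y => l - y) x _ _ (df (l - x) xl') d1.
by rewrite mulrN1.
Qed.

End Calculus.

(** * Linear differential systems *)

Section LinearODE.
Variable R : realType.
Implicit Types (l x y z t : R) (f g h : R -> R).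

(** The intervals of radius [2 C / 2^k] (the sum of the remaining steps) around [u k] are nested,
    and the supremum of their left ends lies in all of them. *)
Lemma geometric_steps_limit (u : nat -> R) (C : R) :
  (forall k, `|u k.+1 - u k| <= C / 2 ^+ k) ->
  exists y, forall k, `|y - u k| <= 2 * C / 2 ^+ k.
Proof.
move=> uC.
have half k : C / 2 ^+ k = 2 * (C / 2 ^+ k.+1).
  by rewrite exprS; field; rewrite expf_neq0.
pose a k := u k - 2 * (C / 2 ^+ k); pose b k := u k + 2 * (C / 2 ^+ k).
have a_incr k : a k <= a k.+1.
  by move: (uC k); rewrite /a ler_norml (half k) => /andP[]; lra.
have b_decr k : b k.+1 <= b k.
  by move: (uC k); rewrite /b ler_norml (half k) => /andP[]; lra.
have a_homo : {homo a : m n / (m <= n)%N >-> m <= n}.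
  by apply: homo_leq => //; exact: le_trans.
have b_homo : {homo b : m n / (m <= n)%N >-> n <= m}.
  by apply: homo_leq => // x y z xy yz; exact: le_trans yz xy.
have C0 : 0 <= C by have := le_trans (normr_ge0 _) (uC 0%N); rewrite expr0 divr1.
have ab m n : a m <= b n.
  apply: (le_trans (a_homo _ _ (leq_maxl m n))).
  apply: le_trans (b_homo _ _ (leq_maxr m n)).
  have : 0 <= C / 2 ^+ maxn m n by rewrite divr_ge0// exprn_ge0.
  by rewrite /a /b; lra.
have aub : has_ubound (range a) by exists (b 0%N) => _ [m _ <-].
exists (sup (range a)) => k.
have h1 : a k <= sup (range a) by apply: ub_le_sup => //; exists k.
have h2 : sup (range a) <= b k.
  by apply: ge_sup; [exists (a 0%N); exists 0%N|move=> _ [m _ <-]].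
by rewrite ler_norml; move: h1 h2; rewrite /a /b; lra.
Qed.

Variables (n : nat) (l : R).
Hypothesis l_gt0 : 0 < l.
Implicit Types (M : 'I_n -> 'I_n -> R -> R) (b Y : 'I_n -> R -> R).

Definition lin_rhs M b Y (i : 'I_n) : R -> R :=
  fun x => \sum_(j < n) M i j x * Y j x + b i x.

Lemma lin_rhs_cont M b Y : (forall i j, cont_on l (M i j)) ->
  (forall i, cont_on l (b i)) -> (forall i, cont_on l (Y i)) ->
  forall i, cont_on l (lin_rhs M b Y i).
Proof.
move=> cM cb cY i; apply: cont_onD (cb i); apply: cont_on_sum => j.
exact: cont_onM.
Qed.

Lemma bounded_coefficients M : (forall i j, cont_on l (M i j)) ->
  exists2 K, 0 < K & forall i j x, 0 <= x <= l -> `|M i j x| <= K.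
Proof.
move=> cM.
have bM i j : exists K, 0 < K /\ forall x, 0 <= x <= l -> `|M i j x| <= K.
  by have [K K0 KM] := cont_on_bounded l_gt0 (cM i j); exists K.
pose K i j : R := sval (cid (bM i j)).
have K0 i j : 0 <= K i j by rewrite /K; case: cid => k [k0 _] /=; exact: ltW.
exists (1 + \sum_i \sum_j K i j).
  by rewrite ltr_pwDl// sumr_ge0// => i _; rewrite sumr_ge0.
move=> i j x xl; apply: (@le_trans _ _ (K i j)).
  by rewrite /K; case: (svalP (cid (bM i j))) => _; exact.
rewrite (bigD1 i)//= (bigD1 j)//= addrA -!addrA.
rewrite [leRHS]addrCA lerDl !addr_ge0// sumr_ge0// => k _.
by rewrite sumr_ge0.
Qed.

Lemma lin_rhs_le M b Y Z (K e : R) i x :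
  (forall i j, `|M i j x| <= K) -> (forall j, `|Y j x - Z j x| <= e) ->
  0 <= e -> `|lin_rhs M b Y i x - lin_rhs M b Z i x| <= n%:R * K * e.
Proof.
move=> MK YZ e0.
rewrite /lin_rhs opprD addrACA subrr addr0 -sumrB.
apply: (le_trans (ler_norm_sum _ _ _)).
apply: (@le_trans _ _ (\sum_(j < n) K * e)).
  by apply: ler_sum => j _; rewrite -mulrBr normrM ler_pM.
by rewrite sumr_const card_ord -mulrA mulr_natl.
Qed.

Lemma deriv_on_expR (c : R) :
  deriv_on l (fun x => expR (c * x)) (fun x => c * expR (c * x)).
Proof.
split.
  apply: continuous_cont_on => x.
  apply: (@continuous_comp _ _ _ (fun x => c * x) expR).
    by apply: mulrl_continuous.
  exact: continuous_expR.
move=> x _.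
have d1 : is_derive x 1 (fun x : R => c * x) c.
  have -> : (fun x : R => c * x) = c *: (id : R -> R) by [].
  by apply: is_derive_eq; rewrite /GRing.scale /= mulr1.
have := @is_derive1_comp _ expR (fun x => c * x) x _ _ (is_derive_expR _) d1.
by rewrite mulrC.
Qed.

(* Successive approximations started at the initial value; the n-th increment
   is bounded by [B 2^-n e^(2cx)], where [c] bounds the operator norm. *)
Lemma lin_ode_exists M b (Y0 : 'I_n -> R) :
  (forall i j, cont_on l (M i j)) -> (forall i, cont_on l (b i)) ->
  exists Y, [/\ forall i, deriv_on l (Y i) (lin_rhs M b Y i),
    forall i, Y i 0 = Y0 i &
    (forall i j x, 0 <= x <= l -> 0 <= M i j x) ->
    (forall i x, 0 <= x <= l -> 0 <= b i x) -> (forall i, 0 <= Y0 i) ->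
    forall i x, 0 <= x <= l -> 0 <= Y i x].
Proof.
move=> cM cb.
pose P := fix P k : 'I_n -> R -> R := if k is k'.+1
  then fun i x => Y0 i + prim (lin_rhs M b (P k') i) x else fun i _ => Y0 i.
have cP k i : cont_on l (P k i).
  elim: k i => [|k IH] i; first exact: cont_on_cst.
  apply: cont_onD; first exact: cont_on_cst.
  by apply: prim_cont; exact: lin_rhs_cont.
have dP k i : deriv_on l (P k.+1 i) (lin_rhs M b (P k) i).
  have cF : cont_on l (lin_rhs M b (P k) i) by exact: lin_rhs_cont.
  apply: eq_deriv_on (deriv_onD (deriv_on_cst l (Y0 i)) (prim_deriv cF)) => x _.
  by rewrite add0r.
have P0 k i : P k i 0 = Y0 i by case: k => //= k; rewrite prim0 addr0.
have [K K0 MK] := bounded_coefficients cM.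
pose c := n%:R * K + 1.
have c0 : 0 < c by rewrite ltr_wpDl// mulr_ge0// ltW.
have [B B0 PB] : exists2 B, 0 < B &
    forall i x, 0 <= x <= l -> `|P 1%N i x - P 0%N i x| <= B.
  have [i0|noi] := pselect (exists i0 : 'I_n, True); last first.
    by exists 1 => // i; exfalso; apply: noi; exists i.
  have [|B B0 HB] := @bounded_coefficients (fun i _ x => P 1%N i x - P 0%N i x).
    by move=> i _; apply: cont_onB.
  by exists B => // i x xl; exact: (HB i i).
have step k i x : 0 <= x <= l ->
    `|P k.+1 i x - P k i x| <= B / 2 ^+ k * expR (2 * c * x).
  elim: k i x => [|k IH] i x xl.
    have e1 : 1 <= expR (2 * c * x).
      by case/andP: xl => x0 _; rewrite -expR0 ler_expR !mulr_ge0// ltW.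
    by rewrite expr0 divr1 (le_trans (PB _ _ xl))// ler_peMr// ltW.
  apply: (deriv_on_abs_le (deriv_onB (dP _ _) (dP _ _))
    (deriv_onZ (B / 2 ^+ k.+1) (deriv_on_expR (2 * c)))) => //.
    rewrite !P0 subrr normr0 mulr_ge0 ?expR_ge0// divr_ge0 ?exprn_ge0//.
    exact: ltW.
  move=> z /andP[z0 zl]; have zl' : 0 <= z <= l by rewrite !ltW.
  have := @lin_rhs_le M b (P k.+1) (P k) K _ i z
    (fun i j => MK i j _ zl') (fun j => IH j _ zl').
  have e0 : 0 <= B / 2 ^+ k * expR (2 * c * z).
    by rewrite mulr_ge0 ?expR_ge0// divr_ge0 ?exprn_ge0// ltW.
  move=> /(_ e0)/le_trans; apply.
  (* Differentiating [e^(2cx)] brings a factor [2c], while the right-hand side is Lipschitz with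
     constant [n K <= c]: each iteration gains a factor 1/2. *)
  rewrite (_ : _ / 2 ^+ k.+1 * _ = c * (B / 2 ^+ k * expR (2 * c * z))).
    by rewrite ler_wpM2r// lerDl.
  by rewrite exprS; field; rewrite expf_neq0.
pose C := B * expR (2 * c * l).
have stepC k i x : 0 <= x <= l -> `|P k.+1 i x - P k i x| <= C / 2 ^+ k.
  move=> xl; apply: (le_trans (step k i x xl)).
  rewrite /C mulrAC ler_wpM2r ?invr_ge0 ?exprn_ge0//.
  rewrite ler_wpM2l ?(ltW B0)// ler_expR ler_wpM2l//.
    by rewrite mulr_ge0// ltW.
  by case/andP: xl.
have lim i x : exists y, 0 <= x <= l -> forall k, `|y - P k i x| <= 2 * C / 2 ^+ k.
  have [xl|] := boolP (0 <= x <= l); last by exists 0.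
  have [y Hy] := geometric_steps_limit (fun k => stepC k i x xl).
  by exists y.
pose Y i x := sval (cid (lim i x)).
have YP i x k : 0 <= x <= l -> `|Y i x - P k i x| <= 2 * C / 2 ^+ k.
  by move=> xl; rewrite /Y; exact: (svalP (cid (lim i x)) xl k).
have C0 : 0 < C by rewrite mulr_gt0 ?expR_gt0.
have small e : 0 < e -> exists k, 2 * C / 2 ^+ k <= e.
  move=> e0; have C2e : 0 < 2 * C / e by rewrite divr_gt0// mulr_gt0.
  exists (Num.bound (2 * C / e)).
  rewrite ler_pdivrMr ?exprn_gt0// [leRHS]mulrC -ler_pdivrMr//.
  apply: (le_trans (ltW (archi_boundP (ltW C2e)))).
  by rewrite -natrX ler_nat ltnW// ltn_expl.
have cY i : cont_on l (Y i).
  apply: cont_on_unif_limit => e /small[k ke].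
  by exists (P k i) => // x xl; exact: le_trans (YP _ _ _ xl) ke.
have cF i : cont_on l (lin_rhs M b Y i) by exact: lin_rhs_cont.
have YE i x : 0 <= x <= l -> Y i x = Y0 i + prim (lin_rhs M b Y i) x.
  move=> xl; apply/eqP; rewrite -subr_eq0 -normr_le0; apply/ler_addgt0Pr => e e0.
  rewrite add0r.
  (* One part of the error comes from [Y - P k.+1], and [n K l] parts come from the integral of the
     right-hand side. *)
  have N0 : 0 < 1 + n%:R * K * l by rewrite ltr_pwDl// !mulr_ge0// ltW.
  have [k ke] := small _ (divr_gt0 e0 N0).
  have C2 : 0 <= 2 * C / 2 ^+ k by rewrite divr_ge0 ?exprn_ge0// mulr_ge0// ltW.
  have H : `|P k.+1 i x - prim (lin_rhs M b Y i) x - Y0 i| <=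
      n%:R * K * (2 * C / 2 ^+ k) * x.
    have := @deriv_on_abs_le _ _ _ _ (fun x => n%:R * K * (2 * C / 2 ^+ k) * x)
     (fun=> n%:R * K * (2 * C / 2 ^+ k)) x (deriv_onB (deriv_onB (dP k i)
      (prim_deriv (cF i))) (deriv_on_cst l (Y0 i))).
    apply => //.
    - apply: eq_deriv_on (deriv_onZ _ (deriv_on_id l)) => y _.
      by rewrite mulr1.
    - by rewrite P0 prim0 subr0 subrr normr0 mulr0.
    - move=> z /andP[z0 zl]; have zl' : 0 <= z <= l by rewrite !ltW.
      rewrite subr0; apply: lin_rhs_le => //; first by move=> ? ?; exact: MK.
      by move=> j; rewrite distrC YP.
  rewrite (_ : Y i x - _ = (Y i x - P k.+1 i x) +
    (P k.+1 i x - prim (lin_rhs M b Y i) x - Y0 i)); last by ring.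
  rewrite (le_trans (ler_normD _ _))//.
  rewrite (_ : e = e / (1 + n%:R * K * l) + n%:R * K * (e / (1 + n%:R * K * l)) * l);
    last by field; exact: lt0r_neq0.
  apply: lerD.
    apply: le_trans ke; apply: (le_trans (YP _ _ _ xl)).
    rewrite ler_wpM2l ?(mulr_ge0 _ (ltW C0))// lef_pV2 ?posrE ?exprn_gt0//.
    by rewrite ler_weXn2l// ler1n.
  apply: (le_trans H); case/andP: xl => x0 xl.
  have nK : 0 <= n%:R * K by rewrite mulr_ge0// ltW.
  apply: ler_pM => //; first by rewrite mulr_ge0.
  by rewrite ler_wpM2l.
exists Y; split.
- move=> i; split=> // x xl.
  have [_ /(_ x xl)] := deriv_onD (deriv_on_cst l (Y0 i)) (prim_deriv (cF i)).
  rewrite add0r; apply: near_eq_is_derive.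
  have : x \in `]0, l[ by rewrite in_itv.
  move/near_in_itvoo; apply: filterS => y; rewrite in_itv/= => /andP[y0 yl].
  by rewrite -YE// !ltW.
- by move=> i; rewrite YE ?prim0 ?addr0// lexx ltW.
- move=> M0 b0 Y00.
  (* With nonnegative coefficients every iterate is nonnegative, and the sign passes to the
     limit. *)
  have P_ge0 k i x : 0 <= x <= l -> 0 <= P k i x.
    elim: k i x => [i x _|k IH i x xl]; first exact: Y00.
    rewrite -[P k.+1 i x]/(Y0 i + prim (lin_rhs M b (P k) i) x).
    apply: addr_ge0 => //; apply: (@prim_ge0 _ l) => //.
      exact: lin_rhs_cont.
    move=> t /andP[t0 tl]; have tl' : 0 <= t <= l by rewrite !ltW.
    by rewrite addr_ge0 ?b0// sumr_ge0// => j _; rewrite mulr_ge0 ?M0 ?IH.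
  move=> i x xl; rewrite -oppr_le0; apply/ler_addgt0Pr => e /small[k ke].
  have := YP i x k xl; rewrite ler_norml => /andP[+ _].
  by have := P_ge0 k i x xl; lra.
Qed.

(* [(sum_i Y_i^2 + n beta^2) e^(-L x)] is nonincreasing. *)
Lemma lin_ode_bound M b Y (K beta x : R) :
  (forall i, deriv_on l (Y i) (lin_rhs M b Y i)) ->
  0 <= K -> (forall i j x, 0 <= x <= l -> `|M i j x| <= K) ->
  0 <= beta -> (forall i x, 0 <= x <= l -> `|b i x| <= beta) -> 0 <= x <= l ->
  \sum_i Y i x ^+ 2 <=
    (\sum_i Y i 0 ^+ 2 + n%:R * beta ^+ 2) * expR ((2 * n%:R * K + 1) * l).
Proof.
move=> dY K0 MK beta0 bbeta xl.
(* By [2 ab <= a^2 + b^2], the matrix terms of the derivative of [E] cost [2 n K] and the forcing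
   terms cost 1. *)
pose L := 2 * n%:R * K + 1.
have L1 : 1 <= L by rewrite lerDr !mulr_ge0.
have L0 : 0 < L by exact: lt_le_trans L1.
pose E x := \sum_i Y i x ^+ 2 + n%:R * beta ^+ 2.
have E0 y : 0 <= E y.
  by rewrite addr_ge0 ?mulr_ge0 ?sqr_ge0// sumr_ge0// => i _; exact: sqr_ge0.
have dE : deriv_on l E (fun x => \sum_i 2 * Y i x * lin_rhs M b Y i x).
  have := deriv_onD (deriv_on_sum (fun i => deriv_onM (dY i) (dY i)))
    (deriv_on_cst l (n%:R * beta ^+ 2)).
  have -> : (fun x => \sum_i Y i x * Y i x + n%:R * beta ^+ 2) = E.
    by apply/funext => y; rewrite /E; congr (_ + _); apply: eq_bigr => i _; rewrite expr2.
  apply: eq_deriv_on => y _; rewrite addr0; apply: eq_bigr => i _; ring.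
have E' y : 0 < y < l -> \sum_i 2 * Y i y * lin_rhs M b Y i y <= L * E y.
  move=> /andP[y0 yl]; have yl' : 0 <= y <= l by rewrite !ltW.
  have term i : 2 * Y i y * lin_rhs M b Y i y <=
      \sum_j K * (Y i y ^+ 2 + Y j y ^+ 2) + Y i y ^+ 2 + beta ^+ 2.
    rewrite /lin_rhs mulrDr mulr_sumr -addrA; apply: lerD.
      apply: ler_sum => j _.
      have h : `|Y i y * Y j y| * 2 <= Y i y ^+ 2 + Y j y ^+ 2.
        have := sqr_ge0 (`|Y i y| - `|Y j y|); rewrite normrM.
        rewrite -(real_normK (num_real (Y i y))) -(real_normK (num_real (Y j y))).
        by nra.
      apply: (le_trans (ler_norm _)).
      rewrite (_ : 2 * Y i y * _ = M i j y * (Y i y * Y j y * 2)); last by ring.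
      rewrite normrM; apply: ler_pM => //; first exact: MK.
      by rewrite normrM (@ger0_norm _ 2).
    have := bbeta i y yl'; have := sqr_ge0 (Y i y - b i y) => h1 h2.
    have : b i y ^+ 2 <= beta ^+ 2.
      by rewrite -(real_normK (num_real (b i y))) lerXn2r// ?nnegrE.
    by move: h1; nra.
  apply: (@le_trans _ _ (2 * n%:R * K * \sum_i Y i y ^+ 2 + E y)).
    apply: (le_trans (ler_sum _ (fun i _ => term i))).
    rewrite !big_split/= sumr_const card_ord -[beta ^+ 2 *+ n]mulr_natl -addrA lerD//.
    under eq_bigr do rewrite -mulr_sumr big_split/= sumr_const card_ord.
    rewrite -mulr_sumr big_split/= sumr_const card_ord -sumrMnl.
    by rewrite le_eqVlt; apply/orP; left; apply/eqP; rewrite sumrMnl -mulr_natl; ring.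
  rewrite /L [leRHS]mulrDl mul1r lerD2r ler_wpM2l ?mulr_ge0//.
  by rewrite /E lerDl mulr_ge0// sqr_ge0.
have := @deriv_on_le _ _ _ _ 0 x (deriv_onN (deriv_onM dE (deriv_on_expR (- L)))).
case/andP: (xl) => x0 xl'; rewrite mulr0 expR0 mulr1 => /(_ (lexx _) x0 xl') H.
have {}H : E x * expR (- L * x) <= E 0.
  rewrite -lerN2; apply: H => z /andP[z0 zx]; rewrite oppr_ge0.
  have zl : 0 < z < l by rewrite z0 (lt_le_trans zx).
  rewrite (_ : _ + _ = (\sum_i 2 * Y i z * lin_rhs M b Y i z - L * E z)
    * expR (- L * z)); last by ring.
  by rewrite mulr_le0_ge0 ?expR_ge0// subr_le0 E'.
apply: (@le_trans _ _ (E x)); first by rewrite lerDl mulr_ge0// sqr_ge0.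
rewrite (_ : E x = E x * expR (- L * x) * expR (L * x)).
  apply: ler_pM => //; rewrite ?expR_ge0 ?mulr_ge0 ?expR_ge0//.
  by rewrite ler_expR ler_wpM2l// ltW.
by rewrite -mulrA -expRD mulNr addNr expR0 mulr1.
Qed.

End LinearODE.

(** * The beam equation as a system of four equations *)

Record state (R : Type) := State {
  sy : R -> R; su : R -> R; sw : R -> R; sv : R -> R }.

Section Beam.
Variable R : realType.
Implicit Types (lam mu x y z t : R) (g h : R -> R) (S T : state R).

Section System.
Variables (l : R) (a q r : R -> R).

(* The fourth-order equation as a first-order system, with [y] the unknown,
   [u = y'], [w = y'' / a] (so [a] is [1 / sigma]) and [v = w' - q u]. *)
Definition beam lam g S : Prop :=
  [/\ deriv_on l (sy S) (su S),
      deriv_on l (su S) (fun x => a x * sw S x),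
      deriv_on l (sw S) (fun x => sv S x + q x * su S x) &
      deriv_on l (sv S) (fun x => lam * r x * sy S x + g x)].

Definition comb (c d : R) S T : state R :=
  State (fun x => c * sy S x + d * sy T x) (fun x => c * su S x + d * su T x)
        (fun x => c * sw S x + d * sw T x) (fun x => c * sv S x + d * sv T x).

Lemma beam_comb (c d : R) lam g h S T : beam lam g S -> beam lam h T ->
  beam lam (fun x => c * g x + d * h x) (comb c d S T).
Proof.
move=> [Sy Su Sw Sv] [Ty Tu Tw Tv]; split => /=.
- exact: deriv_onD (deriv_onZ c Sy) (deriv_onZ d Ty).
- by apply: eq_deriv_on (deriv_onD (deriv_onZ c Su) (deriv_onZ d Tu)) => x _; ring.
- by apply: eq_deriv_on (deriv_onD (deriv_onZ c Sw) (deriv_onZ d Tw)) => x _; ring.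
- by apply: eq_deriv_on (deriv_onD (deriv_onZ c Sv) (deriv_onZ d Tv)) => x _; ring.
Qed.

(** Trades a change of the spectral parameter for a change of forcing. This compares solutions for
    two parameters, and turns a solution for parameter 0 into one for any other. *)
Lemma beam_forcing lam mu g h S :
  (forall x, 0 < x < l -> lam * r x * sy S x + g x = mu * r x * sy S x + h x) ->
  beam lam g S -> beam mu h S.
Proof. by move=> e [? ? ? Sv]; split=> //; exact: eq_deriv_on Sv. Qed.

Hypotheses (l_gt0 : 0 < l) (ca : cont_on l a) (cq : cont_on l q)
  (cr : cont_on l r).

Definition beam_mx lam (i j : 'I_4) : R -> R :=
  match (i : nat), (j : nat) with
  | 0%N, 1%N => fun=> 1
  | 1%N, 2%N => a
  | 2%N, 3%N => fun=> 1
  | 2%N, 1%N => q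
  | 3%N, 0%N => fun x => lam * r x
  | _, _ => fun=> 0
  end.

Definition beam_vec S (i : 'I_4) : R -> R :=
  match (i : nat) with
  | 0%N => sy S | 1%N => su S | 2%N => sw S | _ => sv S
  end.

Definition beam_rhs g (i : 'I_4) : R -> R :=
  if (i : nat) is 3%N then g else fun=> 0.

Lemma beam_mx_cont lam i j : cont_on l (beam_mx lam i j).
Proof.
have c0 (c : R) : cont_on l (fun=> c) by exact: cont_on_cst.
case: i => -[|[|[|[|i]]]] ilt //; case: j => -[|[|[|[|j]]]] jlt //;
  rewrite /beam_mx /=; try exact: c0; try by [].
exact: cont_onM.
Qed.

Lemma beam_lin_ode lam g S : beam lam g S <-> forall i,
  deriv_on l (beam_vec S i) (lin_rhs (beam_mx lam) (beam_rhs g) (beam_vec S) i).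
Proof.
pose o (k : nat) (kP : (k < 4)%N) : 'I_4 := Ordinal kP.
have e k (kP : (k < 4)%N) x :
    lin_rhs (beam_mx lam) (beam_rhs g) (beam_vec S) (o k kP) x =
    match k with
    | 0%N => su S x | 1%N => a x * sw S x | 2%N => sv S x + q x * su S x
    | _ => lam * r x * sy S x + g x end.
  rewrite /lin_rhs !big_ord_recl big_ord0.
  by case: k kP => [|[|[|[|]]]] // kP; rewrite /beam_mx /beam_vec /beam_rhs /=; ring.
split=> [[Sy Su Sw Sv]|H].
  case=> -[|[|[|[|k]]]] kP //; rewrite /beam_vec /=.
  - by apply: eq_deriv_on Sy => x _; rewrite (e 0%N kP).
  - by apply: eq_deriv_on Su => x _; rewrite (e 1%N kP).
  - by apply: eq_deriv_on Sw => x _; rewrite (e 2%N kP).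
  - by apply: eq_deriv_on Sv => x _; rewrite (e 3%N kP).
split.
- by apply: eq_deriv_on (H (o 0%N isT)) => x _; rewrite e.
- by apply: eq_deriv_on (H (o 1%N isT)) => x _; rewrite e.
- by apply: eq_deriv_on (H (o 2%N isT)) => x _; rewrite e.
- by apply: eq_deriv_on (H (o 3%N isT)) => x _; rewrite e.
Qed.

(** The sign is established for the solution built by iteration; [beam_unique] carries it over to
    any other solution. *)
Lemma beam_exists lam g (y0 u0 w0 v0 : R) : cont_on l g ->
  exists S, [/\ beam lam g S,
    [/\ sy S 0 = y0, su S 0 = u0, sw S 0 = w0 & sv S 0 = v0] &
    (forall x, 0 <= x <= l -> [/\ 0 <= a x, 0 <= q x, 0 <= lam * r x & 0 <= g x]) ->
    [/\ 0 <= y0, 0 <= u0, 0 <= w0 & 0 <= v0] ->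
    forall x, 0 <= x <= l ->
      [/\ 0 <= sy S x, 0 <= su S x, 0 <= sw S x & 0 <= sv S x]].
Proof.
move=> cg.
have cb i : cont_on l (beam_rhs g i).
  by case: i => -[|[|[|[|i]]]] ilt //; rewrite /beam_rhs /=; exact: cont_on_cst.
pose d (i : 'I_4) : R :=
  match (i : nat) with 0%N => y0 | 1%N => u0 | 2%N => w0 | _ => v0 end.
have [Y [dY Y0 Ypos]] := lin_ode_exists l_gt0 d (@beam_mx_cont lam) cb.
pose o (k : nat) (kP : (k < 4)%N) : 'I_4 := Ordinal kP.
pose S := State (Y (o 0%N isT)) (Y (o 1%N isT)) (Y (o 2%N isT)) (Y (o 3%N isT)).
have SE : beam_vec S = Y.
  apply/funext => -[[|[|[|[|k]]]] kP] //; rewrite /beam_vec /=;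
  by congr (Y _); apply/val_inj.
exists S; split.
- by apply/beam_lin_ode => i; rewrite SE.
- by split; rewrite /= Y0.
- move=> pos [y00 u00 w00 v00] x xl.
  have P i : 0 <= Y i x.
    apply: Ypos => //.
    + move=> [[|[|[|[|i']]]] iP] [[|[|[|[|j']]]] jP] t /pos[] //= *;
        by rewrite /beam_mx /=.
    + by move=> [[|[|[|[|i']]]] iP] t /pos[] //= *; rewrite /beam_rhs /=.
    + by move=> [[|[|[|[|i']]]] iP].
  by split; exact: P.
Qed.

(** The constant is uniform over [|lam| <= L], as continuity in the parameter requires. It is
    written as a square so that square roots can be taken; [4 E + 1] serves because its square
    dominates [4 E]. *)
Lemma beam_bound (L : R) : exists2 C, 0 < C &
  forall lam g beta S x, `|lam| <= L -> beam lam g S -> 0 <= beta ->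
    (forall t, 0 <= t <= l -> `|g t| <= beta) -> 0 <= x <= l ->
    sy S x ^+ 2 + su S x ^+ 2 + sw S x ^+ 2 + sv S x ^+ 2 <=
    C ^+ 2 * (sy S 0 ^+ 2 + su S 0 ^+ 2 + sw S 0 ^+ 2 + sv S 0 ^+ 2 + beta ^+ 2).
Proof.
have [ka ka0 kaP] := cont_on_bounded l_gt0 ca.
have [kq kq0 kqP] := cont_on_bounded l_gt0 cq.
have [kr kr0 krP] := cont_on_bounded l_gt0 cr.
pose K := 1 + ka + kq + `|L| * kr.
have Lr0 : 0 <= `|L| * kr by rewrite mulr_ge0// ltW.
have K0 : 0 <= K by rewrite /K; lra.
pose E := expR ((2 * 4%:R * K + 1) * l).
have E1 : 0 < E by exact: expR_gt0.
exists (4 * E + 1); first by lra.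
move=> lam g beta S x lamL bS beta0 gb xl.
have MK (i j : 'I_4) t : 0 <= t <= l -> `|beam_mx lam i j t| <= K.
  move=> tl; have := kaP t tl; have := kqP t tl => h1 h2.
  have h3 : `|lam * r t| <= `|L| * kr.
    by rewrite normrM ler_pM ?krP// (le_trans lamL) ?ler_norm.
  case: i => -[|[|[|[|i]]]] ilt //; case: j => -[|[|[|[|j]]]] jlt //;
    rewrite /beam_mx /=; rewrite ?normr0 ?normr1 ?K0//; rewrite /K; lra.
have bb (i : 'I_4) t : 0 <= t <= l -> `|beam_rhs g i t| <= beta.
  by move=> tl; case: i => -[|[|[|[|i]]]] ilt //; rewrite /beam_rhs /= ?normr0// gb.
have /beam_lin_ode dS := bS.
have := lin_ode_bound dS K0 MK beta0 bb xl.
rewrite !big_ord_recl !big_ord0 /beam_vec /= !addr0 !addrA -/E => H.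
apply: (le_trans H).
set A := (X in (X + _) * _); have A0 : 0 <= A by rewrite /A !addr_ge0// sqr_ge0.
have b0 : 0 <= beta ^+ 2 by exact: sqr_ge0.
rewrite (@le_trans _ _ ((4 * E) * (A + beta ^+ 2)))//; first by nra.
rewrite ler_wpM2r ?addr_ge0//; nra.
Qed.

Lemma beam_eq0 lam S : beam lam (fun=> 0) S ->
  [/\ sy S 0 = 0, su S 0 = 0, sw S 0 = 0 & sv S 0 = 0] ->
  forall x, 0 <= x <= l -> [/\ sy S x = 0, su S x = 0, sw S x = 0 & sv S x = 0].
Proof.
move=> bS [y0 u0 w0 v0] x xl.
have [C C0 H] := beam_bound `|lam|.
have := H lam _ 0 S x (lexx _) bS (lexx 0).
rewrite y0 u0 w0 v0 !expr0n /= !addr0 mulr0 normr0 => /(_ (fun _ _ => lexx 0) xl) {}H.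
have := sqr_ge0 (sy S x); have := sqr_ge0 (su S x); have := sqr_ge0 (sw S x).
have := sqr_ge0 (sv S x) => h1 h2 h3 h4.
by split; apply/eqP; rewrite -sqrf_eq0; apply/eqP; lra.
Qed.

Lemma beam_unique lam g S T : beam lam g S -> beam lam g T ->
  [/\ sy S 0 = sy T 0, su S 0 = su T 0, sw S 0 = sw T 0 & sv S 0 = sv T 0] ->
  forall x, 0 <= x <= l ->
    [/\ sy S x = sy T x, su S x = su T x, sw S x = sw T x & sv S x = sv T x].
Proof.
move=> bS bT [y0 u0 w0 v0] x xl.
have b : beam lam (fun=> 0) (comb 1 (-1) S T).
  by apply: beam_forcing (beam_comb 1 (-1) bS bT) => t _; ring.
have [|e1 e2 e3 e4] := beam_eq0 b _ xl; rewrite /=.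
  by rewrite y0 u0 w0 v0; split; ring.
by move: e1 e2 e3 e4 => /=; split; lra.
Qed.

End System.

Lemma beam_sub l l' a q r lam g S : l' <= l -> beam l a q r lam g S ->
  beam l' a q r lam g S.
Proof. by move=> ll [? ? ? ?]; split; apply: deriv_on_sub ll _. Qed.

(** [u] and [v] involve derivatives of odd order and change sign under reflection; [y] and [w] do
    not. *)
Lemma beam_reflect l a q r lam g S : beam l a q r lam g S ->
  beam l (fun x => a (l - x)) (fun x => q (l - x)) (fun x => r (l - x)) lam
    (fun x => g (l - x))
    (State (fun x => sy S (l - x)) (fun x => - su S (l - x))
           (fun x => sw S (l - x)) (fun x => - sv S (l - x))).
Proof.
move=> [Sy Su Sw Sv]; split => /=.
- exact: deriv_on_reflect.
- by apply: eq_deriv_on (deriv_onN (deriv_on_reflect Su)) => x _; ring.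
- by apply: eq_deriv_on (deriv_on_reflect Sw) => x _; ring.
- by apply: eq_deriv_on (deriv_onN (deriv_on_reflect Sv)) => x _; ring.
Qed.

End Beam.

(** * The characteristic determinant *)

Section Spectrum.
Variable R : realType.
Implicit Types (lam mu x y z t : R) (g h : R -> R) (S T : state R).
Variables (l : R) (a q r : R -> R).
Hypotheses (l_gt0 : 0 < l) (ca : cont_on l a) (cq : cont_on l q)
  (cr : cont_on l r).
Hypotheses (a_gt0 : forall x, 0 <= x <= l -> 0 < a x)
  (q_ge0 : forall x, 0 <= x <= l -> 0 <= q x)
  (r_gt0 : forall x, 0 <= x <= l -> 0 < r x).

Local Notation sol := (beam l a q r).
Local Notation zero := (fun=> 0 : R).
Local Notation c0 := (@cont_on0 R l).

Let itvW x : 0 < x < l -> 0 <= x <= l.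
Proof. by case/andP=> x0 xl; rewrite !ltW. Qed.

Let itv0 : 0 <= (0 : R) <= l. Proof. by rewrite lexx ltW. Qed.

Let itvl : 0 <= l <= l. Proof. by rewrite lexx ltW. Qed.

(** The vanishing of [y] descends through the four equations, using [a > 0] to obtain [w = 0]. Its
    contrapositive certifies nontriviality: nonzero initial data or forcing exclude [y = 0]. *)
Lemma beam_y_eq0 lam g S : sol lam g S -> cont_on l g ->
  (forall x, 0 < x < l -> sy S x = 0) -> forall x, 0 <= x <= l ->
  [/\ sy S x = 0, su S x = 0, sw S x = 0, sv S x = 0 & g x = 0].
Proof.
move=> [Sy Su Sw Sv] cg y0 x xl.
have u0 t : 0 < t < l -> su S t = 0 by move=> tl; exact: (deriv_on_cst_eq0 Sy y0 tl).
have w0 t : 0 < t < l -> sw S t = 0.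
  move=> tl; have /eqP := deriv_on_cst_eq0 Su u0 tl.
  by rewrite mulf_eq0 gt_eqF ?a_gt0 ?itvW//= => /eqP.
have v0 t : 0 < t < l -> sv S t = 0.
  by move=> tl; have := deriv_on_cst_eq0 Sw w0 tl; rewrite u0// mulr0 addr0.
have g0 t : 0 < t < l -> g t = 0.
  by move=> tl; have := deriv_on_cst_eq0 Sv v0 tl; rewrite y0// mulr0 add0r.
split.
- exact: (cont_on_eq0 l_gt0 (deriv_on_cont Sy) y0 xl).
- exact: (cont_on_eq0 l_gt0 (deriv_on_cont Su) u0 xl).
- exact: (cont_on_eq0 l_gt0 (deriv_on_cont Sw) w0 xl).
- exact: (cont_on_eq0 l_gt0 (deriv_on_cont Sv) v0 xl).
- exact: (cont_on_eq0 l_gt0 cg g0 xl).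
Qed.

(* With [lam >= 0] the system is cooperative, so nonnegative data propagate. *)
Lemma beam_pos lam S x : 0 <= lam -> sol lam zero S ->
  sy S 0 = 0 -> su S 0 = 0 -> sw S 0 = 0 -> sv S 0 = 1 -> 0 < x <= l ->
  0 < sy S x.
Proof.
move=> lam0 bS y0 u0 w0 v0 /andP[x0 xl].
have [T [bT [Ty0 Tu0 Tw0 Tv0] Tpos]] :=
  beam_exists l_gt0 ca cq cr lam 0 0 0 1 c0.
have E t : 0 <= t <= l -> [/\ sy S t = sy T t, su S t = su T t,
    sw S t = sw T t & sv S t = sv T t].
  by apply: (beam_unique l_gt0 ca cq cr bS bT); rewrite y0 u0 w0 v0.
have {}Tpos t : 0 <= t <= l ->
    [/\ 0 <= sy S t, 0 <= su S t, 0 <= sw S t & 0 <= sv S t].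
  move=> tl; have [-> -> -> ->] := E t tl; apply: Tpos => //.
  by move=> z zl; rewrite (ltW (a_gt0 zl)) q_ge0// mulr_ge0// ltW// r_gt0.
have [Sy Su Sw Sv] := bS.
(* Strict positivity enters through [v(0) = 1] and climbs the chain from [v] to [w], [u] and [y]. *)
have v1 t : 0 <= t <= l -> 1 <= sv S t.
  move=> /andP[t0 tl]; rewrite -v0; apply: (deriv_on_le Sv) => // z /andP[z0 zt].
  have zl : 0 <= z <= l by rewrite ltW//= (le_trans (ltW zt)).
  by rewrite addr0 !mulr_ge0//; [rewrite ltW// r_gt0|case: (Tpos z zl)].
have wpos t : 0 < t <= l -> 0 < sw S t.
  move=> /andP[t0 tl]; rewrite -w0; apply: (deriv_on_lt Sw) => // z /andP[z0 zt].
  have zl : 0 <= z <= l by rewrite ltW//= (le_trans (ltW zt)).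
  have [_ uz _ _] := Tpos z zl.
  by rewrite ltr_pwDl ?mulr_ge0 ?q_ge0// (lt_le_trans ltr01)// v1.
have upos t : 0 < t <= l -> 0 < su S t.
  move=> /andP[t0 tl]; rewrite -u0; apply: (deriv_on_lt Su) => // z /andP[z0 zt].
  have zl : z <= l by rewrite (le_trans (ltW zt)).
  by rewrite mulr_gt0 ?wpos ?a_gt0 ?z0 ?zl// ltW.
rewrite -y0; apply: (deriv_on_lt Sy) => // z /andP[z0 zx].
by rewrite upos// z0 (le_trans (ltW zx)).
Qed.

Definition flow g (cg : cont_on l g) lam (w0 v0 : R) : state R :=
  sval (cid (beam_exists l_gt0 ca cq cr lam 0 0 w0 v0 cg)).

Lemma flowP g (cg : cont_on l g) lam (w0 v0 : R) :
  sol lam g (flow cg lam w0 v0) /\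
  [/\ sy (flow cg lam w0 v0) 0 = 0, su (flow cg lam w0 v0) 0 = 0,
      sw (flow cg lam w0 v0) 0 = w0 & sv (flow cg lam w0 v0) 0 = v0].
Proof.
by have [] := svalP (cid (beam_exists l_gt0 ca cq cr lam 0 0 w0 v0 cg)).
Qed.


Definition wflow lam := flow c0 lam 1 0.
Definition vflow lam := flow c0 lam 0 1.

Lemma wflowP lam : sol lam zero (wflow lam) /\
  [/\ sy (wflow lam) 0 = 0, su (wflow lam) 0 = 0, sw (wflow lam) 0 = 1 &
      sv (wflow lam) 0 = 0].
Proof. exact: flowP. Qed.

Lemma vflowP lam : sol lam zero (vflow lam) /\
  [/\ sy (vflow lam) 0 = 0, su (vflow lam) 0 = 0, sw (vflow lam) 0 = 0 &
      sv (vflow lam) 0 = 1].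
Proof. exact: flowP. Qed.

Lemma vflow_gt0 lam x : 0 <= lam -> 0 < x <= l -> 0 < sy (vflow lam) x.
Proof.
by move=> lam0; have [bS [? ? ? ?]] := vflowP lam; exact: beam_pos bS _ _ _ _.
Qed.

(** The solutions clamped at 0 form an affine plane with coordinates [w(0)] and [v(0)], so the
    conditions at [l] become a linear system in two unknowns. *)
Lemma flow_decomposition lam g (cg : cont_on l g) S : sol lam g S ->
  sy S 0 = 0 -> su S 0 = 0 -> forall x, 0 <= x <= l ->
  sy S x = sy (flow cg lam 0 0) x + (sw S 0 * sy (wflow lam) x + sv S 0 * sy (vflow lam) x)
  /\
  su S x = su (flow cg lam 0 0) x + (sw S 0 * su (wflow lam) x + sv S 0 * su (vflow lam) x).
Proof.
move=> bS y0 u0 x xl.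
have [b1 [y1 u1 w1 v1]] := flowP cg lam 0 0.
have [b2 [y2 u2 w2 v2]] := wflowP lam.
have [b3 [y3 u3 w3 v3]] := vflowP lam.
pose T := comb 1 1 (flow cg lam 0 0) (comb (sw S 0) (sv S 0) (wflow lam) (vflow lam)).
have bT : sol lam g T.
  by apply: beam_forcing (beam_comb 1 1 b1 (beam_comb _ _ b2 b3)) => t _; ring.
have [|-> -> _ _] := beam_unique l_gt0 ca cq cr bS bT _ xl; last first.
  by rewrite /T /=; split; ring.
rewrite /T /= y0 u0 y1 u1 w1 v1 y2 u2 w2 v2 y3 u3 w3 v3.
by split; ring.
Qed.

Lemma flow0 lam x : 0 <= x <= l ->
  sy (flow c0 lam 0 0) x = 0 /\ su (flow c0 lam 0 0) x = 0.
Proof.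
move=> xl; have [b1 e] := flowP c0 lam 0 0.
by have [-> -> _ _] := beam_eq0 l_gt0 ca cq cr b1 e xl.
Qed.

(** The difference of the two flows solves the equation for [mu] with zero initial data and forcing
    [(mu - lam) r y], of size [|mu - lam|]. *)
Lemma flow_lipschitz g (cg : cont_on l g) lam (w0 v0 : R) : exists2 C, 0 <= C &
  forall mu x, `|mu - lam| <= 1 -> 0 <= x <= l ->
  `|sy (flow cg mu w0 v0) x - sy (flow cg lam w0 v0) x| <= C * `|mu - lam| /\
  `|su (flow cg mu w0 v0) x - su (flow cg lam w0 v0) x| <= C * `|mu - lam|.
Proof.
have [b1 [y1 u1 w1 v1]] := flowP cg lam w0 v0.
have [/deriv_on_cont cy _ _ _] := b1.
have [K K0 KP] := cont_on_bounded l_gt0 (cont_onM cr cy).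
have [C C0 CP] := beam_bound l_gt0 ca cq cr (`|lam| + 1).
exists (C * K); first by rewrite mulr_ge0// ltW.
move=> mu x mulam xl.
have [b2 [y2 u2 w2 v2]] := flowP cg mu w0 v0.
pose h x := (mu - lam) * (r x * sy (flow cg lam w0 v0) x).
have b : sol mu h (comb 1 (-1) (flow cg mu w0 v0) (flow cg lam w0 v0)).
  have b1' : sol mu (fun x => g x - h x) (flow cg lam w0 v0).
    by apply: beam_forcing b1 => t _; rewrite /h; ring.
  by apply: beam_forcing (beam_comb 1 (-1) b2 b1') => t _; rewrite /=; ring.
have mu1 : `|mu| <= `|lam| + 1.
  rewrite (_ : mu = lam + (mu - lam)); last by ring.
  by rewrite (le_trans (ler_normD _ _))// lerD2l.
have hb t : 0 <= t <= l -> `|h t| <= `|mu - lam| * K.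
  by move=> tl; rewrite /h normrM ler_wpM2l// KP.
have := CP mu h (`|mu - lam| * K) _ x mu1 b (mulr_ge0 (normr_ge0 _) (ltW K0)) hb xl.
rewrite /= y1 u1 w1 v1 y2 u2 w2 v2.
set dy := 1 * sy _ x + _; set du := 1 * su _ x + _.
set dw := 1 * sw _ x + _; set dv := 1 * sv _ x + _.
set Z := (X in _ <= X).
have -> : Z = (C * (`|mu - lam| * K)) ^+ 2 by rewrite /Z; ring.
move=> H.
have B0 : 0 <= C * (`|mu - lam| * K) by rewrite !mulr_ge0// ltW.
rewrite (_ : sy _ x - _ = dy); last by rewrite /dy; ring.
rewrite (_ : su _ x - _ = du); last by rewrite /du; ring.
rewrite (_ : C * K * _ = C * (`|mu - lam| * K)); last by ring.
have := sqr_ge0 dy; have := sqr_ge0 du; have := sqr_ge0 dw; have := sqr_ge0 dv.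
move=> h1 h2 h3 h4.
by split; rewrite -(ler_pXn2r (n := 2))// ?nnegrE// real_normK ?num_real//; lra.
Qed.

Lemma flow_continuous_y g (cg : cont_on l g) (w0 v0 : R) x : 0 <= x <= l ->
  continuous (fun lam => sy (flow cg lam w0 v0) x).
Proof.
move=> xl lam; have [C C0 CP] := flow_lipschitz cg lam w0 v0.
by apply: (@lipschitz_continuous_at _ _ _ C) => mu mu1; case: (CP mu x mu1 xl).
Qed.

Lemma flow_continuous_u g (cg : cont_on l g) (w0 v0 : R) x : 0 <= x <= l ->
  continuous (fun lam => su (flow cg lam w0 v0) x).
Proof.
move=> xl lam; have [C C0 CP] := flow_lipschitz cg lam w0 v0.
by apply: (@lipschitz_continuous_at _ _ _ C) => mu mu1; case: (CP mu x mu1 xl).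
Qed.

Lemma flow_cont g (cg : cont_on l g) lam (w0 v0 : R) :
  cont_on l (sy (flow cg lam w0 v0)).
Proof. by have [[/deriv_on_cont]] := flowP cg lam w0 v0. Qed.

Lemma flow_continuous_prim g (cg : cont_on l g) h (w0 v0 : R) : cont_on l h ->
  continuous (fun lam => prim (fun x => h x * sy (flow cg lam w0 v0) x) l).
Proof.
move=> ch lam; have [C C0 CP] := flow_lipschitz cg lam w0 v0.
have [K K0 KP] := cont_on_bounded l_gt0 ch.
apply: (@lipschitz_continuous_at _ _ _ (K * C * l)) => mu mu1.
have c1 := cont_onM ch (@flow_cont g cg mu w0 v0).
have c2 := cont_onM ch (@flow_cont g cg lam w0 v0).
rewrite -(primB c1 c2 itvl).
rewrite (_ : K * C * l * _ = K * C * `|mu - lam| * l); last by ring.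
apply: (prim_abs_le (cont_onB c1 c2) itvl) => t /itvW tl.
rewrite -mulrBr normrM -mulrA ler_pM// ?KP//.
by case: (CP mu t mu1 tl).
Qed.

Definition char_det lam :=
  sy (wflow lam) l * su (vflow lam) l - sy (vflow lam) l * su (wflow lam) l.

Lemma char_det_continuous : continuous char_det.
Proof.
move=> lam; apply: cvgB; apply: cvgM;
  by [exact: flow_continuous_y|exact: flow_continuous_u].
Qed.

Definition clamped lam g S :=
  [/\ sol lam g S, sy S 0 = 0, su S 0 = 0, sy S l = 0 & su S l = 0].

Definition nontrivial S := exists2 x, 0 <= x <= l & sy S x != 0.

Lemma char_det_eq0P lam :
  char_det lam = 0 <-> exists2 S, clamped lam zero S & nontrivial S.
Proof.
have [b2 [y2 u2 w2 v2]] := wflowP lam.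
have [b3 [y3 u3 w3 v3]] := vflowP lam.
split=> [D0|[S [bS y0 u0 yl ul] [x xl yx]]].
  have [c [d [cd e1 e2]]] : exists c d : R, [/\ (c != 0) || (d != 0),
      c * sy (wflow lam) l + d * sy (vflow lam) l = 0 &
      c * su (wflow lam) l + d * su (vflow lam) l = 0].
    move: D0; rewrite /char_det; set A1 := sy _ l; set A2 := sy (vflow lam) l.
    set B1 := su (wflow lam) l; set B2 := su _ l => D0.
    (* A kernel vector of the singular matrix is read off a nonzero row; if both rows vanish, any
       vector serves. *)
    have [A0|] := boolP ((A2 != 0) || (- A1 != 0)).
      by exists A2, (- A1); split => //; lra.
    rewrite negb_or !negbK oppr_eq0 => /andP[/eqP A20 /eqP A10].
    have [B0|] := boolP ((B2 != 0) || (- B1 != 0)).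
      by exists B2, (- B1); split => //; [rewrite A20 A10|]; ring.
    rewrite negb_or !negbK oppr_eq0 => /andP[/eqP B20 /eqP B10].
    by exists 1, 0; rewrite A10 A20 B10 B20 oner_eq0; split => //; ring.
  pose S := comb c d (wflow lam) (vflow lam).
  have bS : sol lam zero S.
    by apply: beam_forcing (beam_comb c d b2 b3) => t _; ring.
  exists S.
    by split => //=; rewrite /wflow /vflow ?y2 ?y3 ?u2 ?u3; ring.
  apply: contrapT => nt.
  have S0 x : 0 < x < l -> sy S x = 0.
    move=> /itvW xl; apply: contrapT => /eqP yx; apply: nt.
    by exists x.
  have [_ _ e3 e4 _] := beam_y_eq0 bS c0 S0 itv0.
  move: e3 e4 cd; rewrite /= w2 w3 v2 v3.
  rewrite !mulr1 !mulr0 addr0 add0r => -> ->.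
  by rewrite eqxx.
have dec z zl := flow_decomposition c0 bS y0 u0 (x := z) zl.
have {}dec z (zl : 0 <= z <= l) :
    sy S z = sw S 0 * sy (wflow lam) z + sv S 0 * sy (vflow lam) z /\
    su S z = sw S 0 * su (wflow lam) z + sv S 0 * su (vflow lam) z.
  by have [-> ->] := dec z zl; have [-> ->] := flow0 lam zl; rewrite !add0r.
have [] := dec l itvl; rewrite yl ul => e1 e2.
(* Conversely [(w(0), v(0))] is a kernel vector; the determinant times a nonzero coordinate of it is
   a combination of the vanishing boundary values. *)
have := dec x xl; have [W0|W0] := eqVneq (sw S 0) 0; last first.
  move=> _; apply: (mulfI W0); rewrite mulr0 /char_det.
  rewrite (_ : sw S 0 * _ =
    (sw S 0 * sy (wflow lam) l + sv S 0 * sy (vflow lam) l) * su (vflow lam) l -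
    (sw S 0 * su (wflow lam) l + sv S 0 * su (vflow lam) l) * sy (vflow lam) l);
    last by ring.
  by rewrite -e1 -e2 !mul0r subrr.
have [V0|V0] := eqVneq (sv S 0) 0.
  by move=> [+ _]; rewrite W0 V0 !mul0r addr0 => /eqP; rewrite (negPf yx).
move=> _; apply: (mulfI V0); rewrite mulr0 /char_det.
move: e1 e2; rewrite W0 !mul0r !add0r => /esym/eqP + /esym/eqP.
by rewrite !mulf_eq0 (negPf V0)/= => /eqP-> /eqP->; ring.
Qed.

(** Green's identity. The bracket [(v_S y_T - w_S u_T) - (y_S v_T - u_S w_T)] vanishes at both ends,
    and in its derivative the terms in [a] and [q] cancel. It yields orthogonality, reality of the
    spectrum and the derivative of the work [m]. *)
Lemma clamped_bracket lam mu g h S T : cont_on l g -> cont_on l h ->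
  clamped lam g S -> clamped mu h T ->
  (lam - mu) * prim (fun x => r x * sy S x * sy T x) l =
  prim (fun x => h x * sy S x) l - prim (fun x => g x * sy T x) l.
Proof.
move=> cg ch [[Sy Su Sw Sv] Sy0 Su0 Syl Sul] [[Ty Tu Tw Tv] Ty0 Tu0 Tyl Tul].
have cy := deriv_on_cont Sy; have cz := deriv_on_cont Ty.
have c1 := cont_onM (cont_onM cr cy) cz.
have c2 := cont_onM ch cy; have c3 := cont_onM cg cz.
have c4 := cont_onM (@cont_on_cst _ l (lam - mu)) c1.
have B := deriv_onB (deriv_onB (deriv_onM Sv Ty) (deriv_onM Sw Tu))
  (deriv_onB (deriv_onM Sy Tv) (deriv_onM Su Tw)).
have {}B := eq_deriv_on (g' := fun x => (lam - mu) * (r x * sy S x * sy T x)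
  - (h x * sy S x - g x * sy T x)) _ B.
have {}B := B ltac:(by move=> x _; ring).
have := primE B (cont_onB c4 (cont_onB c2 c3)) itvl.
rewrite (primB c4 (cont_onB c2 c3) itvl) (primB c2 c3 itvl) (primZ _ c1 itvl).
by rewrite Sy0 Su0 Syl Sul Ty0 Tu0 Tyl Tul; lra.
Qed.

(** Integrates the derivative of [v y - w u], which vanishes at both ends. *)
Lemma clamped_energy lam g S : clamped lam g S -> cont_on l g ->
  lam * prim (fun x => r x * sy S x ^+ 2) l + prim (fun x => g x * sy S x) l =
  prim (fun x => q x * su S x ^+ 2) l + prim (fun x => a x * sw S x ^+ 2) l.
Proof.
move=> [[Sy Su Sw Sv] Sy0 Su0 Syl Sul] cg.
have cy := deriv_on_cont Sy; have cu := deriv_on_cont Su.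
have cw := deriv_on_cont Sw.
have c2 f : cont_on l f -> cont_on l (fun x => f x ^+ 2) by move=> cf; exact: cont_onM.
have c1 := cont_onM cr (c2 _ cy); have c3 := cont_onM cg cy.
have c4 := cont_onM cq (c2 _ cu); have c5 := cont_onM ca (c2 _ cw).
have c6 := cont_onM (@cont_on_cst _ l lam) c1.
have B := deriv_onB (deriv_onM Sv Sy) (deriv_onM Sw Su).
have {}B := eq_deriv_on (g' := fun x => lam * (r x * sy S x ^+ 2) + g x * sy S x
  - (q x * su S x ^+ 2 + a x * sw S x ^+ 2)) _ B.
have {}B := B ltac:(by move=> x _; ring).
have := primE B (cont_onB (cont_onD c6 c3) (cont_onD c4 c5)) itvl.
rewrite (primB (cont_onD c6 c3) (cont_onD c4 c5) itvl) (primD c6 c3 itvl).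
rewrite (primD c4 c5 itvl) (primZ _ c1 itvl) Sy0 Su0 Syl Sul; lra.
Qed.

Lemma weight_gt0 g S lam : clamped lam g S -> nontrivial S ->
  0 < prim (fun x => r x * sy S x ^+ 2) l.
Proof.
move=> [[Sy _ _ _] _ _ _ _] [x xl yx].
have cf := cont_onM cr (cont_onM (deriv_on_cont Sy) (deriv_on_cont Sy)).
have f0 t : 0 < t < l -> 0 <= r t * (sy S t * sy S t).
  by move=> /itvW tl; rewrite mulr_ge0 ?(ltW (r_gt0 tl))// -expr2 sqr_ge0.
under eq_fun do rewrite expr2.
rewrite lt_def (prim_ge0 cf)// andbT; apply: contra_neq yx => e.
apply: (cont_on_eq0 l_gt0 (deriv_on_cont Sy)) => // t tl.
have /eqP := prim_eq0 cf f0 e tl.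
by rewrite mulf_eq0 gt_eqF ?r_gt0 ?itvW//= mulf_eq0 orbb => /eqP.
Qed.

(** Zero bending energy forces [a w = 0], so [u] and then [y] keep the value 0 that they have at the
    left end. *)
Lemma bending_gt0 g S lam : clamped lam g S -> nontrivial S ->
  0 < prim (fun x => a x * sw S x ^+ 2) l.
Proof.
move=> [[Sy Su Sw _] y0 u0 _ _] [x xl yx].
have cf := cont_onM ca (cont_onM (deriv_on_cont Sw) (deriv_on_cont Sw)).
have f0 t : 0 < t < l -> 0 <= a t * (sw S t * sw S t).
  by move=> /itvW tl; rewrite mulr_ge0 ?(ltW (a_gt0 tl))// -expr2 sqr_ge0.
under eq_fun do rewrite expr2.
rewrite lt_def (prim_ge0 cf)// andbT; apply: contra_neq yx => e.
have w0 t : 0 < t < l -> a t * sw S t = 0.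
  move=> tl; have /eqP := prim_eq0 cf f0 e tl.
  by rewrite mulf_eq0 gt_eqF ?a_gt0 ?itvW//= mulf_eq0 orbb => /eqP ->; rewrite mulr0.
have uz t : 0 < t < l -> su S t = 0.
  by move=> /itvW tl; rewrite (deriv_on_eq_cst Su w0 tl).
by rewrite (deriv_on_eq_cst Sy uz xl).
Qed.

Lemma clamped_eigenvalue_gt0 lam S : clamped lam zero S -> nontrivial S -> 0 < lam.
Proof.
move=> bS ntS.
have := clamped_energy bS c0.
rewrite (_ : prim (fun x => 0 * sy S x) l = 0) ?addr0; last first.
  under eq_fun do rewrite mul0r.
  by rewrite (primE (deriv_on_cst l 0) c0 itvl) subrr.
have W := weight_gt0 bS ntS; have B := bending_gt0 bS ntS.
have Q : 0 <= prim (fun x => q x * su S x ^+ 2) l.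
  have [[_ Su _ _] _ _ _ _] := bS; have cu := deriv_on_cont Su.
  apply: (prim_ge0 (cont_onM cq (cont_onM cu cu)) itvl) => t /itvW tl.
  by rewrite mulr_ge0 ?q_ge0// -expr2 sqr_ge0.
move=> e; have : 0 < lam * prim (fun x => r x * sy S x ^+ 2) l by rewrite e; lra.
by rewrite pmulr_lgt0.
Qed.

Lemma char_det_gt0 lam : char_det lam = 0 -> 0 < lam.
Proof. by move/char_det_eq0P => [S]; exact: clamped_eigenvalue_gt0. Qed.

(** If [w(0) = 0], then [y] is [v(0)] times the [y] of [vflow lam], which is positive at [l] because
    [lam > 0]; thus [y(l) = 0] gives [v(0) = 0]. *)
Lemma clamped_moment lam S : clamped lam zero S -> nontrivial S -> sw S 0 != 0.
Proof.
move=> cS ntS; have lam0 := ltW (clamped_eigenvalue_gt0 cS ntS).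
have [bS y0 u0 yl ul] := cS; case: ntS => x xl; apply: contra_neq => w0.
have dec z (zl : 0 <= z <= l) : sy S z = sv S 0 * sy (vflow lam) z.
  have [-> _] := flow_decomposition c0 bS y0 u0 zl.
  by have [-> _] := flow0 lam zl; rewrite w0 mul0r !add0r.
have := dec l itvl; rewrite yl => /esym/eqP; rewrite mulf_eq0 => /orP[/eqP v0|].
  by rewrite dec// v0 mul0r.
by rewrite gt_eqF// vflow_gt0// l_gt0 lexx.
Qed.

(** The combination of [T] and [S] with [w(0) = 0] is again clamped, so [clamped_moment] makes it
    trivial. *)
Lemma clamped_simple lam S T : clamped lam zero S -> nontrivial S ->
  clamped lam zero T -> exists c, forall x, 0 <= x <= l -> sy T x = c * sy S x.
Proof.
move=> cS ntS [bT Ty0 Tu0 Tyl Tul]; have w0 := clamped_moment cS ntS.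
have [bS Sy0 Su0 Syl Sul] := cS.
exists (sw T 0 / sw S 0) => x xl.
have cU k : clamped lam zero (comb 1 k T S).
  split=> /=; rewrite ?Ty0 ?Tu0 ?Tyl ?Tul ?Sy0 ?Su0 ?Syl ?Sul; try by ring.
  by apply: beam_forcing (beam_comb 1 k bT bS) => t _; ring.
set k := sw T 0 / sw S 0.
have : sw (comb 1 (- k) T S) 0 == 0 by rewrite /= mulNr divfK// mul1r subrr.
have [yU _|/eqP yU] := pselect (sy (comb 1 (- k) T S) x = 0).
  by move: yU => /=; lra.
by rewrite (negPf (clamped_moment (cU (- k)) _))//; exists x.
Qed.

(* The eigenfunctions, normalised by [w(0) = 1], depend continuously on the
   eigenvalue, and distinct ones are orthogonal. *)
Lemma char_det_isolated lam : char_det lam = 0 ->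
  exists2 d, 0 < d & forall mu, `|mu - lam| < d -> char_det mu = 0 -> mu = lam.
Proof.
move=> D0; have lam0 := char_det_gt0 D0.
(* [N mu] is normalised by [w(0) = 1], and [c mu] imposes [y(l) = 0]; the last condition [u(l) = 0]
   then holds when the determinant vanishes. *)
pose c mu := - (sy (wflow mu) l / sy (vflow mu) l).
pose N mu := comb 1 (c mu) (wflow mu) (vflow mu).
have cN mu : 0 < mu -> char_det mu = 0 -> clamped mu zero (N mu).
  move=> mu0 Dmu.
  have [b2 [y2 u2 w2 v2]] := wflowP mu.
  have [b3 [y3 u3 w3 v3]] := vflowP mu.
  have P0 : sy (vflow mu) l != 0.
    by rewrite gt_eqF// vflow_gt0 ?(ltW mu0)// l_gt0 lexx.
  split; first (by apply: beam_forcing (beam_comb 1 (c mu) b2 b3) => t _; ring).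
  - by rewrite /= y2 y3; ring.
  - by rewrite /= u2 u3; ring.
  - by rewrite /= /c; field.
  - apply: (mulfI P0); rewrite mulr0 /= /c; move: Dmu; rewrite /char_det => Dmu.
    rewrite -[RHS]oppr0 -Dmu; field; exact: P0.
have ntN : nontrivial (N lam).
  apply: contrapT => nt; have [b _ _ _ _] := cN lam lam0 D0.
  have S0 x : 0 < x < l -> sy (N lam) x = 0.
    by move=> /itvW xl; apply: contrapT => /eqP yx; apply: nt; exists x.
  have [_ _ /eqP + _ _] := beam_y_eq0 b c0 S0 itv0.
  have [_ [_ _ w2 _]] := wflowP lam.
  have [_ [_ _ w3 _]] := vflowP lam.
  by rewrite /= w2 w3 mulr1 mulr0 addr0 oner_eq0.
have cy mu (w0 v0 : R) := @flow_cont _ c0 mu w0 v0.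
pose h x := r x * sy (N lam) x.
have ch : cont_on l h.
  by have [[/deriv_on_cont cNy _ _ _] _ _ _ _] := cN lam lam0 D0; exact: cont_onM.
(* The weighted scalar product of [N lam] and [N mu], expanded so that its continuity in [mu]
   follows from that of the flows. *)
pose K mu := prim (fun x => h x * sy (wflow mu) x) l +
  c mu * prim (fun x => h x * sy (vflow mu) x) l.
have KE mu : K mu = prim (fun x => r x * sy (N lam) x * sy (N mu) x) l.
  have c1 := cont_onM ch (cy mu 1 0); have c2 := cont_onM ch (cy mu 0 1).
  rewrite /K -(primZ _ c2 itvl) -(primD c1 (cont_onM (@cont_on_cst _ l (c mu)) c2) itvl).
  by apply: eq_prim => t _; rewrite /h /=; ring.
have K0 : 0 < K lam.
  rewrite KE; under eq_fun do rewrite -mulrA -expr2.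
  exact: weight_gt0 (cN _ lam0 D0) ntN.
have Kc : {for lam, continuous K}.
  apply: cvgD; first exact: flow_continuous_prim.
  apply: cvgM; last exact: flow_continuous_prim.
  apply: cvgN; apply: cvgM; first exact: flow_continuous_y.
  apply: cvgV; last exact: flow_continuous_y.
  by rewrite gt_eqF// vflow_gt0 ?(ltW lam0)// l_gt0 lexx.
have /cvgr_gt/(_ 0 K0)[d /= d0 dP] := Kc.
exists d => // mu mud Dmu; apply: contrapT => /eqP neq.
(* For a second eigenvalue [mu], orthogonality gives [K mu = 0], against [K > 0] near [lam]. *)
have := clamped_bracket c0 c0 (cN lam lam0 D0) (cN mu (char_det_gt0 Dmu) Dmu).
rewrite -KE (_ : prim (fun x => 0 * sy (N lam) x) l = 0); last first.
  under eq_fun do rewrite mul0r.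
  by rewrite (primE (deriv_on_cst l 0) c0 itvl) subrr.
rewrite (_ : prim (fun x => 0 * sy (N mu) x) l = 0); last first.
  under eq_fun do rewrite mul0r.
  by rewrite (primE (deriv_on_cst l 0) c0 itvl) subrr.
rewrite subrr => /eqP; rewrite mulf_eq0 subr_eq0 eq_sym (negPf neq)/=.
by rewrite gt_eqF//; apply: dP; rewrite /= distrC.
Qed.

End Spectrum.

(** * Unboundedness of the spectrum *)

Lemma two_equations_three_unknowns (F : fieldType) (y u : 'I_3 -> F) :
  exists k : 'I_3 -> F, [/\ exists i, k i != 0, \sum_i k i * y i = 0 &
    \sum_i k i * u i = 0].
Proof.
pose A : 'M[F]_(3, 2) := \matrix_(i, j) if j == ord0 then y i else u i.
have /rowV0Pn[v /sub_kermxP vA /rV0Pn[i vi]] : kermx A != 0.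
  by rewrite -mxrank_eq0 mxrank_ker -lt0n subn_gt0 ltnS rank_leq_col.
exists (fun i => v 0 i); split; first by exists i.
- transitivity ((v *m A) 0 ord0); last by rewrite vA mxE.
  by rewrite mxE; apply: eq_bigr => j _; rewrite !mxE.
- transitivity ((v *m A) 0 ord_max); last by rewrite vA mxE.
  by rewrite mxE; apply: eq_bigr => j _; rewrite !mxE.
Qed.

Section Unbounded.
Variable R : realType.
Implicit Types (lam mu x y z t : R) (g h : R -> R) (S T : state R).
Variables (l : R) (a q r : R -> R).
Hypotheses (l_gt0 : 0 < l) (ca : cont_on l a) (cq : cont_on l q)
  (cr : cont_on l r).
Hypotheses (a_gt0 : forall x, 0 <= x <= l -> 0 < a x)
  (q_ge0 : forall x, 0 <= x <= l -> 0 <= q x)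
  (r_gt0 : forall x, 0 <= x <= l -> 0 < r x).

Local Notation sol := (beam l a q r).
Local Notation zero := (fun=> 0 : R).
Local Notation char_det := (char_det l_gt0 ca cq cr).
Local Notation flow := (flow l_gt0 ca cq cr).
Local Notation wflow := (wflow l_gt0 ca cq cr).
Local Notation vflow := (vflow l_gt0 ca cq cr).
Local Notation clamped := (clamped l a q r).

Let itvW x : 0 < x < l -> 0 <= x <= l.
Proof. by case/andP=> x0 xl; rewrite !ltW. Qed.

Let itv0 : 0 <= (0 : R) <= l. Proof. by rewrite lexx ltW. Qed.

Let itvl : 0 <= l <= l. Proof. by rewrite lexx ltW. Qed.

Local Notation c0 := (@cont_on0 R l).

Lemma clamped_unique lam g S T : char_det lam != 0 -> clamped lam g S ->
  clamped lam g T -> forall x, 0 <= x <= l -> sy S x = sy T x.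
Proof.
move=> D0 [bS y0 u0 yl ul] [bT z0 t0 zl tl] x xl.
apply: contrapT => ne; apply: (negP D0); apply/eqP/char_det_eq0P => //.
exists (comb 1 (-1) S T); last first.
  by exists x => //=; rewrite mul1r mulN1r subr_eq0; apply/eqP.
split=> /=; rewrite ?y0 ?u0 ?yl ?ul ?z0 ?t0 ?zl ?tl; try by ring.
by apply: beam_forcing (beam_comb 1 (-1) bS bT) => t _; ring.
Qed.

Section Forced.
Variables (g : R -> R) (cg : cont_on l g).
Local Notation p lam := (flow cg lam 0 0).

(* Cramer's rule for the two boundary conditions at [l]. *)
Definition forced lam : state R :=
  comb 1 1 (p lam) (comb
    ((sy (vflow lam) l * su (p lam) l - sy (p lam) l * su (vflow lam) l) /
      char_det lam)
    ((sy (p lam) l * su (wflow lam) l - sy (wflow lam) l * su (p lam) l) /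
      char_det lam)
    (wflow lam) (vflow lam)).

Lemma forced_clamped lam : char_det lam != 0 -> clamped lam g (forced lam).
Proof.
move=> D0; rewrite /forced.
have [b1 [y1 u1 w1 v1]] := flowP l_gt0 ca cq cr cg lam 0 0.
have [b2 [y2 u2 w2 v2]] := wflowP l_gt0 ca cq cr lam.
have [b3 [y3 u3 w3 v3]] := vflowP l_gt0 ca cq cr lam.
have b al be : sol lam g (comb 1 1 (p lam) (comb al be (wflow lam) (vflow lam))).
  by apply: beam_forcing (beam_comb 1 1 b1 (beam_comb al be b2 b3)) => t _; ring.
split.
- exact: b.
- by rewrite /= y1 y2 y3 !(mulr0, addr0).
- by rewrite /= u1 u2 u3 !(mulr0, addr0).
- by move: D0; rewrite /char_det /= => D0; field.
- by move: D0; rewrite /char_det /= => D0; field.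
Qed.

Lemma forced_continuous h lam : cont_on l h -> char_det lam != 0 ->
  {for lam, continuous (fun mu => prim (fun x => h x * sy (forced mu) x) l)}.
Proof.
move=> ch D0.
pose al mu := (sy (vflow mu) l * su (p mu) l - sy (p mu) l * su (vflow mu) l) /
  char_det mu.
pose be mu := (sy (p mu) l * su (wflow mu) l - sy (wflow mu) l * su (p mu) l) /
  char_det mu.
have -> : (fun mu => prim (fun x => h x * sy (forced mu) x) l) = fun mu =>
    prim (fun x => h x * sy (p mu) x) l + (al mu * prim (fun x => h x * sy (wflow mu) x) l
    + be mu * prim (fun x => h x * sy (vflow mu) x) l).
  apply/funext => mu.
  have c1 := cont_onM ch (@flow_cont _ _ _ _ _ l_gt0 ca cq cr _ cg mu 0 0).
  have c2 := cont_onM ch (@flow_cont _ _ _ _ _ l_gt0 ca cq cr _ c0 mu 1 0).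
  have c3 := cont_onM ch (@flow_cont _ _ _ _ _ l_gt0 ca cq cr _ c0 mu 0 1).
  have c2' := cont_onM (@cont_on_cst _ l (al mu)) c2.
  have c3' := cont_onM (@cont_on_cst _ l (be mu)) c3.
  rewrite -(primZ _ c2 itvl) -(primZ _ c3 itvl) -(primD c2' c3' itvl).
  rewrite -(primD c1 (cont_onD c2' c3') itvl).
  by apply: eq_prim => t _; rewrite /= -/(al mu) -/(be mu); ring.
have cy g' (cg' : cont_on l g') (w0 v0 : R) : {for lam, continuous (fun mu =>
    sy (flow cg' mu w0 v0) l)} by exact: flow_continuous_y.
have cu g' (cg' : cont_on l g') (w0 v0 : R) : {for lam, continuous (fun mu =>
    su (flow cg' mu w0 v0) l)} by exact: flow_continuous_u.
have cD : {for lam, continuous (fun mu => (char_det mu)^-1)}.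
  by apply: cvgV => //; exact: char_det_continuous.
apply: cvgD; first exact: flow_continuous_prim.
apply: cvgD; apply: cvgM; try exact: flow_continuous_prim; apply: cvgM => //.
  by apply: cvgB; apply: cvgM; by [exact: cy|exact: cu].
by apply: cvgB; apply: cvgM; by [exact: cy|exact: cu].
Qed.

End Forced.

(* If there is no eigenvalue above [L], the function [m = int g y_lam] satisfies
   the Riccati inequality [m' >= m^2 / C] on [L, +oo[, so it cannot be positive. *)
Lemma forced_work_le0 (L lam0 : R) g S : (forall lam, L <= lam -> char_det lam != 0) ->
  L < lam0 -> cont_on l g -> clamped lam0 g S ->
  prim (fun x => g x * sy S x) l <= 0.
Proof.
move=> DL lam0L cg cS; rewrite leNgt; apply/negP => mS.
pose Y := forced cg.
have cY lam : L <= lam -> clamped lam g (Y lam) by move=> /DL; exact: forced_clamped.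
pose m lam := prim (fun x => g x * sy (Y lam) x) l.
pose J lam mu := prim (fun x => r x * sy (Y mu) x * sy (Y lam) x) l.
have m0 : 0 < m lam0.
  rewrite /m; move: mS; congr (0 < _); apply: eq_prim => t tl; congr (_ * _).
  by apply: clamped_unique cS (cY _ (ltW lam0L)) _ tl; exact: DL (ltW _).
have cont_y lam : L <= lam -> cont_on l (sy (Y lam)).
  by move=> /cY[[/deriv_on_cont]].
have mJ lam mu : L <= lam -> L <= mu -> m lam - m mu = J lam mu * (lam - mu).
  move=> lamL muL.
  have := clamped_bracket l_gt0 cr cg cg (cY mu muL) (cY lam lamL).
  by rewrite -/(m lam) -/(m mu) -/(J lam mu); lra.
(* By Green's identity the difference quotient of [m] is exactly [J lam mu], so Caratheodory's
   criterion only asks for continuity in [lam]. The derivative is two-sided, hence the strict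
   [L < mu]. *)
have dm mu : L < mu -> is_derive mu 1 m (J mu mu).
  move=> muL; apply/is_derive1_caratheodory.
  exists (fun z => if z == mu then J mu mu else (m z - m mu) / (z - mu)).
  split; last by rewrite eqxx.
    move=> z; case: eqP => [->|/eqP zmu]; first by rewrite !subrr mulr0.
    by rewrite divfK// subr_eq0.
  have Jc : {for mu, continuous (fun lam => J lam mu)}.
    apply: forced_continuous; last exact: DL (ltW _).
    exact: cont_onM (cont_y _ (ltW muL)).
  rewrite /prop_for /continuous_at eqxx; apply: cvg_trans Jc.
  apply: near_eq_cvg; near=> z.
  case: eqP => [->//|/eqP zmu]; rewrite mJ ?mulfK ?subr_eq0//; last exact: ltW.
  by apply: ltW; near: z; exact: lt_nbhsr.
have J0 mu : L <= mu -> 0 <= J mu mu.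
  move=> muL; have cy := cont_y mu muL.
  apply: (prim_ge0 (cont_onM (cont_onM cr cy) cy) itvl) => t /itvW tl.
  by rewrite -mulrA mulr_ge0 ?(ltW (r_gt0 tl))// -expr2 sqr_ge0.
have mle mu : lam0 <= mu -> m lam0 <= m mu.
  rewrite le_eqVlt => /predU1P[->//|lamu].
  have [||c] := @MVT _ m (fun mu => J mu mu) _ _ lamu.
  - move=> x; rewrite in_itv/= => /andP[x0 _]; apply: dm; exact: lt_trans x0.
  - apply: derivable_within_continuous => x; rewrite in_itv/= => /andP[x0 _].
    by have [] := dm x (lt_le_trans lam0L x0).
  rewrite in_itv/= => /andP[c1 c2] e; rewrite -subr_ge0 e mulr_ge0 ?subr_ge0 ?(ltW lamu)//.
  by apply: J0; apply: ltW; exact: lt_trans c1.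
have r_neq0 x : 0 <= x <= l -> r x != 0 by move=> /r_gt0/lt0r_neq0.
have cg2 := cont_onM (cont_onM cg cg) (cont_onV r_neq0 cr).
(* The Cauchy-Schwarz constant for the weight [r]; the added 1 makes it positive. *)
pose C := prim (fun x => g x * g x / r x) l + 1.
have C0 : 0 < C.
  rewrite ltr_pwDr//; apply: (prim_ge0 cg2 itvl) => t /itvW tl.
  by rewrite divr_ge0 ?(ltW (r_gt0 tl))// -expr2 sqr_ge0.
have CS mu : lam0 <= mu -> m mu ^+ 2 <= C * J mu mu.
  move=> lamu; have muL : L <= mu by rewrite (le_trans (ltW lam0L)).
  have mp : 0 < m mu by rewrite (lt_le_trans m0) ?mle.
  have cy := cont_y mu muL.
  (* Expanding the integral of [(g - s r y)^2 / r >= 0] gives [2 s m <= C - 1 + s^2 J]. This [s]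
     makes the left side [2 C], whence [m^2 <= C J]. *)
  pose s := C / m mu.
  have c1 := cont_onM cg cy; have c2 := cont_onM (cont_onM cr cy) cy.
  have c1' := cont_onM (@cont_on_cst _ l (2 * s)) c1.
  have c2' := cont_onM (@cont_on_cst _ l (s ^+ 2)) c2.
  have := @prim_ge0 _ l _ l (cont_onD (cont_onB cg2 c1') c2') itvl.
  rewrite (primD (cont_onB cg2 c1') c2' itvl) (primB cg2 c1' itvl).
  rewrite (primZ _ c1 itvl) (primZ _ c2 itvl) -/(m mu) -/(J mu mu) => H.
  have {H} : 0 <= C - 1 - 2 * s * m mu + s ^+ 2 * J mu mu.
    rewrite /C addrK; apply: H => t /itvW tl; have rt := r_gt0 tl.
    rewrite (_ : _ + _ = (g t - s * r t * sy (Y mu) t) ^+ 2 / r t); last first.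
      by field; exact: lt0r_neq0.
    by rewrite divr_ge0 ?sqr_ge0 ?ltW.
  rewrite (_ : 2 * s * m mu = 2 * C); last by rewrite /s; field; exact: lt0r_neq0.
  move=> H; have : C <= s ^+ 2 * J mu mu by lra.
  rewrite /s (_ : _ * J mu mu = C * (C * J mu mu / m mu ^+ 2)); last first.
    by field; exact: lt0r_neq0.
  by rewrite -{1}(mulr1 C) ler_pM2l// ler_pdivlMr ?exprn_gt0// mul1r.
(* [1/m] decreases at rate at least [1/C], so it would be nonpositive at [T]. *)
pose T := lam0 + C / m lam0.
have lT : lam0 < T by rewrite ltrDl divr_gt0.
have mpos mu : lam0 <= mu -> 0 < m mu by move=> lamu; rewrite (lt_le_trans m0) ?mle.
have dN mu : lam0 <= mu ->
    is_derive mu 1 (fun mu => (m mu)^-1) (- (m mu) ^- 2 *: J mu mu).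
  move=> lamu; apply: is_deriveV; first by rewrite gt_eqF ?mpos.
  by apply: dm; exact: lt_le_trans lamu.
have [||c] := @MVT _ (fun mu => (m mu)^-1) (fun mu => - (m mu) ^- 2 *: J mu mu) _ _ lT.
- by move=> x; rewrite in_itv/= => /andP[x0 _]; exact: dN (ltW x0).
- apply: derivable_within_continuous => x; rewrite in_itv/= => /andP[x0 _].
  by have [] := dN x x0.
rewrite in_itv/= => /andP[c1 c2]; rewrite /GRing.scale/= => e.
have mc := mpos c (ltW c1); have CSc := CS c (ltW c1).
have : 0 < (m T)^-1 by rewrite invr_gt0 mpos// ltW.
have : (m T)^-1 - (m lam0)^-1 <= - (m lam0)^-1.
  rewrite e /T addrC addKr mulNr mulNr lerN2.
  rewrite (_ : _ * _ * _ = (m lam0)^-1 * (C * J c c / m c ^+ 2)); last first.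
    by field; rewrite !lt0r_neq0.
  by rewrite ler_peMr ?invr_ge0 ?(ltW m0)// ler_pdivlMr ?exprn_gt0// mul1r.
lra.
Unshelve. all: by end_near. Qed.

Definition tent (c d : R) : R -> R := fun x => Num.max 0 (d - `|x - c|).

Lemma tent_continuous (c d : R) : continuous (tent c d).
Proof.
move=> x; apply: (@continuous_max _ _ (fun=> 0) (fun x => d - `|x - c|)).
  exact: cvg_cst.
apply: cvgB; first exact: cvg_cst.
by apply: cvg_norm; apply: cvgB; [exact: cvg_id|exact: cvg_cst].
Qed.

(* Start from zero data at [0] with a combination of three tents supported in
   [[x0, l]], chosen to meet the two boundary conditions at [l]. *)
Lemma localized_clamped x0 : 0 < x0 < l -> exists g S,
  [/\ cont_on l g, clamped 0 g S, nontrivial l S &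
      forall x, 0 <= x <= x0 -> sy S x = 0 /\ su S x = 0].
Proof.
move=> /andP[x00 x0l].
(* Three adjacent tents of half-width [d] fill [[x0, l]]: one more than there are conditions at [l],
   and with disjoint interiors. *)
pose d := (l - x0) / 6.
have d0 : 0 < d by rewrite divr_gt0// subr_gt0.
have lE : l = x0 + 6 * d by rewrite /d; field.
pose c (k : 'I_3) : R := x0 + (2 * k%:R + 1) * d.
have cg k : cont_on l (tent (c k) d).
  exact: (continuous_cont_on (@tent_continuous (c k) d)).
pose p k := flow (cg k) 0 0 0.
have pP k := flowP l_gt0 ca cq cr (cg k) 0 0 0.
have kR0 (k : 'I_3) : 0 <= k%:R :> R by exact: ler0n.
have p0 k x : 0 <= x <= x0 -> sy (p k) x = 0 /\ su (p k) x = 0.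
  move=> xx0; have [b i] := pP k.
  have b' : beam x0 a q r 0 zero (p k).
    apply: beam_forcing (beam_sub (ltW x0l) b) => t /andP[t0 tx].
    congr (_ + _); rewrite /tent; apply/max_idPl; rewrite subr_le0.
    rewrite distrC (le_trans _ (ler_norm _))// /c.
    by have := mulr_ge0 (kR0 k) (ltW d0); nra.
  have sub f : cont_on l f -> cont_on x0 f by exact: cont_on_sub (ltW x0l).
  by have [] := beam_eq0 x00 (sub _ ca) (sub _ cq) (sub _ cr) b' i xx0.
have [k [[i ki] ky ku]] := two_equations_three_unknowns
  (fun k => sy (p k) l) (fun k => su (p k) l).
have [j0 [j1 [j2 jE]]] : exists j0 j1 j2 : 'I_3, forall f : 'I_3 -> R,
    \sum_k f k = f j0 + f j1 + f j2.
  exists ord0, (lift ord0 ord0), (lift ord0 (lift ord0 ord0)) => f.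
  by rewrite !big_ord_recl big_ord0 addr0 addrA.
pose S := comb 1 (k j2) (comb (k j0) (k j1) (p j0) (p j1)) (p j2).
pose g x := \sum_j k j * tent (c j) d x.
have cgg : cont_on l g.
  by apply: cont_on_sum => j; apply: cont_onM => //; exact: cont_on_cst.
have SE x : sy S x = \sum_j k j * sy (p j) x /\ su S x = \sum_j k j * su (p j) x.
  by rewrite !jE /S /=; split; ring.
have bS : sol 0 g S.
  have [b0 _] := pP j0; have [b1 _] := pP j1; have [b2 _] := pP j2.
  apply: beam_forcing (beam_comb 1 (k j2) (beam_comb (k j0) (k j1) b0 b1) b2) => t _.
  by rewrite /g jE; ring.
have S0 x : 0 <= x <= x0 -> sy S x = 0 /\ su S x = 0.
  move=> xx0; have [-> ->] := SE x; split; rewrite big1// => j _;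
    by have [e1 e2] := p0 j x xx0; rewrite ?e1 ?e2 mulr0.
exists g, S; split => //.
- have [a0 b0] := S0 0 ltac:(by rewrite lexx ltW).
  have [e1 e2] := SE l.
  by split => //; [rewrite e1|rewrite e2].
(* If [y] vanished, so would the forcing; but at the centre of the tent number [i] it equals
   [k i * d], with [k i != 0]. *)
- apply: contrapT => nt.
  have y0 x : 0 < x < l -> sy S x = 0.
    by move=> /itvW xl; apply: contrapT => /eqP yx; apply: nt; exists x.
  have i2 : i%:R <= 2 :> R by rewrite (ler_nat _ i 2) -ltnS.
  have ci : 0 <= c i <= l.
    by rewrite lE /c; apply/andP; split; have := mulr_ge0 (kR0 i) (ltW d0); nra.
  have [_ _ _ _] := beam_y_eq0 l_gt0 a_gt0 bS cgg y0 ci.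
  rewrite /g (bigD1 i)//= big1 ?addr0.
    rewrite /tent subrr normr0 subr0 (max_idPr (ltW d0)) => /eqP.
    by rewrite mulf_eq0 (negPf ki) gt_eqF.
  move=> j ji; rewrite /tent (max_idPl _) ?mulr0// subr_le0.
  rewrite (_ : c i - c j = (i%:R - j%:R) * 2 * d); last by rewrite /c; ring.
  rewrite 2!normrM (gtr0_norm d0) (@ger0_norm _ 2)// ler_peMl ?(ltW d0)//.
  suff : 1 <= `|i%:R - j%:R : R| by lra.
  have [ij|ij] := leqP i j.
    have {}ij : (i < j)%N by rewrite ltn_neqAle eq_sym ji ij.
    by rewrite distrC -natrB ?(ltnW ij)// normr_nat ler1n subn_gt0.
  by rewrite -natrB ?(ltnW ij)// normr_nat ler1n subn_gt0.
Qed.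

(* The inequality of Poincare on [[l - eps, l]] makes the bending energy dominate
   [lam0 int r y^2] for small [eps]. *)
Lemma exists_positive_work (lam0 : R) : 0 <= lam0 -> exists g S,
  [/\ cont_on l g, clamped lam0 g S & 0 < prim (fun x => g x * sy S x) l].
Proof.
move=> lam00.
have [A A0 AP] := cont_on_bounded l_gt0 ca.
have [M M0 MP] := cont_on_bounded l_gt0 cr.
(* The estimates below give [lam0 int r y^2 <= B eps^3 I0], with [I0] the bending energy; as
   [eps <= 1], the condition [B eps < 1] suffices. *)
pose B := lam0 * M * A * l.
have B0 : 0 <= B by rewrite !mulr_ge0// ltW.
have [eps [e0 el e1 eB]] : exists eps, [/\ 0 < eps, eps < l, eps <= 1 & B * eps < 1].
  have B1 : 0 < 1 + B by lra.
  exists (Num.min (l / 2) (1 + B)^-1); split.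
  - by rewrite lt_min divr_gt0// invr_gt0.
  - by rewrite gt_min ltr_pdivrMr// ltr_pMr// ltr1n.
  - by rewrite ge_min invf_le1// lerDl B0 orbT.
  - apply: (@le_lt_trans _ _ (B / (1 + B))).
      by rewrite ler_wpM2l// ge_min lexx orbT.
    by rewrite ltr_pdivrMr// mul1r ltrDr.
have [|g [S [cg cS nS S0]]] := @localized_clamped (l - eps).
  by rewrite subr_gt0 el ltrBlDr ltrDl.
have := bending_gt0 l_gt0 ca a_gt0 cS nS.
set I0 := prim _ l => I0p.
have E : I0 <= prim (fun x => g x * sy S x) l.
  have := clamped_energy l_gt0 ca cq cr cS cg; rewrite mul0r add0r => ->.
  rewrite lerDr; have [[_ /deriv_on_cont cu _ _] _ _ _ _] := cS.
  apply: (prim_ge0 (cont_onM cq (cont_onM cu cu)) itvl) => t /itvW tl.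
  by rewrite mulr_ge0 ?q_ge0// -expr2 sqr_ge0.
have [bS y0 u0 yl ul] := cS; have [Sy Su Sw Sv] := bS.
have cy := deriv_on_cont Sy; have cw := deriv_on_cont Sw.
pose x0 := l - eps.
have cP := cont_onM ca (cont_onM cw cw).
pose P := prim (fun x => a x * sw S x ^+ 2).
have dP : deriv_on l P (fun x => a x * sw S x ^+ 2) by exact: prim_deriv.
have x0p : 0 <= x0 by rewrite /x0 subr_ge0 ltW.
have [yx0 ux0] : sy S x0 = 0 /\ su S x0 = 0 by apply: S0; rewrite lexx andbT.
have w2 t : 0 < t < l -> 0 <= a t * sw S t ^+ 2.
  by move=> /itvW tl; rewrite mulr_ge0 ?sqr_ge0 ?ltW ?a_gt0.
have u2 x : x0 <= x <= l -> su S x ^+ 2 <= A * eps * I0.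
  move=> /andP[x0x xl].
  have xe : x - x0 <= eps by rewrite /x0; lra.
  have Ae : 0 < A * eps by rewrite mulr_gt0.
  (* Cauchy-Schwarz for [u = int a w] from [x0]: [F] is nondecreasing since [F' >= a (s + w)^2], and
     this [s] minimises the resulting bound [s^2 A eps + 2 s u(x) + I0]. *)
  pose s := - (su S x / (A * eps)).
  pose F t := s ^+ 2 * A * (t - x0) + 2 * s * su S t + P t.
  have dF : deriv_on l F (fun t => s ^+ 2 * A + 2 * s * (a t * sw S t) +
      a t * sw S t ^+ 2).
    have := deriv_onD (deriv_onD (deriv_onZ (s ^+ 2 * A)
      (deriv_onB (deriv_on_id l) (deriv_on_cst l x0)))
      (deriv_onZ (2 * s) Su)) dP.
    by apply: eq_deriv_on => t _; rewrite subr0 mulr1.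
  have P0 z : 0 <= z <= l -> 0 <= P z by move=> zl; exact: (prim_ge0 cP zl).
  have Fx : F x0 <= F x.
    apply: (deriv_on_le dF x0p x0x xl) => z /andP[z1 z2].
    have zl : 0 <= z <= l by rewrite (le_trans x0p (ltW z1)) (le_trans (ltW z2)).
    have aA : a z <= A by rewrite (le_trans (ler_norm _)) ?AP.
    apply: (@le_trans _ _ (a z * (s + sw S z) ^+ 2)).
      by rewrite mulr_ge0 ?sqr_ge0 ?ltW ?a_gt0.
    by have := sqr_ge0 s; nra.
  have : 0 <= F x.
    apply: le_trans Fx; rewrite /F subrr ux0 !mulr0 !add0r P0// x0p.
    by rewrite (le_trans x0x).
  have PI : P x <= I0.
    apply: (deriv_on_le dP (le_trans x0p x0x) xl) => // z /andP[z1 z2].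
    by rewrite w2// z2 andbT (le_lt_trans _ z1)// (le_trans x0p).
  have s2 : s ^+ 2 * A * (x - x0) <= su S x ^+ 2 / (A * eps).
    apply: (@le_trans _ _ (s ^+ 2 * A * eps)).
      by rewrite ler_wpM2l// mulr_ge0 ?sqr_ge0 ?ltW.
    by rewrite /s le_eqVlt; apply/orP; left; apply/eqP; field; rewrite !lt0r_neq0.
  have -> : F x = s ^+ 2 * A * (x - x0) - 2 * (su S x ^+ 2 / (A * eps)) + P x.
    by rewrite /F /s; field; rewrite !lt0r_neq0.
  move=> H; rewrite mulrC -ler_pdivrMr//; lra.
have y2 x : 0 <= x <= l -> sy S x ^+ 2 <= A * eps ^+ 3 * I0.
  move=> /andP[xp xl]; have [xx0|x0x] := leP x x0.
    have [-> _] := S0 x ltac:(by rewrite xp).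
    by rewrite expr0n/= !mulr_ge0 ?exprn_ge0 ?ltW.
  have [c /andP[c1 c2]] := deriv_on_MVT Sy x0p x0x xl.
  rewrite yx0 subr0 => ->; rewrite exprMn.
  rewrite (_ : A * eps ^+ 3 * I0 = (A * eps * I0) * eps ^+ 2); last by ring.
  apply: ler_pM; rewrite ?sqr_ge0//.
    by apply: u2; rewrite (ltW c1) (le_trans (ltW c2)).
  rewrite lerXn2r ?nnegrE ?subr_ge0 ?(ltW x0x) ?(ltW e0)//.
  by rewrite /x0; lra.
(* The same [S] solves the equation for [lam0] with this forcing, at the cost of [lam0 int r y^2] in
   the work. *)
pose h x := g x - lam0 * (r x * sy S x).
exists h, S; split.
- exact: cont_onB cg (cont_onM (@cont_on_cst _ l lam0) (cont_onM cr cy)).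
- split => //; apply: beam_forcing bS => t _.
  by rewrite /h; ring.
have c1 := cont_onM cg cy; have c2 := cont_onM cr (cont_onM cy cy).
have -> : prim (fun x => h x * sy S x) l =
    prim (fun x => g x * sy S x) l - lam0 * prim (fun x => r x * (sy S x * sy S x)) l.
  rewrite -(primZ _ c2 itvl) -(primB c1 (cont_onM (@cont_on_cst _ l lam0) c2) itvl).
  by apply: eq_prim => t _; rewrite /h; ring.
have rb : prim (fun x => r x * (sy S x * sy S x)) l <= M * (A * eps ^+ 3 * I0) * l.
  apply: (le_trans (ler_norm _)); apply: (prim_abs_le c2 itvl) => t /itvW tl.
  by rewrite normrM ler_pM// ?MP// -expr2 ger0_norm ?sqr_ge0 ?y2.
have : lam0 * prim (fun x => r x * (sy S x * sy S x)) l <= B * eps ^+ 3 * I0.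
  apply: (le_trans (ler_wpM2l lam00 rb)).
  by rewrite le_eqVlt; apply/orP; left; apply/eqP; rewrite /B; ring.
have : B * eps ^+ 3 * I0 < I0.
  rewrite -[ltRHS]mul1r ltr_pM2r//; apply: le_lt_trans eB.
  rewrite ler_wpM2l// exprS ler_piMr ?(ltW e0)// exprn_ile1//.
  exact: ltW.
lra.
Qed.

Lemma char_det_unbounded (L : R) : exists2 lam, L <= lam & char_det lam = 0.
Proof.
apply: contrapT => nex.
(* The threshold is raised to 0 because positive work is constructed only for nonnegative
   parameters; the [+ 1] below makes the inequality strict. *)
have DL lam : Num.max L 0 <= lam -> char_det lam != 0.
  by rewrite ge_max => /andP[Ll _]; apply/negP => /eqP D0; apply: nex; exists lam.
have [|g [S [cg cS]]] := @exists_positive_work (Num.max L 0 + 1).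
  by rewrite addr_ge0// le_max lexx orbT.
by rewrite ltNge (forced_work_le0 DL _ cg cS)// ltrDl.
Qed.

End Unbounded.

(** * The right endpoint, reality and discreteness of the spectrum *)

Section SpectrumEnd.
Variable R : realType.
Implicit Types (lam mu x y z t : R) (g h : R -> R) (S T : state R).
Variables (l : R) (a q r : R -> R).
Hypotheses (l_gt0 : 0 < l) (ca : cont_on l a) (cq : cont_on l q)
  (cr : cont_on l r).
Hypotheses (a_gt0 : forall x, 0 <= x <= l -> 0 < a x)
  (q_ge0 : forall x, 0 <= x <= l -> 0 <= q x)
  (r_gt0 : forall x, 0 <= x <= l -> 0 < r x).

Local Notation zero := (fun=> 0 : R).

Lemma clamped_moment_end lam S : clamped l a q r lam zero S ->
  nontrivial l S -> sw S l != 0.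
Proof.
move=> [bS y0 u0 yl ul] [x /andP[x0 xl] yx].
have refl f (P : R -> Prop) : (forall x, 0 <= x <= l -> P (f x)) ->
    forall x, 0 <= x <= l -> P (f (l - x)).
  by move=> H z /andP[z0 zl]; apply: H; rewrite subr_ge0 zl lerBlDr lerDl.
have := @clamped_moment _ _ _ _ _ l_gt0 (cont_on_reflect ca) (cont_on_reflect cq)
  (cont_on_reflect cr) (refl _ (fun y => is_true (0 < y)) a_gt0)
  (refl _ (fun y => is_true (0 <= y)) q_ge0)
  (refl _ (fun y => is_true (0 < y)) r_gt0) lam _ _ _.
move=> /(_ (State (fun x => sy S (l - x)) (fun x => - su S (l - x))
           (fun x => sw S (l - x)) (fun x => - sv S (l - x)))) /=.
rewrite subr0; apply.
  split => /=; rewrite ?subr0 ?subrr ?ul ?u0 ?oppr0//.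
  exact: (beam_reflect bS).
exists (l - x); first by rewrite subr_ge0 xl lerBlDr lerDl.
by rewrite /= subKr.
Qed.

(** [S] and [T] are the real and imaginary parts of an eigenfunction for [al + i be]. Green's
    identity with equal parameters reads [be (int r y_S^2 + int r y_T^2) = 0]. *)
Lemma clamped_real_spectrum (al be : R) S T :
  clamped l a q r al (fun x => - be * (r x * sy T x)) S ->
  clamped l a q r al (fun x => be * (r x * sy S x)) T -> be != 0 ->
  ~ nontrivial l S /\ ~ nontrivial l T.
Proof.
move=> cS cT be0.
have il : 0 <= l <= l by rewrite lexx ltW.
have [[/deriv_on_cont cy _ _ _] _ _ _ _] := cS.
have [[/deriv_on_cont cz _ _ _] _ _ _ _] := cT.
have cg := cont_onM (@cont_on_cst _ l (- be)) (cont_onM cr cz).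
have ch := cont_onM (@cont_on_cst _ l be) (cont_onM cr cy).
have := clamped_bracket l_gt0 cr cg ch cS cT; rewrite subrr mul0r.
have c1 := cont_onM cr (cont_onM cy cy); have c2 := cont_onM cr (cont_onM cz cz).
pose I f := prim (fun x => r x * f x ^+ 2) l.
have -> : prim (fun x => be * (r x * sy S x) * sy S x) l = be * I (sy S).
  by rewrite -(primZ _ c1 il); apply: eq_prim => t _; ring.
have -> : prim (fun x => - be * (r x * sy T x) * sy T x) l = - be * I (sy T).
  by rewrite -(primZ _ c2 il); apply: eq_prim => t _; ring.
rewrite mulNr opprK -mulrDr => /esym/eqP; rewrite mulf_eq0 (negPf be0)/= => /eqP e.
have I0 f : cont_on l f -> 0 <= I f.
  move=> cf; apply: (prim_ge0 (cont_onM cr (cont_onM cf cf)) il) => t /andP[t0 tl].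
  by rewrite mulr_ge0 -?expr2 ?sqr_ge0// ltW// r_gt0// !ltW.
have := I0 _ cy; have := I0 _ cz => h1 h2.
by split=> [/(weight_gt0 l_gt0 cr r_gt0 cS)|/(weight_gt0 l_gt0 cr r_gt0 cT)];
  rewrite -/(I _); lra.
Qed.

(** The gap is needed at every real [t]: the enumeration uses it at infima and suprema not known
    beforehand to be zeros. *)
Lemma char_det_discrete t : exists2 d, 0 < d & forall s,
  char_det l_gt0 ca cq cr s = 0 -> `|s - t| < d -> s = t.
Proof.
have [Dt|Dt] := eqVneq (char_det l_gt0 ca cq cr t) 0.
  have [d d0 dP] := char_det_isolated a_gt0 q_ge0 r_gt0 Dt.
  by exists d => // s Ds st; exact: dP.
have Dc : {for t, continuous (char_det l_gt0 ca cq cr)} by exact: char_det_continuous.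
have /cvgr_neq0/(_ Dt)[d /= d0 dP] := Dc.
exists d => // s Ds st; have := dP s.
by rewrite /= distrC Ds eqxx => /(_ st).
Qed.

End SpectrumEnd.

(** Iterates from 0 the map sending [t] to the least element of [S] above [t]. The gap at [t] keeps
    these elements away from [t], and the gap at their infimum makes it attained. *)
Lemma enumerate_discrete (R : realType) (S : set R) :
  (forall s, S s -> 0 < s) ->
  (forall t : R, exists2 d, 0 < d & forall s, S s -> `|s - t| < d -> s = t) ->
  (forall L : R, exists2 s, L <= s & S s) ->
  exists lam : nat -> R, [/\ forall s, S s <-> exists n, s = lam n,
    forall n, lam n < lam n.+1 & lam n @[n --> \oo] --> +oo].
Proof.
move=> Spos Sdisc Sunb.
have next_ex t : exists s, [/\ S s, t < s & forall s', S s' -> t < s' -> s <= s'].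
  have [d d0 dP] := Sdisc t.
  pose E := [set s | S s /\ t < s].
  have E0 : E !=set0.
    have [s ts Ss] := Sunb (t + 1); exists s; split=> //.
    by rewrite (lt_le_trans _ ts)// ltrDl.
  have Elb : lbound E (t + d).
    move=> s [Ss ts]; rewrite leNgt; apply/negP => sd.
    have := dP s Ss; rewrite gtr0_norm ?subr_gt0// ltrBlDl => /(_ sd) st.
    by move: ts; rewrite st ltxx.
  have Ei : has_inf E by split => //; exists (t + d).
  have tm : t + d <= inf E by exact: lb_le_inf.
  exists (inf E); split.
  - have [e e0 eP] := Sdisc (inf E).
    have [s [Ss ts] se] := inf_adherent e0 Ei.
    have ms : inf E <= s by apply: ge_inf; [exists (t + d)|split].
    by rewrite -(eP s Ss)// ger0_norm ?subr_ge0// ltrBlDl.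
  - by rewrite (lt_le_trans _ tm)// ltrDl.
  - by move=> s Ss ts; apply: ge_inf; [exists (t + d)|split].
pose next t := sval (cid (next_ex t)).
have nextP t : [/\ S (next t), t < next t & forall s, S s -> t < s -> next t <= s].
  exact: (svalP (cid (next_ex t))).
pose lam n := iter n next (next 0).
have lamS n : S (lam n) by case: n => [|n]; [have [] := nextP 0|have [] := nextP (lam n)].
have lam_lt n : lam n < lam n.+1 by have [] := nextP (lam n).
have lam_le : {homo lam : m n / (m <= n)%N >-> m <= n}.
  apply: homo_leq => [x|y x z|k]; [exact: lexx|exact: le_trans|exact: ltW].
have lam_unb L : exists n, L < lam n.
  apply: contrapT => nex.
  have ub : ubound (range lam) L.
    by move=> _ [n _ <-]; rewrite leNgt; apply/negP => Ln; apply: nex; exists n.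
  have hs : has_sup (range lam) by split; [exists (lam 0%N); exists 0%N|exists L].
  (* A bounded sequence would have a term inside the gap of its supremum, hence equal to it, and the
     next term would exceed it. *)
  have [d d0 dP] := Sdisc (sup (range lam)).
  have [_ [n _ <-] nd] := sup_adherent d0 hs.
  have lelam k : lam k <= sup (range lam) by apply: ub_le_sup; [exists L|exists k].
  have := dP _ (lamS n); rewrite distrC ger0_norm ?subr_ge0// ltrBlDr -ltrBlDl ltrBlDr.
  rewrite -ltrBlDr => /(_ nd) e.
  by have := lt_le_trans (lam_lt n) (lelam n.+1); rewrite e ltxx.
exists lam; split => //.
- move=> s; split=> [Ss|[n ->]//]; have [n sn] := lam_unb s.
  elim: n sn => [|n IH] sn.
    have [_ _ /(_ s Ss (Spos s Ss))] := nextP 0.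
    by rewrite leNgt sn.
  case: (ltgtP s (lam n)) => [ns|ns|ns]; [exact: IH| |by exists n].
  have [_ _ /(_ s Ss ns)] := nextP (lam n).
  by rewrite leNgt sn.
- apply/cvgryPge => A; have [n An] := lam_unb A.
  near=> k; apply: (le_trans (ltW An)); apply: lam_le.
  by near: k; exact: nbhs_infty_ge.
Unshelve. all: by end_near. Qed.

(** * Weak derivatives *)

#[local] Instance ae_filter (R : realType) :
    Filter (nbhs (almost_everywhere (@lebesgue_measure R))) :=
  ae_filter_ringOfSetsType _.

(** * Integrability and square integrability on the open interval *)

Section Integrable.
Variable R : realType.
Implicit Types (l c d x y z t : R) (f g h : R -> R).
Local Notation mu := (@lebesgue_measure R).

Definition integ l f := mu.-integrable `]0, l[ (EFin \o f).
Definition integral_oo l f : R := \int[mu]_(x in `]0, l[) f x.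

Lemma integ_measurable l f : integ l f -> measurable_fun `]0, l[ f.
Proof. by move=> /measurable_int/measurable_EFinP. Qed.

Lemma integ_cc l f : integ l f -> mu.-integrable `[0, l] (EFin \o f).
Proof.
move=> fi; have mf := integ_measurable fi.
apply/integrableP; split.
  by apply/measurable_EFinP; exact: measurable_fun_itv_cc mf.
rewrite integral_itv_bndoo; first by case/integrableP: fi.
by do 2 apply: measurableT_comp => //; apply/measurable_EFinP.
Qed.

Lemma integral_ooE l f : integ l f -> integral_oo l f = prim f l.
Proof.
move=> fi; rewrite /integral_oo /prim /Rintegral.
rewrite [in RHS]integral_itv_bndoo//.
by have /measurable_EFinP := integ_measurable fi.
Qed.

Lemma cc_integ l f : mu.-integrable `[0, l] (EFin \o f) -> integ l f.
Proof. by apply: integrableS => //; exact: subset_itv_oo_cc. Qed.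

Lemma cont_integ l f : cont_on l f -> integ l f.
Proof. by move=> cf; apply: cc_integ; exact: cont_on_integrable. Qed.

Lemma integD l f g : integ l f -> integ l g -> integ l (fun x => f x + g x).
Proof. by move=> fi gi; apply: (integrableD _ fi gi). Qed.

Lemma integZ l c f : integ l f -> integ l (fun x => c * f x).
Proof. by move=> fi; apply: (integrableZl _ c fi). Qed.

Lemma integN l f : integ l f -> integ l (fun x => - f x).
Proof.
move=> /(integZ (-1)); congr (integ _ _).
by apply/funext => x; rewrite mulN1r.
Qed.

Lemma integB l f g : integ l f -> integ l g -> integ l (fun x => f x - g x).
Proof. by move=> fi /integN; exact: integD. Qed.

Lemma integ_bounded l c f g : measurable_fun `]0, l[ f -> integ l g ->
  (forall x, 0 < x < l -> `|f x| <= c * `|g x|) -> integ l f.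
Proof.
move=> mf gi fg; apply: le_integrable (integZ c gi) => //.
  exact/measurable_EFinP.
move=> x /=; rewrite in_itv/= lee_fin => xl.
apply: (le_trans (fg x xl)); rewrite normrM ler_wpM2r//; exact: ler_norm.
Qed.

Lemma cont_measurable l f : cont_on l f -> measurable_fun `]0, l[ f.
Proof. by move/cont_integ/integ_measurable. Qed.

Lemma integMcont l f g : 0 < l -> integ l f -> cont_on l g ->
  integ l (fun x => f x * g x).
Proof.
move=> l0 fi cg; have [K K0 KP] := cont_on_bounded l0 cg.
apply: (@integ_bounded _ K _ f) => //.
  by apply: measurable_funM; [exact: integ_measurable|exact: cont_measurable].
move=> x /andP[x0 xl]; by rewrite normrM mulrC ler_wpM2r// KP// !ltW.
Qed.

Lemma integral_ooD l f g : integ l f -> integ l g ->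
  integral_oo l (fun x => f x + g x) = integral_oo l f + integral_oo l g.
Proof. by move=> fi gi; rewrite /integral_oo RintegralD. Qed.

Lemma integral_ooB l f g : integ l f -> integ l g ->
  integral_oo l (fun x => f x - g x) = integral_oo l f - integral_oo l g.
Proof. by move=> fi gi; rewrite /integral_oo RintegralB. Qed.

Lemma integral_ooZ l c f : integ l f ->
  integral_oo l (fun x => c * f x) = c * integral_oo l f.
Proof. by move=> fi; rewrite /integral_oo RintegralZl. Qed.

Lemma eq_integral_oo l f g : (forall x, 0 < x < l -> f x = g x) ->
  integral_oo l f = integral_oo l g.
Proof. by move=> fg; apply: eq_Rintegral => x; rewrite inE/= in_itv; exact: fg. Qed.

Lemma eq_integ l f g : (forall x, 0 < x < l -> f x = g x) -> integ l f -> integ l g.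
Proof.
move=> fg; apply: eq_integrable => // x; rewrite inE/= in_itv/= => xl.
by rewrite fg.
Qed.

Definition ae_eq_on l f g : Prop := {ae mu, forall x, 0 < x < l -> f x = g x}.

Lemma ae_integral_oo l f g : measurable_fun `]0, l[ f -> measurable_fun `]0, l[ g ->
  ae_eq_on l f g -> integral_oo l f = integral_oo l g.
Proof.
move=> mf mg fg; rewrite /integral_oo /Rintegral; congr fine.
apply: ae_eq_integral => //; [exact/measurable_EFinP|exact/measurable_EFinP|].
by apply: filterS fg => x; rewrite /= in_itv/= => H /H ->.
Qed.

(** An interior point of difference comes with a whole ball of difference, which has positive
    measure. *)
Lemma ae_eq_cont l f g : cont_on l f -> cont_on l g -> ae_eq_on l f g -> 0 < l ->
  forall x, 0 <= x <= l -> f x = g x.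
Proof.
move=> cf cg fg l0; have ch := cont_onB cf cg.
suff h0 x : 0 < x < l -> f x - g x = 0.
  by move=> x xl; apply/eqP; rewrite -subr_eq0 (cont_on_eq0 l0 ch h0 xl).
move=> xl; apply: contrapT => /eqP hx.
have /cvgr_neq0/(_ hx) := cont_on_at xl ch.
have : x \in `]0, l[ by rewrite in_itv.
move=> /near_in_itvoo xn hn.
have [e /= e0 He] := filterI xn hn.
have [N [mN N0 NP]] := fg.
have sub : ball x e `<=` N.
  move=> y /He[]; rewrite /= in_itv/= => yl hy; apply: NP => /= H.
  by move: hy; rewrite H// subrr eqxx.
have : (mu (ball x e) <= mu N)%E.
  by apply: le_measure => //; rewrite inE//; exact: measurable_ball.
move: N0 => ->; rewrite lebesgue_measure_ball ?(ltW e0)// lee_fin leNgt.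
by rewrite pmulrn_lgt0 ?e0.
Qed.

Lemma eq_ae_eq_on l f g : (forall x, 0 < x < l -> f x = g x) -> ae_eq_on l f g.
Proof. by move=> fg; apply: filterE. Qed.

Definition sqint l f := measurable_fun `]0, l[ f /\ integ l (fun x => f x ^+ 2).

Lemma sqint_integ l f : sqint l f -> integ l f.
Proof.
move=> [mf f2]; have i1 : integ l (fun=> 1) by apply: cont_integ; exact: cont_on_cst.
apply: (@integ_bounded _ 1 _ (fun x => 1 + f x ^+ 2)) => //; first exact: integD.
move=> x _; rewrite mul1r (@ger0_norm _ (1 + _)) ?addr_ge0 ?sqr_ge0//.
rewrite -(real_normK (num_real (f x))).
by have := sqr_ge0 (`|f x| - 1); nra.
Qed.

Lemma cont_sqint l f : cont_on l f -> sqint l f.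
Proof.
by move=> cf; split; [exact: cont_measurable|exact: (cont_integ (cont_onM cf cf))].
Qed.

Lemma sqintD l f g : sqint l f -> sqint l g -> sqint l (fun x => f x + g x).
Proof.
move=> [mf f2] [mg g2]; split; first exact: measurable_funD.
apply: (@integ_bounded _ 2 _ (fun x => f x ^+ 2 + g x ^+ 2)).
- by apply: measurable_funX; exact: measurable_funD.
- exact: integD.
- move=> x _; rewrite !ger0_norm ?addr_ge0 ?sqr_ge0//.
  by have := sqr_ge0 (f x - g x); nra.
Qed.

Lemma sqintMcont l f g : 0 < l -> sqint l f -> cont_on l g ->
  sqint l (fun x => f x * g x).
Proof.
move=> l0 [mf f2] cg; split.
  by apply: measurable_funM => //; exact: cont_measurable.
apply: (@eq_integ _ (fun x => f x ^+ 2 * (g x * g x))).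
  by move=> x _; rewrite exprMn expr2 [g x ^+ 2]expr2.
by apply: integMcont => //; exact: cont_onM.
Qed.

Lemma sqintN l f : sqint l f -> sqint l (fun x => - f x).
Proof.
move=> [mf f2]; split; first exact: measurableT_comp.
by apply: eq_integ f2 => x _; rewrite sqrrN.
Qed.

Lemma eq_sqint l f g : (forall x, 0 < x < l -> f x = g x) -> sqint l f -> sqint l g.
Proof.
move=> fg [mf f2]; split.
  by apply: eq_measurable_fun mf => x; rewrite inE/= in_itv/=; exact: fg.
by apply: eq_integ f2 => x xl; rewrite fg.
Qed.

End Integrable.

(** * The du Bois-Reymond lemma, by way of Lebesgue points *)

Section WeakDerivative.
Variable R : realType.
Implicit Types (l a b c d x y z t : R) (f g h phi : R -> R).
Local Notation mu := (@lebesgue_measure R).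
Lemma prim_supp0 h a x : (forall t, h t != 0 -> a <= t) -> x < a -> prim h x = 0.
Proof.
move=> h0 xa; rewrite (@eq_prim _ h (fun=> 0)) ?/prim ?/Rintegral ?integral0//.
move=> t /andP[_ tx]; apply: contrapT => /eqP /h0.
by rewrite leNgt (le_lt_trans tx xa).
Qed.

Lemma prim_supp_end l h b x : cont_on l h -> (forall t, h t != 0 -> t <= b) ->
  0 <= x -> b <= x -> x <= l -> prim h x = prim h l.
Proof.
move=> ch h0 x0 bx; rewrite le_eqVlt => /predU1P[->//|xl].
have [z /andP[xz zl]] := deriv_on_MVT (prim_deriv ch) x0 xl (lexx l).
have -> : h z = 0.
  apply: contrapT => /eqP /h0; rewrite leNgt (le_lt_trans bx xz)//.
by rewrite mul0r => /eqP; rewrite subr_eq0 => /eqP ->.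
Qed.

(** Supplies the test functions of the du Bois-Reymond argument: the zero integral makes the
    primitive vanish again to the right of [b]. *)
Lemma test_function_prim l h a b : continuous h -> 0 < a -> a <= b -> b < l ->
  (forall t, h t != 0 -> a <= t <= b) -> prim h l = 0 ->
  test_function l (prim h) /\ derive1 (prim h) = h.
Proof.
move=> ch a0 ab bl supp hl.
have sa t : h t != 0 -> a <= t by move=> /supp/andP[].
have sb t : h t != 0 -> t <= b by move=> /supp/andP[].
have b0 : 0 < b by exact: lt_le_trans ab.
have hb : prim h b = 0.
  by rewrite (prim_supp_end (continuous_cont_on ch) sb _ _ (ltW bl))// ltW.
have dh x : is_derive x 1 (prim h) (h x).
  have [x0|x0] := ltP 0 x.
    have [_] := prim_deriv (@continuous_cont_on _ (x + 1) _ ch); apply.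
    by rewrite x0 ltrDl ltr01.
  have xa : x < a by exact: le_lt_trans a0.
  have -> : h x = 0 by apply: contrapT => /eqP /sa; rewrite leNgt xa.
  apply: near_eq_is_derive (is_derive_cst (0 : R) x 1).
  by near=> y; rewrite (prim_supp0 sa)//; near: y; exact: lt_nbhsl.
have -> : derive1 (prim h) = h.
  by apply/funext => x; rewrite derive1E; exact: derive_val.
split=> //; split=> [x||]; first by [].
  have -> : derive1 (prim h) = h.
    by apply/funext => x; rewrite derive1E; exact: derive_val.
  exact: ch.
exists a, b; split=> // x; apply: contraNT; rewrite negb_and -!ltNge => /orP[xa|bx].
  by rewrite (prim_supp0 sa).
have bx' : b < x + 1 by rewrite (lt_trans bx)// ltrDl.
rewrite -hb eq_sym (prim_supp_end (continuous_cont_on ch) sb _ (lexx b) (ltW bx))//.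
exact: ltW.
Unshelve. all: by end_near. Qed.

Lemma dist01_le1 x y : 0 <= x <= 1 -> 0 <= y <= 1 -> `|x - y| <= 1.
Proof.
by move=> /andP[? ?] /andP[? ?]; rewrite ler_norml; apply/andP; split; lra.
Qed.

Lemma tent_ge0 c d x : 0 <= tent c d x.
Proof. by rewrite /tent le_max lexx. Qed.

Lemma tent_le c d x : 0 <= d -> tent c d x <= d.
Proof. by move=> d0; rewrite /tent ge_max d0 gerBl normr_ge0. Qed.

Lemma tent_supp c d x : tent c d x != 0 -> c - d < x < c + d.
Proof.
rewrite /tent; case: (leP (d - `|x - c|) 0) => [|]; first by rewrite eqxx.
by rewrite subr_gt0 ltr_distl.
Qed.

(** A crude bound, the integral being [d^2]: on the middle half, of length [d], the tent is at least
    [d / 2]. *)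
Lemma tent_mass l c d : 0 < d -> 0 <= c - d -> c + d <= l ->
  d ^+ 2 / 2 <= prim (tent c d) l.
Proof.
move=> d0 cd0 cdl; have l0 : 0 <= l by lra.
have ct : cont_on l (tent c d) by apply: continuous_cont_on; exact: tent_continuous.
have dt := prim_deriv ct.
have [|||z /andP[z1 z2]] := deriv_on_MVT dt (x := c - d / 2) (y := c + d / 2); try lra.
move=> e.
have h1 : prim (tent c d) (c + d / 2) <= prim (tent c d) l.
  apply: (deriv_on_le dt); try lra.
  by move=> t _; exact: tent_ge0.
have h2 : 0 <= prim (tent c d) (c - d / 2).
  by apply: (prim_ge0 ct) => [|t _]; [apply/andP; split; lra|exact: tent_ge0].
have h3 : d / 2 <= tent c d z.
  rewrite /tent le_max; apply/orP; right.
  have : `|z - c| <= d / 2 by rewrite ler_norml; apply/andP; split; lra.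
  by lra.
have : d / 2 * d <= tent c d z * (c + d / 2 - (c - d / 2)).
  by rewrite (_ : c + d / 2 - (c - d / 2) = d) ?ler_wpM2r ?(ltW d0)//; field.
by rewrite expr2; lra.
Qed.

Section DuBoisReymond.
Variables (l : R) (f g : R -> R).
Hypotheses (fi : integ l f) (gi : integ l g).
Hypothesis fg : forall phi, test_function l phi ->
  integral_oo l (fun x => f x * derive1 phi x) =
  - integral_oo l (fun x => g x * phi x).

Let I : set R := `]0, l[.
(** Extension by zero makes [f] locally integrable on the whole line, the setting of Lebesgue
    points. *)
Let F : R -> R := f \_ I.

(* The bump is supported on the right of [a], so that the primitive of
   [bump a d - bump b d] tends everywhere to the indicator of [`]a, b]]. *)
Definition bump (a d x : R) : R :=
  tent (a + d) d x / prim (tent (a + d) d) l.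

(** The bump is at most [d / (d^2 / 2) = 2 / d] and lives in a ball of radius [2 d] and measure
    [4 d]; the product of the two is 8. *)
Lemma bump_average (a d : R) : 0 < d -> 0 < a - 2 * d -> a + 2 * d < l ->
  (`|integral_oo l (fun x => f x * bump a d x) - f a|%:E <= 8%:E * davg F a (2 * d))%E.
Proof.
move=> d0 ad al; pose c := a + d; pose m := prim (tent c d) l.
have l0 : 0 < l by lra.
have m0 : d ^+ 2 / 2 <= m by apply: tent_mass => //; rewrite /c; lra.
have mp : 0 < m by apply: lt_le_trans m0; rewrite divr_gt0 ?exprn_gt0.
have ct : cont_on l (tent c d) by apply: continuous_cont_on; exact: tent_continuous.
have ti : integ l (tent c d) by exact: cont_integ.
have aI : a \in `]0, l[ by rewrite in_itv/=; apply/andP; split; lra.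
have Fa : F a = f a by rewrite /F patchE mem_set.
have hi : integ l (fun x => (f x - f a) * tent c d x).
  by apply: integMcont => //; apply: integB => //; apply: cont_integ; exact: cont_on_cst.
have fti : integ l (fun x => f x * tent c d x) by exact: integMcont.
have -> : integral_oo l (fun x => f x * bump a d x) - f a =
    m^-1 * integral_oo l (fun x => (f x - f a) * tent c d x).
  rewrite (@eq_integral_oo _ l (fun x => f x * bump a d x)
    (fun x => m^-1 * (f x * tent c d x))); last by move=> x _; rewrite /bump -/c -/m; ring.
  rewrite (@eq_integral_oo _ l (fun x => (f x - f a) * tent c d x)
    (fun x => f x * tent c d x - f a * tent c d x)); last by move=> x _; ring.
  rewrite integral_ooZ// integral_ooB//; last exact: integZ.
  rewrite integral_ooZ// (integral_ooE ti) -/m.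
  by field; exact: lt0r_neq0.
rewrite normrM (gtr0_norm (_ : 0 < m^-1)) ?invr_gt0//.
have key : (`|integral_oo l (fun x => (f x - f a) * tent c d x)|%:E <=
   d%:E * \int[mu]_(y in ball a (2 * d)) `|(F y - F a)%:E|)%E.
  rewrite /integral_oo EFin_normr_Rintegral//.
  have /measurable_EFinP mh := integ_measurable hi.
  apply: le_trans; first by apply: le_abse_integral => //; exact: mh.
  have mF : measurable_fun setT F.
    have mI : measurable I by exact: measurable_itv.
    exact: ((measurable_restrictT f mI).1 (integ_measurable fi)).
  have mb : measurable_fun (ball a (2 * d)) (fun y => `|(F y - F a)%:E|%E).
    apply: measurableT_comp => //; apply/measurable_EFinP.
    by apply: measurable_funB => //; exact: measurable_funTS.
  rewrite -ge0_integralZl//; last 2 first.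
  - exact: measurable_ball.
  - by rewrite lee_fin ltW.
  rewrite [leLHS]integral_mkcond [leRHS]integral_mkcond.
  apply: ge0_le_integral => //.
  - by move=> x _; apply: erestrict_ge0 => y _; exact: abse_ge0.
  - apply/(measurable_restrictT _ _).1 => //.
    exact: measurableT_comp.
  - apply/(measurable_restrictT _ _).1; first exact: measurable_ball.
    by apply: measurable_funeM.
  move=> x _; rewrite !patchE; case: ifPn => [xI|_]; last first.
    by case: ifPn => // _; rewrite mule_ge0 ?abse_ge0// lee_fin ltW.
  have Fx : F x = f x by rewrite /F patchE xI.
  have [t0|/tent_supp/andP[x1 x2]] := eqVneq (tent c d x) 0.
    rewrite t0 mulr0 abse0; case: ifPn => // _.
    by rewrite mule_ge0 ?abse_ge0// lee_fin ltW.
  rewrite ifT; last first.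
    rewrite inE /ball/= ltr_norml; move: x1 x2; rewrite /c => x1 x2.
    by apply/andP; split; lra.
  rewrite Fx Fa -EFinM lee_fin normrM mulrC ler_wpM2r//.
  by rewrite ger0_norm ?tent_ge0// tent_le// ltW.
rewrite EFinM; apply: (@le_trans _ _ ((m^-1)%:E * (d%:E *
    \int[mu]_(y in ball a (2 * d)) `|(F y - F a)%:E|))%E).
  by rewrite lee_wpmul2l// lee_fin invr_ge0 ltW.
rewrite /davg /iavg lebesgue_measure_ball; last by rewrite mulr_ge0// ltW.
set X := (X in (_ * (_ * X) <= _)%E).
have X0 : (0 <= X)%E by apply: integral_ge0 => y _; exact: abse_ge0.
have -> : (\int[mu]_(y in ball a (2 * d)) `|((center (F a) \o F) y)%:E| = X)%E by [].
rewrite inver gt_eqF; last by rewrite pmulrn_lgt0// mulr_gt0.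
rewrite !muleA -!EFinM lee_wpmul2r// lee_fin.
rewrite (_ : 8 * _ = 2 / d); last by field; exact: lt0r_neq0.
rewrite mulrC ler_pdivlMr// mulrAC ler_pdivrMr//.
by move: m0; rewrite expr2; lra.
Qed.

Lemma bump_supp (a d : R) x : bump a d x != 0 -> a <= x <= a + 2 * d.
Proof.
rewrite /bump mulf_eq0 negb_or => /andP[/tent_supp/andP[x1 x2] _].
by apply/andP; split; lra.
Qed.

Lemma bump_continuous (a d : R) : continuous (bump a d).
Proof. by move=> x; apply: cvgM; [exact: tent_continuous|exact: cvg_cst]. Qed.

Lemma prim_bump (a d x : R) : 0 < d -> 0 < a -> a + 2 * d < l -> 0 <= x <= l ->
  [/\ 0 <= prim (bump a d) x <= 1, x <= a -> prim (bump a d) x = 0 &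
      a + 2 * d <= x -> prim (bump a d) x = 1].
Proof.
move=> d0 a0 al /andP[x0 xl]; pose c := a + d; pose m := prim (tent c d) l.
have m0 : d ^+ 2 / 2 <= m by apply: tent_mass => //; rewrite /c; lra.
have mp : 0 < m by apply: lt_le_trans m0; rewrite divr_gt0 ?exprn_gt0.
have ct : cont_on l (tent c d) by apply: continuous_cont_on; exact: tent_continuous.
have cb : cont_on l (bump a d) by apply: continuous_cont_on; exact: bump_continuous.
have b0 t : 0 <= bump a d t by rewrite /bump divr_ge0 ?tent_ge0// ltW.
have bl : prim (bump a d) l = 1.
  rewrite (@eq_prim _ _ (fun t => m^-1 * tent c d t)).
    by rewrite (primZ _ ct) ?lexx ?(le_trans x0)// mulVf// lt0r_neq0.
  by move=> t _; rewrite mulrC.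
split.
- apply/andP; split; first by apply: (prim_ge0 cb) => //; rewrite x0.
  by rewrite -bl; apply: (deriv_on_le (prim_deriv cb)).
- move=> xa; rewrite (@eq_prim _ _ (fun=> 0)) ?/prim ?/Rintegral ?integral0//.
  move=> t /andP[_ tx]; apply/eqP; apply: contraT.
  rewrite /bump mulf_eq0 negb_or => /andP[/tent_supp/andP[x1 x2] _].
  by move: x1; lra.
- move=> ax; rewrite (@prim_supp_end l _ (a + 2 * d))//.
  by move=> t /bump_supp/andP[].
Qed.

Lemma bump_limit (a e : R) : 0 < e -> 0 < a - 2 * e -> a + 2 * e < l ->
  lebesgue_pt F a ->
  integral_oo l (fun x => f x * bump a (e / n.+1%:R) x) @[n --> \oo] --> f a.
Proof.
move=> e0 ae al Fa; pose d n : R := e / n.+1%:R.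
have d0 n : 0 < d n by rewrite divr_gt0.
have de n : d n <= e by rewrite ler_pdivrMr// ler_peMr ?ler1n// ltW.
have dcv : (2 * d n) @[n --> \oo] --> (0 : R).
  rewrite -(mulr0 2); apply: cvgM; first exact: cvg_cst.
  by rewrite -(mulr0 e); apply: cvgM; [exact: cvg_cst|exact: cvg_harmonic].
have /fine_cvgP[fin cv] : davg F a (2 * d n) @[n --> \oo] --> 0%:E.
  have /cvge_at_rightP := Fa; apply; split => // n.
  by rewrite mulr_gt0.
apply/cvgrPdist_le => eps eps0.
have e8 : 0 < eps / 8 by rewrite divr_gt0.
have /cvgrPdist_le/(_ _ e8) := cv; move: fin.
apply: filterS2 => n /= fin; rewrite sub0r normrN => H.
rewrite distrC -lee_fin.
apply: le_trans (bump_average (d0 n) _ _) _.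
- by have := de n; lra.
- by have := de n; lra.
rewrite -(fineK fin) -EFinM lee_fin.
have := le_trans (ler_norm _) H.
by rewrite ler_pdivlMr// mulrC.
Qed.

(** The test function is the primitive of [bump a d - bump b d]. As [d] tends to 0, the side of [f]
    tends to [f a - f b] at Lebesgue points, and dominated convergence gives the integral of [g]
    over []a, b]] on the other side. *)
Lemma weak_increment (a b : R) : 0 < a -> a < b -> b < l ->
  lebesgue_pt F a -> lebesgue_pt F b -> f b - f a = prim g b - prim g a.
Proof.
move=> a0 ab bl Fa Fb.
have l0 : 0 < l by lra.
have [e [e0 ae abe be]] : exists e : R,
    [/\ 0 < e, 0 < a - 2 * e, a + 2 * e < b & b + 2 * e < l].
  exists (Num.min a (Num.min (b - a) (l - b)) / 4).
  have h1 : 0 < Num.min a (Num.min (b - a) (l - b)).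
    by rewrite !lt_min a0 !subr_gt0 ab.
  have h2 : Num.min a (Num.min (b - a) (l - b)) <= a by rewrite ge_min lexx.
  have h3 : Num.min a (Num.min (b - a) (l - b)) <= b - a.
    by rewrite !ge_min lexx orbT.
  have h4 : Num.min a (Num.min (b - a) (l - b)) <= l - b.
    by rewrite !ge_min lexx !orbT.
  by split; lra.
pose d n : R := e / n.+1%:R.
have d0 n : 0 < d n by rewrite divr_gt0.
have de n : d n <= e by rewrite ler_pdivrMr// ler_peMr ?ler1n// ltW.
pose h n x := bump a (d n) x - bump b (d n) x.
have cb c' n : cont_on l (bump c' (d n)).
  by apply: continuous_cont_on; exact: bump_continuous.
have primh n x : 0 <= x <= l ->
    prim (h n) x = prim (bump a (d n)) x - prim (bump b (d n)) x.
  by move=> xl; exact: primB (cb a n) (cb b n) xl.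
have Pa n x : 0 <= x <= l -> [/\ 0 <= prim (bump a (d n)) x <= 1,
    x <= a -> prim (bump a (d n)) x = 0 & a + 2 * d n <= x -> prim (bump a (d n)) x = 1].
  by move=> xl; apply: prim_bump => //; have := de n; lra.
have Pb n x : 0 <= x <= l -> [/\ 0 <= prim (bump b (d n)) x <= 1,
    x <= b -> prim (bump b (d n)) x = 0 & b + 2 * d n <= x -> prim (bump b (d n)) x = 1].
  by move=> xl; apply: prim_bump => //; have := de n; lra.
have ll : 0 <= l <= l by rewrite lexx ltW.
have tf n : test_function l (prim (h n)) /\ derive1 (prim (h n)) = h n.
  apply: (@test_function_prim _ _ a (b + 2 * d n)) => //.
  - by move=> x; apply: cvgB; exact: bump_continuous.
  - by have := d0 n; lra.
  - by have := de n; lra.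
  - move=> t ht; have [ta|ta] := eqVneq (bump a (d n) t) 0.
      have : bump b (d n) t != 0.
        by apply: contraNneq ht => tb; rewrite /h ta tb subrr.
      by move=> /bump_supp/andP[? ?]; apply/andP; split; lra.
    by move: ta => /bump_supp/andP[? ?]; have dn := de n; apply/andP; split; lra.
  - rewrite primh//; have [_ _ ->] := Pa n l ll; last by have := de n; lra.
    by have [_ _ ->] := Pb n l ll; [rewrite subrr|have := de n; lra].
have fbi c' n : integ l (fun x => f x * bump c' (d n) x).
  by apply: integMcont.
have eqn n : integral_oo l (fun x => f x * bump a (d n) x) -
    integral_oo l (fun x => f x * bump b (d n) x) =
    - integral_oo l (fun x => g x * prim (h n) x).
  have [tn dn] := tf n; rewrite -(fg tn) dn -integral_ooB//.
  by apply: eq_integral_oo => x _; rewrite /h; ring.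
have lhs : integral_oo l (fun x => f x * bump a (d n) x) -
    integral_oo l (fun x => f x * bump b (d n) x) @[n --> \oo] --> f a - f b.
  by apply: cvgB; apply: bump_limit => //; lra.
pose ab_set : set R := `]a, b]%classic.
have subab : ab_set `<=` I.
  move=> x; rewrite /ab_set /I/= !in_itv/= => /andP[? ?].
  by apply/andP; split; lra.
have mI : measurable I by exact: measurable_itv.
have mab : measurable ab_set by exact: measurable_itv.
have rhs : integral_oo l (fun x => g x * prim (h n) x) @[n --> \oo] -->
    prim g b - prim g a.
  have -> : prim g b - prim g a = \int[mu]_(x in I) (g \_ ab_set) x.
    rewrite -Rintegral_mkcondr setIidr// /prim.
    have gb : mu.-integrable `[0, b] (EFin \o g).
      apply: integrableS (integ_cc gi) => //; apply: subset_itvl.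
      by rewrite bnd_simp ltW.
    by rewrite (Rintegral_itvB gb)// bnd_simp ltW.
  have ghi n : integ l (fun x => g x * prim (h n) x).
    apply: integMcont => //; apply: prim_cont; exact: cont_onB (cb a n) (cb b n).
  have [||||| int_lim _ cvg_lim] := @dominated_convergence _ _ _ mu I mI
    (fun n x => (g x * prim (h n) x)%:E) (EFin \o (g \_ ab_set))
    (fun x => `|(g x)%:E|%E).
  - by move=> n; have /measurable_EFinP := integ_measurable (ghi n).
  - apply/measurable_EFinP; apply/(measurable_restrict g mab mI).
    by rewrite setIidr//; apply: measurable_funS (integ_measurable gi).
  - apply: filterE => x; rewrite /I/= in_itv/= => /andP[x0 xl].
    have xl' : 0 <= x <= l by rewrite !ltW.
    apply: cvg_EFin; first exact: nearW.
    have key (v : R) : (\forall n \near \oo, prim (h n) x = v) ->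
        (g x * prim (h n) x) @[n --> \oo] --> g x * v.
      by move=> H; apply: cvg_near_cst; apply: filterS H => n ->.
    have small (y : R) : 0 < y -> \forall n \near \oo, 2 * d n <= y.
      move=> y0; have dcv : (2 * d n) @[n --> \oo] --> (0 : R).
        rewrite -(mulr0 2); apply: cvgM; first exact: cvg_cst.
        by rewrite -(mulr0 e); apply: cvgM; [exact: cvg_cst|exact: cvg_harmonic].
      exact: (cvgr_le _ dcv).
    rewrite patchE; case: ifPn; rewrite /ab_set; last first.
      move=> /negP xab.
      suff : (g x * prim (h n) x) @[n --> \oo] --> g x * 0 by rewrite mulr0.
      apply: key.
      have [xa|ax] := leP x a.
        apply: nearW => n; rewrite primh//.
        have [_ pa _] := Pa n x xl'; have [_ pb _] := Pb n x xl'.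
        by rewrite pa// pb ?subrr// (le_trans xa (ltW ab)).
      have bx : b < x.
        rewrite ltNge; apply/negP => xb; apply: xab.
        by rewrite inE/= in_itv/= ax.
      have := small (x - b); rewrite subr_gt0 => /(_ bx).
      apply: filterS => n dn; rewrite primh//.
      have [_ _ ->] := Pa n x xl'; last by lra.
      by have [_ _ ->] := Pb n x xl'; [rewrite subrr|lra].
    rewrite inE/= in_itv/= => /andP[ax xb].
    suff : (g x * prim (h n) x) @[n --> \oo] --> g x * 1 by rewrite mulr1.
    apply: key.
    have := small (x - a); rewrite subr_gt0 => /(_ ax).
    apply: filterS => n dn; rewrite primh//.
    have [_ _ ->] := Pa n x xl'; last by lra.
    by have [_ pb _] := Pb n x xl'; rewrite pb// subr0.
  - exact: integrable_abse gi.
  - apply: filterE => x n; rewrite /I/= in_itv/= => /andP[x0 xl].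
    have xl' : 0 <= x <= l by rewrite !ltW.
    rewrite lee_fin normrM ler_piMr// primh//.
    have [u01 _ _] := Pa n x xl'; have [v01 _ _] := Pb n x xl'.
    exact: dist01_le1.
  have fin : (\int[mu]_(x in I) (EFin \o (g \_ ab_set)) x)%E \is a fin_num.
    exact: integrable_fin_num.
  move: cvg_lim; rewrite -(fineK fin) => /fine_cvg; exact.
have lhs' : integral_oo l (fun x => f x * bump a (d n) x) -
    integral_oo l (fun x => f x * bump b (d n) x) @[n --> \oo] -->
    - (prim g b - prim g a).
  by under eq_fun do rewrite eqn; exact: cvgN.
by rewrite -opprB (norm_cvg_unique lhs lhs') opprK.
Qed.

(** Almost every point is a Lebesgue point, and between such points [f] and [prim g] have equal
    increments; the constant is read at one of them. *)
Lemma weak_derivative_prim : exists c, ae_eq_on l f (fun x => c + prim g x).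
Proof.
have mI : measurable I by exact: measurable_itv.
have locF : locally_integrable setT F := integrable_locally mI fi.
have [[a0 [a0l La0]]|none] := pselect (exists a0, 0 < a0 < l /\ lebesgue_pt F a0).
  exists (f a0 - prim g a0).
  apply: filterS (lebesgue_differentiation locF) => x Lx /andP[x0 xl].
  case/andP: a0l => a00 a0l.
  case: (ltgtP x a0) => [xa|ax|->]; last by ring.
    by have := weak_increment x0 xa a0l Lx La0; lra.
  by have := weak_increment a00 ax xl La0 Lx; lra.
(* Without an interior Lebesgue point the claim holds vacuously. *)
exists 0; apply: filterS (lebesgue_differentiation locF) => x Lx xl.
by exfalso; apply: none; exists x.
Qed.

End DuBoisReymond.
End WeakDerivative.

(** * Real weak derivatives: continuous representatives, uniqueness, products *)

Section RealWeakDerivative.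
Variable R : realType.
Implicit Types (l a b c d x y z t : R) (f g h phi : R -> R).
Local Notation mu := (@lebesgue_measure R).
Definition wder l f g : Prop :=
  [/\ sqint l f, sqint l g & forall phi, test_function l phi ->
    integral_oo l (fun x => f x * derive1 phi x) =
    - integral_oo l (fun x => g x * phi x)].

Lemma test_function_deriv l phi : test_function l phi ->
  [/\ deriv_on l phi (derive1 phi), cont_on l (derive1 phi), phi 0 = 0 & phi l = 0].
Proof.
move=> [dphi cphi' [a [b [a0 bl supp]]]].
have supp0 x : ~~ (a <= x <= b) -> phi x = 0.
  by move=> nx; apply/eqP; apply: contraNT nx; exact: supp.
split.
- split=> [|x _].
    apply: continuous_cont_on => x.
    by apply: differentiable_continuous; apply/derivable1_diffP; exact: dphi.
  by rewrite derive1E; exact: derivableP.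
- exact: continuous_cont_on.
- by apply: supp0; rewrite negb_and -!ltNge a0.
- by apply: supp0; rewrite negb_and -!ltNge bl orbT.
Qed.

Lemma integ_prim_cont l g : integ l g -> cont_on l (prim g).
Proof.
move=> gi; case: (leP 0 l) => [l0|l0].
  exact: parameterized_integral_continuous (integ_cc gi).
by apply/cont_onP => x /andP[x0 xl]; move: (le_trans x0 xl); rewrite leNgt l0.
Qed.

Lemma wder_prim l f g : wder l f g -> exists c, ae_eq_on l f (fun x => c + prim g x).
Proof.
by move=> [/sqint_integ fi /sqint_integ gi fg]; exact: weak_derivative_prim.
Qed.

Lemma wder_cont_rep l f g : wder l f g -> exists2 F, cont_on l F & ae_eq_on l f F.
Proof.
move=> fg; have [c e] := wder_prim fg; have [_ /sqint_integ gi _] := fg.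
exists (fun x => c + prim g x) => //.
by apply: cont_onD; [exact: cont_on_cst|exact: integ_prim_cont].
Qed.

Variable l : R.
Hypothesis l_gt0 : 0 < l.

Lemma integral_test f phi : sqint l f -> test_function l phi ->
  integ l (fun x => f x * phi x) /\ integ l (fun x => f x * derive1 phi x).
Proof.
move=> /sqint_integ fi /test_function_deriv[/deriv_on_cont cp cp' _ _].
by split; exact: integMcont.
Qed.

Lemma wder_ae f g f' g' : wder l f g -> ae_eq_on l f f' -> ae_eq_on l g g' ->
  sqint l f' -> sqint l g' -> wder l f' g'.
Proof.
move=> [fs gs fg] ff gg fs' gs'; split=> // phi tphi.
have [f1 f2] := integral_test fs tphi; have [g1 g2] := integral_test gs tphi.
have [f1' f2'] := integral_test fs' tphi; have [g1' g2'] := integral_test gs' tphi.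
rewrite -(@ae_integral_oo _ _ (fun x => f x * derive1 phi x)) ?fg//;
  try exact: integ_measurable.
  congr (- _); apply: ae_integral_oo; try exact: integ_measurable.
  by apply: filterS gg => x H xl; rewrite H.
by apply: filterS ff => x H xl; rewrite H.
Qed.

Lemma wderD f g f' g' : wder l f g -> wder l f' g' ->
  wder l (fun x => f x + f' x) (fun x => g x + g' x).
Proof.
move=> [fs gs fg] [fs' gs' fg']; split; [exact: sqintD|exact: sqintD|].
move=> phi tphi.
have [f1 f2] := integral_test fs tphi; have [g1 g2] := integral_test gs tphi.
have [f1' f2'] := integral_test fs' tphi; have [g1' g2'] := integral_test gs' tphi.
under [in LHS]eq_integral_oo do rewrite mulrDl.
under [in RHS]eq_integral_oo do rewrite mulrDl.
by rewrite !integral_ooD// fg// fg'// opprD.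
Qed.

Lemma wderN f g : wder l f g -> wder l (fun x => - f x) (fun x => - g x).
Proof.
move=> [fs gs fg]; split; [exact: sqintN|exact: sqintN|] => phi tphi.
have [f1 f2] := integral_test fs tphi; have [g1 g2] := integral_test gs tphi.
under [in LHS]eq_integral_oo do rewrite mulNr -mulN1r.
under [in RHS]eq_integral_oo do rewrite mulNr -mulN1r.
by rewrite !integral_ooZ// fg// !mulN1r.
Qed.

Lemma wderB f g f' g' : wder l f g -> wder l f' g' ->
  wder l (fun x => f x - f' x) (fun x => g x - g' x).
Proof. by move=> fg /wderN; exact: wderD. Qed.

(** The difference [K] is a weak derivative of 0, so its primitive is constant on []0, l[]; Lebesgue
    differentiation recovers [K] from that primitive almost everywhere. *)
Lemma wder_unique f g f' g' : wder l f g -> wder l f' g' -> ae_eq_on l f f' ->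
  ae_eq_on l g g'.
Proof.
move=> fg fg' ff.
pose k x := g x - g' x; pose I : set R := `]0, l[%classic; pose K := k \_ I.
have kK x : 0 < x < l -> k x = K x by move=> xl; rewrite /K patchE mem_set// /I/= in_itv.
have [_ ks _] := wderB fg fg'.
have Ks : sqint l K by exact: eq_sqint kK ks.
have c0 := @cont_on0 R l.
have w0 : wder l (fun=> 0) K.
  apply: wder_ae (wderB fg fg') _ _ (cont_sqint c0) Ks.
    by apply: filterS ff => x H xl; rewrite H// subrr.
  exact: eq_ae_eq_on.
have [c cK] := wder_prim w0.
have Ki := sqint_integ Ks.
have cP := cont_onD (@cont_on_cst _ l c) (integ_prim_cont Ki).
have PK x : 0 < x < l -> prim K x = - c.
  move=> /andP[x0 xl]; have /= := ae_eq_cont c0 cP cK l_gt0 (x := x).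
  by rewrite !ltW// => /(_ isT); lra.
have mI : measurable I by exact: measurable_itv.
have locK : locally_integrable setT K := integrable_locally mI (sqint_integ ks).
apply: filterS (lebesgue_differentiation locK) => x Lx xl.
suff Kx : K x = 0 by apply/eqP; rewrite -subr_eq0 -/(k x) kK// Kx.
case/andP: (xl) => x0 xl'.
have [|_ <-] := FTC1_lebesgue_pt xl' (integ_cc Ki) _ Lx.
  by rewrite lte_fin.
rewrite derive1E -[RHS](derive_cst (- c) x (1 : R)); apply: near_eq_derive.
have : x \in `]0, l[ by rewrite in_itv.
by move/near_in_itvoo; apply: filterS => y; rewrite in_itv/= => yl; exact: (PK y yl).
Qed.

Lemma eq_deriv_on_fun f g f' : (forall x, 0 <= x <= l -> f x = g x) ->
  deriv_on l f f' -> deriv_on l g f'.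
Proof.
move=> fg [cf df]; split; first exact: eq_cont_on cf.
move=> x xl; apply: near_eq_is_derive (df x xl).
have : x \in `]0, l[ by rewrite in_itv.
move/near_in_itvoo; apply: filterS => y; rewrite in_itv/= => /andP[y0 yl].
by rewrite fg// !ltW.
Qed.

Lemma wder_deriv_on f g : wder l f g -> cont_on l f -> cont_on l g -> deriv_on l f g.
Proof.
move=> fg cf cg; have [c fc] := wder_prim fg.
have cF := cont_onD (@cont_on_cst _ l c) (prim_cont cg).
have fE := ae_eq_cont cf cF fc l_gt0.
apply: (@eq_deriv_on_fun (fun x => c + prim g x)); first by move=> x /fE.
apply: eq_deriv_on (deriv_onD (deriv_on_cst l c) (prim_deriv cg)) => x _.
by rewrite add0r.
Qed.

Lemma deriv_on_wder f g : deriv_on l f g -> cont_on l g -> wder l f g.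
Proof.
move=> df cg; have cf := deriv_on_cont df.
split; [exact: cont_sqint|exact: cont_sqint|] => phi tphi.
have [dphi cphi' p0 pl] := test_function_deriv tphi.
have [f1 f2] := integral_test (cont_sqint cf) tphi.
have [g1 g2] := integral_test (cont_sqint cg) tphi.
apply/eqP; rewrite -addr_eq0 -integral_ooD// integral_ooE; last exact: integD.
have il : 0 <= l <= l by rewrite lexx ltW.
have D := deriv_onM df dphi.
have cD := cont_onD (cont_onM cf cphi') (cont_onM cg (deriv_on_cont dphi)).
have {}D : deriv_on l (fun x => f x * phi x) (fun x => f x * derive1 phi x + g x * phi x).
  by apply: eq_deriv_on D => x _; rewrite addrC.
by rewrite (primE D cD il) p0 pl !mulr0 subrr.
Qed.

(** [h] is regular only inside the segment; at every other point the product vanishes in a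
    neighbourhood, since the support of [phi] stays away from the ends. *)
Lemma test_functionM h h' phi : deriv_on l h h' -> cont_on l h' ->
  test_function l phi ->
  test_function l (fun x => h x * phi x) /\
  forall x, 0 < x < l ->
    derive1 (fun x => h x * phi x) x = h' x * phi x + h x * derive1 phi x.
Proof.
move=> dh ch' tphi; have [dphi cphi' _ _] := test_function_deriv tphi.
have [_ dM] := deriv_onM dh dphi.
have [dphiR cphiR' [a [b [a0 bl supp]]]] := tphi.
have E x : 0 < x < l ->
    derive1 (fun x => h x * phi x) x = h' x * phi x + h x * derive1 phi x.
  by move=> xl; have ? := dM x xl; rewrite derive1E; exact: derive_val.
split=> //.
have supp0 x : ~~ (a <= x <= b) -> h x * phi x = 0.
  by move=> nx; rewrite (_ : phi x = 0) ?mulr0//; apply/eqP; apply: contraNT nx; exact: supp.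
have near0 x : ~~ (0 < x < l) -> \forall y \near x, ~~ (a <= y <= b).
  rewrite negb_and -!leNgt => /orP[x0|lx].
    have : x < a by exact: le_lt_trans a0.
    move=> /lt_nbhsl; apply: filterS => y ya.
    by rewrite negb_and -!ltNge ya.
  have : b < x by exact: lt_le_trans lx.
  move=> /lt_nbhsr; apply: filterS => y yb.
  by rewrite negb_and -!ltNge yb orbT.
have der0 x : (\forall y \near x, ~~ (a <= y <= b)) ->
    is_derive x 1 (fun x => h x * phi x) 0.
  move=> nx; apply: near_eq_is_derive (is_derive_cst (0 : R) x 1).
  by apply: filterS nx => y /supp0.
split.
- move=> x; have [/dM[]//|/near0/der0[]//] := boolP (0 < x < l).
- move=> x; have [xl|nx] := boolP (0 < x < l).
    have cx : {for x, continuous (fun x => h' x * phi x + h x * derive1 phi x)}.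
      apply: cont_on_at xl _; apply: cont_onD; apply: cont_onM => //.
      + exact: deriv_on_cont dphi.
      + exact: deriv_on_cont dh.
    rewrite /continuous_at E//; apply: cvg_trans cx; apply: near_eq_cvg.
    have : x \in `]0, l[ by rewrite in_itv.
    by move/near_in_itvoo; apply: filterS => y; rewrite in_itv/= => /E.
  have n0 := near0 x nx.
  have e0 y : (\forall z \near y, ~~ (a <= z <= b)) ->
      derive1 (fun x => h x * phi x) y = 0.
    by move=> /der0 ?; rewrite derive1E; exact: derive_val.
  rewrite /continuous_at (e0 _ n0); apply: cvg_near_cst.
  by move/near_join : n0; apply: filterS => y /e0.
- exists a, b; split=> // x; apply: contraNT => nx.
  by apply/eqP; exact: supp0.
Qed.

(* A test function times a C^1 function is again a test function. *)
Lemma wderM f g h h' : wder l f g -> deriv_on l h h' -> cont_on l h' ->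
  wder l (fun x => f x * h x) (fun x => g x * h x + f x * h' x).
Proof.
move=> [fs gs fg] dh ch'; have ch := deriv_on_cont dh.
have fhs : sqint l (fun x => f x * h x) by exact: sqintMcont.
have ghs : sqint l (fun x => g x * h x) by exact: sqintMcont.
have fhs' : sqint l (fun x => f x * h' x) by exact: sqintMcont.
split=> //; first exact: sqintD.
move=> phi tphi; have [tM dM] := test_functionM dh ch' tphi.
have [i1 i2] := integral_test fhs tphi; have [i3 _] := integral_test ghs tphi.
have [i4 _] := integral_test fhs' tphi.
have := fg _ tM.
rewrite (@eq_integral_oo _ _ _ (fun x => f x * h' x * phi x + f x * h x * derive1 phi x));
  last by move=> x /dM ->; ring.
rewrite (@eq_integral_oo _ _ (fun x => g x * (h x * phi x)) (fun x => g x * h x * phi x));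
  last by move=> x _; ring.
rewrite integral_ooD// => e.
rewrite (@eq_integral_oo _ _ (fun x => (g x * h x + f x * h' x) * phi x)
  (fun x => g x * h x * phi x + f x * h' x * phi x)); last by move=> x _; ring.
rewrite integral_ooD// opprD -e.
by rewrite addrC addrA addNr add0r.
Qed.

End RealWeakDerivative.

Local Open Scope complex_scope.

(** * Complex weak derivatives and the operator [wD] *)

Section ComplexWeakDerivative.
Variable R : realType.
Implicit Types (l x y z t : R) (f g h : R -> R[i]).
Local Notation mu := (@lebesgue_measure R).
Definition re f : R -> R := fun x => complex.Re (f x).
Definition im f : R -> R := fun x => complex.Im (f x).
Arguments re : simpl never.
Arguments im : simpl never.
Definition cplx (u v : R -> R) : R -> R[i] := fun x => u x +i* v x.

Lemma eq_cplx (z w : R[i]) : complex.Re z = complex.Re w ->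
  complex.Im z = complex.Im w -> z = w.
Proof. by case: z => a b; case: w => c d /= -> ->. Qed.

Lemma re_real (z : R[i]) (t : R) : complex.Re (z * t%:C) = complex.Re z * t.
Proof. by case: z => a b /=; rewrite mulr0 subr0. Qed.

Lemma im_real (z : R[i]) (t : R) : complex.Im (z * t%:C) = complex.Im z * t.
Proof. by case: z => a b /=; rewrite mulr0 add0r. Qed.

Lemma re_toC (u : R -> R) : re (toC u) = u. Proof. by apply/funext. Qed.
Lemma im_toC (u : R -> R) : im (toC u) = fun=> 0. Proof. by apply/funext. Qed.

Lemma normc_sqr (z : R[i]) :
  Normc.normc z ^+ 2 = complex.Re z ^+ 2 + complex.Im z ^+ 2.
Proof. by case: z => a b /=; rewrite sqr_sqrtr// addr_ge0// sqr_ge0. Qed.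

Variable l : R.
Hypothesis l_gt0 : 0 < l.

Let I : set R := `]0, l[.

Lemma L2P f : L2 l f <-> sqint l (re f) /\ sqint l (im f).
Proof.
have E : (\int[mu]_(x in I) ((Normc.normc (f x)) ^+ 2)%:E =
    \int[mu]_(x in I) (re f x ^+ 2 + im f x ^+ 2)%:E)%E.
  by apply: eq_integral => x _; rewrite normc_sqr.
split=> [[mr mi]|[[mr r2] [mi i2]]].
  rewrite -/I E => fin.
  have m2 : measurable_fun I (fun x => re f x ^+ 2 + im f x ^+ 2).
    by apply: measurable_funD; apply: measurable_funX.
  have i2 : integ l (fun x => re f x ^+ 2 + im f x ^+ 2).
    apply/integrableP; split; first exact/measurable_EFinP.
    apply: le_lt_trans fin; rewrite le_eqVlt; apply/orP; left; apply/eqP.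
    by apply: eq_integral => x _ /=; rewrite ger0_norm// addr_ge0// sqr_ge0.
  split; split=> //; apply: (@integ_bounded _ _ 1 _ _ _ i2) => //.
  - exact: measurable_funX.
  - move=> x _; rewrite mul1r !ger0_norm ?addr_ge0 ?sqr_ge0//.
    by rewrite lerDl sqr_ge0.
  - exact: measurable_funX.
  - move=> x _; rewrite mul1r !ger0_norm ?addr_ge0 ?sqr_ge0//.
    by rewrite lerDr sqr_ge0.
split=> //; rewrite -/I E.
have /integrableP[_] := integD r2 i2; apply: le_lt_trans.
apply: ge0_le_integral => //.
- exact: measurable_itv.
- by move=> x _; rewrite lee_fin addr_ge0// sqr_ge0.
- by apply/measurable_EFinP; apply: measurable_funD; apply: measurable_funX.
- apply: measurableT_comp => //; apply/measurable_EFinP.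
  by apply: measurable_funD; apply: measurable_funX.
- by move=> x _ /=; rewrite lee_fin ler_norm.
Qed.

(** Test functions are real, so the defining identity splits into real and imaginary parts. *)
Lemma weakP f g : weak_derivative l f g <->
  wder l (re f) (re g) /\ wder l (im f) (im g).
Proof.
have C h (u : R -> R) : Cintegral l (fun x => h x * (u x)%:C) =
    integral_oo l (fun x => re h x * u x) +i* integral_oo l (fun x => im h x * u x).
  rewrite /Cintegral /integral_oo; congr (_ +i* _); apply: eq_Rintegral => x _.
    exact: re_real.
  exact: im_real.
split=> [[/L2P[fr fi] /L2P[gr gi] H]|[[fr gr Hr] [fi gi Hi]]].
  by split; split=> // phi /H; rewrite !C => -[].
split; [exact/L2P|exact/L2P|] => phi tphi; rewrite !C.
by rewrite Hr// Hi//; apply: eq_cplx.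
Qed.

Lemma weak_re_im f (u v : R -> R) : wder l (re f) u -> wder l (im f) v ->
  weak_derivative l f (cplx u v).
Proof. by move=> ? ?; apply/weakP. Qed.

Definition cae f g := ae_eq_on l (re f) (re g) /\ ae_eq_on l (im f) (im g).

Lemma caeP f g : cae f g <-> {ae mu, forall x, 0 < x < l -> f x = g x}.
Proof.
split=> [[]|H]; last by split; apply: filterS H => x H xl; rewrite /re /im H.
by apply: filterS2 => x H K xl; apply: eq_cplx; [exact: H|exact: K].
Qed.

Lemma eq_cae f g : (forall x, 0 <= x <= l -> f x = g x) -> cae f g.
Proof.
move=> fg; apply/caeP; apply: filterE => x /andP[x0 xl].
by rewrite fg// !ltW.
Qed.

Lemma cae_refl f : cae f f. Proof. exact: eq_cae. Qed.

Lemma weak_ae f g f' g' : weak_derivative l f g -> cae f f' -> cae g g' ->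
  L2 l f' -> L2 l g' -> weak_derivative l f' g'.
Proof.
move=> /weakP[fr fi] [a1 a2] [b1 b2] /L2P[? ?] /L2P[? ?].
by apply/weakP; split; [exact: wder_ae fr _ _ _ _|exact: wder_ae fi _ _ _ _].
Qed.

Lemma weak_unique f g f' g' : weak_derivative l f g -> weak_derivative l f' g' ->
  cae f f' -> cae g g'.
Proof.
move=> /weakP[fr fi] /weakP[fr' fi'] [a1 a2]; split.
  exact: (wder_unique l_gt0 fr fr' a1).
exact: (wder_unique l_gt0 fi fi' a2).
Qed.

Lemma cont_L2 f : continuous_on_itv l f -> L2 l f.
Proof. by move=> [cr ci]; apply/L2P; split; exact: cont_sqint. Qed.

Lemma cae_cont f g : continuous_on_itv l f -> continuous_on_itv l g -> cae f g ->
  forall x, 0 <= x <= l -> f x = g x.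
Proof.
move=> [fr fi] [gr gi] [er ei] x xl; apply: eq_cplx.
  exact: (ae_eq_cont fr gr er l_gt0).
exact: (ae_eq_cont fi gi ei l_gt0).
Qed.

Lemma eq_continuous_on_itv f g : (forall x, 0 <= x <= l -> f x = g x) ->
  continuous_on_itv l f -> continuous_on_itv l g.
Proof.
by move=> e [cr ci]; split; [apply: eq_cont_on cr|apply: eq_cont_on ci] => x /e ->.
Qed.

Lemma weak_L2 f g : weak_derivative l f g -> L2 l f /\ L2 l g.
Proof. by case. Qed.

(** The default value of [xget] is never reached: a continuous weak derivative qualifies if there is
    one, and otherwise any weak derivative does, vacuously. *)
Lemma wD_weak f g : weak_derivative l f g -> weak_derivative l f (wD l f) /\
  ((exists h, weak_derivative l f h /\ continuous_on_itv l h) ->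
   continuous_on_itv l (wD l f)).
Proof.
move=> fg; rewrite /wD; apply: (@xgetPex _ _ [set g | weak_derivative l f g /\
    ((exists h, weak_derivative l f h /\ continuous_on_itv l h) ->
     continuous_on_itv l g)]).
have [[h [fh ch]]|nex] := pselect (exists h, weak_derivative l f h /\
    continuous_on_itv l h).
  by exists h.
by exists g.
Qed.

(** Evaluates nested [wD]: an inner [wD] is known only on [[0, l]], hence the replacement of [f] by
    a function that agrees with it there. *)
Lemma wD_eq f f0 g : (forall x, 0 <= x <= l -> f x = f0 x) ->
  weak_derivative l f0 g -> continuous_on_itv l f0 -> continuous_on_itv l g ->
  [/\ weak_derivative l f (wD l f), continuous_on_itv l (wD l f) &
      forall x, 0 <= x <= l -> wD l f x = g x].
Proof.
move=> e fg cf cg.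
have cf' : continuous_on_itv l f by apply: eq_continuous_on_itv cf => x /e.
have fg' : weak_derivative l f g.
  apply: weak_ae fg _ (cae_refl g) (cont_L2 cf') (cont_L2 cg).
  by apply: eq_cae => x /e.
have [w c] := wD_weak fg'; have cw : continuous_on_itv l (wD l f) by apply: c; exists g.
by split=> //; apply: cae_cont => //; apply: weak_unique w fg' (cae_refl f).
Qed.

(** A weak derivative that itself has one is a primitive almost everywhere, so it has a continuous
    representative, and [wD] selects it. *)
Lemma wD_regular f g h : weak_derivative l f g -> weak_derivative l g h ->
  [/\ weak_derivative l f (wD l f), continuous_on_itv l (wD l f) &
      weak_derivative l (wD l f) h].
Proof.
move=> fg gh; have /weakP[gr gi] := gh.
have [u cu gu] := wder_cont_rep gr; have [v cv gv] := wder_cont_rep gi.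
have cuv : continuous_on_itv l (cplx u v) by split.
have guv : cae g (cplx u v) by split.
have [Lf Lg] := weak_L2 fg; have [_ Lh] := weak_L2 gh.
have fuv : weak_derivative l f (cplx u v).
  by apply: weak_ae fg (cae_refl f) guv Lf (cont_L2 cuv).
have [w c] := wD_weak fuv.
have cw : continuous_on_itv l (wD l f) by apply: c; exists (cplx u v).
split=> //; apply: weak_ae gh _ (cae_refl h) (cont_L2 cw) Lh.
exact: weak_unique fg w (cae_refl f).
Qed.

Lemma weak_deriv_on f g : weak_derivative l f g -> continuous_on_itv l f ->
  continuous_on_itv l g -> deriv_on l (re f) (re g) /\ deriv_on l (im f) (im g).
Proof.
move=> /weakP[fr fi] [cr ci] [dr di]; split.
  exact: (wder_deriv_on l_gt0 fr).
exact: (wder_deriv_on l_gt0 fi).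
Qed.

Lemma weakB f g f' g' : weak_derivative l f g -> weak_derivative l f' g' ->
  weak_derivative l (fun x => f x - f' x) (fun x => g x - g' x).
Proof.
have reB (u v : R -> R[i]) : re (fun x => u x - v x) = fun x => re u x - re v x.
  by apply/funext => x; rewrite /re; case: (u x) => a b; case: (v x).
have imB (u v : R -> R[i]) : im (fun x => u x - v x) = fun x => im u x - im v x.
  by apply/funext => x; rewrite /im; case: (u x) => a b; case: (v x).
move=> /weakP[fr fi] /weakP[gr gi]; apply/weakP; rewrite !reB !imB.
by split; exact: wderB.
Qed.

Lemma weak_toC (u v : R -> R) : wder l u v -> weak_derivative l (toC u) (toC v).
Proof.
move=> uv; apply/weakP; rewrite !re_toC !im_toC; split=> //.
by apply: deriv_on_wder => //; [exact: deriv_on_cst|exact: cont_on0].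
Qed.

Lemma continuous_toC (u : R -> R) : cont_on l u -> continuous_on_itv l (toC u).
Proof. by move=> cu; split; [exact: cu|exact: cont_on0]. Qed.

End ComplexWeakDerivative.

(** * The spectral problem as a first-order system *)

Section EigenSystem.
Variable R : realType.
Implicit Types (x y z t : R) (lam : R[i]) (S T : state R).
Local Notation mu := (@lebesgue_measure R).
Variables (l : R) (rho sigma q : R -> R).
Hypotheses (l_gt0 : 0 < l) (rhoH : Hsp l 2 (toC rho))
  (sigmaH : Hsp l 2 (toC sigma)) (qH : Hsp l 1 (toC q)).
Hypothesis sigma_gt0 : forall x, 0 <= x <= l -> 0 < sigma x.
Hypothesis rho_gt0 : forall x, 0 <= x <= l -> 0 < rho x.

Let a x := (sigma x)^-1.

Lemma Hsp_toC_cont k (u : R -> R) : Hsp l k (toC u) -> cont_on l u.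
Proof. by case=> _ []. Qed.

Let crho : cont_on l rho := Hsp_toC_cont rhoH.
Let csigma : cont_on l sigma := Hsp_toC_cont sigmaH.
Let cq : cont_on l q := Hsp_toC_cont qH.

Let a_cont : cont_on l a.
Proof. by apply: cont_onV => // x /sigma_gt0/lt0r_neq0. Qed.

Lemma sigma_derivatives : exists s s' : R -> R,
  [/\ deriv_on l sigma s, cont_on l s & wder l s s'].
Proof.
have [[g1 w1 [g2 w2 _]] csig] := sigmaH.
have [w c k] := wD_regular l_gt0 w1 w2.
exists (re (wD l (toC sigma))), (re g2); split.
- by have [] := weak_deriv_on l_gt0 w csig c; rewrite re_toC.
- by have [] := c.
- by have /(weakP l)[] := k.
Qed.

Lemma q_derivative : exists q', wder l q q'.
Proof.
by have [[g1 /(weakP l)[]]] := qH; rewrite re_toC; exists (re g1).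
Qed.

(** Membership in H^4 makes [y], [u = y'], [z = y''] and [w = sigma z] differentiable with
    continuous derivatives. The equation then gives [v = w' - q u] the continuous weak derivative
    [lam rho y]. The imaginary part of [lam] couples the real and imaginary parts. *)
Lemma eigenspace_states lam (y : R -> R[i]) :
  in_eigenspace l rho sigma q lam y -> exists S T,
  [/\ sy S = re y, sy T = im y,
    clamped l a q rho (complex.Re lam)
      (fun x => - complex.Im lam * (rho x * sy T x)) S,
    clamped l a q rho (complex.Re lam)
      (fun x => complex.Im lam * (rho x * sy S x)) T &
    forall x, 0 <= x <= l ->
      (sigma x)%:C * wD l (wD l y) x = sw S x +i* sw T x].
Proof.
move=> [[[[g1 w1 [g2 w2 [g3 w3 [g4 w4 _]]]] cy] [_ [y0 u0 yl ul]]] eqn].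
have [yu cu ug] := wD_regular l_gt0 w1 w2; set u := wD l y in yu cu ug u0 ul eqn *.
have [uz cz zg] := wD_regular l_gt0 ug w3; set z := wD l u in uz cz zg eqn *.
have [zz cz1 z1g] := wD_regular l_gt0 zg w4; set z1 := wD l z in zz cz1 z1g.
have [dyr dyi] := weak_deriv_on l_gt0 yu cy cu.
have [dur dui] := weak_deriv_on l_gt0 uz cu cz.
have [dzr dzi] := weak_deriv_on l_gt0 zz cz cz1.
have /(weakP l)[z1r z1i] := z1g.
have [s [s' [dsig cs ss']]] := sigma_derivatives; have [q' qq'] := q_derivative.
have [cyr cyi] := cy; have [cur cui] := cu; have [czr czi] := cz.
have [cz1r cz1i] := cz1.
set w := fun t => toC sigma t * wD l (wD l y) t in eqn.
have wre : re w = fun x => sigma x * re z x.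
  by apply/funext => x; rewrite /re /w mulrC re_real mulrC.
have wim : im w = fun x => sigma x * im z x.
  by apply/funext => x; rewrite /im /w mulrC im_real mulrC.
pose p0r x := s x * re z x + sigma x * re z1 x.
pose p0i x := s x * im z x + sigma x * im z1 x.
have dwr : deriv_on l (re w) p0r by rewrite wre; exact: deriv_onM.
have dwi : deriv_on l (im w) p0i by rewrite wim; exact: deriv_onM.
have cp0r : cont_on l p0r := cont_onD (cont_onM cs czr) (cont_onM csigma cz1r).
have cp0i : cont_on l p0i := cont_onD (cont_onM cs czi) (cont_onM csigma cz1i).
have cw : continuous_on_itv l w by split; [exact: deriv_on_cont dwr|exact: deriv_on_cont dwi].
have cp0 : continuous_on_itv l (cplx p0r p0i) by split.
have wp0 : weak_derivative l w (cplx p0r p0i) :=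
  weak_re_im (deriv_on_wder l_gt0 dwr cp0r) (deriv_on_wder l_gt0 dwi cp0i).
have comm f g h k : wder l (fun x => f x * g x) (fun x => h x * g x + f x * k x) ->
    wder l (fun x => g x * f x) (fun x => h x * g x + f x * k x).
  rewrite (_ : (fun x => f x * g x) = (fun x => g x * f x))//.
  by apply/funext => x; rewrite mulrC.
(* In each product of [w' = s z + sigma z1] one factor is only weakly differentiable ([s], then
   [z1]) and the other is C^1. *)
have p0r' := wderD l_gt0 (wderM l_gt0 ss' dzr cz1r) (comm _ _ _ _ (wderM l_gt0 z1r dsig cs)).
have p0i' := wderD l_gt0 (wderM l_gt0 ss' dzi cz1i) (comm _ _ _ _ (wderM l_gt0 z1i dsig cs)).
have p0' : weak_derivative l (cplx p0r p0i) _ :=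
  @weak_re_im _ l (cplx p0r p0i) _ _ p0r' p0i'.
have [wp cp pp0] := wD_eq l_gt0 (fun x _ => erefl (w x)) wp0 cw cp0.
set p := wD l w in wp cp pp0 eqn.
have pA : weak_derivative l p (wD l p).
  have := weak_ae l_gt0 p0' (eq_cae (fun x xl => esym (pp0 x xl))) (cae_refl _ _)
    (cont_L2 cp) (proj2 (weak_L2 p0')).
  by move=> /wD_weak[].
set qu := fun t => toC q t * wD l y t in eqn.
have qure : re qu = fun x => q x * re u x.
  by apply/funext => x; rewrite /re /qu mulrC re_real mulrC.
have quim : im qu = fun x => q x * im u x.
  by apply/funext => x; rewrite /im /qu mulrC im_real mulrC.
have qur' := wderM l_gt0 qq' dur czr; have qui' := wderM l_gt0 qq' dui czi.
have quB : weak_derivative l qu (wD l qu).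
  rewrite -qure in qur'; rewrite -quim in qui'.
  by have /wD_weak[] := weak_re_im qur' qui'.
pose v x := p x - qu x.
pose F x := lam * ((rho x)%:C * y x).
have Fre : re F = fun x => complex.Re lam * (rho x * re y x)
    - complex.Im lam * (rho x * im y x).
  apply/funext => x; rewrite /re /im /F; case: (y x) => b c; move: (lam) => [d e] /=.
  by ring.
have Fim : im F = fun x => complex.Re lam * (rho x * im y x)
    + complex.Im lam * (rho x * re y x).
  apply/funext => x; rewrite /re /im /F; case: (y x) => b c; move: (lam) => [d e] /=.
  by ring.
have cst c f : cont_on l f -> cont_on l (fun x => c * (rho x * f x)).
  by move=> cf; apply: cont_onM; [exact: cont_on_cst|exact: cont_onM].
have cF : continuous_on_itv l F.
  by split; rewrite -/(re F) -/(im F) ?Fre ?Fim; [apply: cont_onB|apply: cont_onD]; exact: cst.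
have cqu : continuous_on_itv l qu.
  by split; rewrite -/(re qu) -/(im qu) ?qure ?quim; exact: cont_onM.
have vre : re v = fun x => re p x - re qu x.
  by apply/funext => x; rewrite /re /v; case: (p x) => b c; case: (qu x).
have vim : im v = fun x => im p x - im qu x.
  by apply/funext => x; rewrite /im /v; case: (p x) => b c; case: (qu x).
have [cpr cpi] := cp; have [cqr cqi] := cqu.
have cv : continuous_on_itv l v.
  by split; rewrite -/(re v) -/(im v) ?vre ?vim; exact: cont_onB.
(* The equation holds only almost everywhere, which is enough to exchange the weak derivative of [v]
   for the continuous [F]. *)
have vF : weak_derivative l v F.
  have vB : weak_derivative l v _ := weakB l_gt0 pA quB.
  apply: (weak_ae l_gt0 vB (cae_refl l v) _ (cont_L2 cv) (cont_L2 cF)).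
  apply/caeP; apply: filterS eqn => x H xl.
  have := H; rewrite in_itv/= => /(_ xl); rewrite /opA -/w -/p -/qu => e.
  have r0 : toC rho x != 0.
    rewrite /toC eq_complex /= eqxx andbT; case/andP: xl => x0 xl.
    by rewrite lt0r_neq0// rho_gt0// !ltW.
  by rewrite /F -/(toC rho x) mulrCA -e mulVKf.
have [dvr dvi] := weak_deriv_on l_gt0 vF cv cF.
have sig0 x : 0 < x < l -> sigma x != 0.
  by move=> /andP[x0 xl]; rewrite lt0r_neq0// sigma_gt0// !ltW.
have pr x : 0 <= x <= l -> re p x = p0r x by move=> xl; rewrite /re pp0.
have pim x : 0 <= x <= l -> im p x = p0i x by move=> xl; rewrite /im pp0.
have oo x : 0 < x < l -> 0 <= x <= l by move=> /andP[x0 xl]; rewrite !ltW.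
exists (State (re y) (re u) (re w) (re v)), (State (im y) (im u) (im w) (im v)).
split=> //=.
- split; [split=> //=|by rewrite /= /re y0|by rewrite /= /re u0|by rewrite /= /re yl|
    by rewrite /= /re ul].
  + apply: eq_deriv_on dur => x /sig0 sx; rewrite wre /a.
    by rewrite mulrA mulVf// mul1r.
  + apply: eq_deriv_on dwr => x /oo xl; rewrite vre qure.
    by rewrite subrK pr.
  + by apply: eq_deriv_on dvr => x _; rewrite Fre; ring.
- split; [split=> //=|by rewrite /= /im y0|by rewrite /= /im u0|by rewrite /= /im yl|
    by rewrite /= /im ul].
  + apply: eq_deriv_on dui => x /sig0 sx; rewrite wim /a.
    by rewrite mulrA mulVf// mul1r.
  + apply: eq_deriv_on dwi => x /oo xl; rewrite vim quim.
    by rewrite subrK pim.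
  + by apply: eq_deriv_on dvi => x _; rewrite Fim; ring.
- by move=> x _; apply: eq_cplx.
Qed.

Lemma deriv_on_inv_sigma s : deriv_on l sigma s ->
  deriv_on l a (fun x => - (s x * (a x * a x))).
Proof.
move=> [_ ds]; split=> // x xl.
have sx : sigma x != 0 by case/andP: xl => x0 xl; rewrite lt0r_neq0// sigma_gt0// !ltW.
have dx := ds x xl; apply: (is_derive_eq (is_deriveV sx dx)).
by rewrite /GRing.scale /= /a; field.
Qed.

(** [y'' = a w] is C^1, but its derivative [z1] contains [s = sigma'] and [q u], which are only
    weakly differentiable: this gives a fourth derivative in L^2, as membership in H^4 asks. *)
Lemma states_eigenspace (lam : R) S : clamped l a q rho lam (fun=> 0) S ->
  in_eigenspace l rho sigma q lam%:C (toC (sy S)).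
Proof.
move=> [[Sy Su Sw Sv] y0 u0 yl ul].
have [s [s' [dsig cs ss']]] := sigma_derivatives; have [q' qq'] := q_derivative.
have da := deriv_on_inv_sigma dsig.
have cy := deriv_on_cont Sy; have cu := deriv_on_cont Su.
have cw := deriv_on_cont Sw; have cv := deriv_on_cont Sv.
pose z x := a x * sw S x.
have cz : cont_on l z := cont_onM a_cont cw.
pose p x := sv S x + q x * su S x.
have cp : cont_on l p := cont_onD cv (cont_onM cq cu).
pose z1 x := - (s x * (a x * a x)) * sw S x + a x * p x.
have dz : deriv_on l z z1 := deriv_onM da Sw.
have caa : cont_on l (fun x => - (s x * (a x * a x))) :=
  cont_onN (cont_onM cs (cont_onM a_cont a_cont)).
have cz1 : cont_on l z1 := cont_onD (cont_onM caa cw) (cont_onM a_cont cp).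
have wyu := deriv_on_wder l_gt0 Sy cu; have wuz := deriv_on_wder l_gt0 Su cz.
have wzz := deriv_on_wder l_gt0 dz cz1.
have cV : cont_on l (fun x => lam * rho x * sy S x + 0) :=
  cont_onD (cont_onM (cont_onM (@cont_on_cst _ l lam) crho) cy) (@cont_on0 _ l).
have wv := deriv_on_wder l_gt0 Sv cV.
have wqu := wderM l_gt0 qq' Su cz.
have wp := wderD l_gt0 wv wqu.
(* [z1] is regrouped as [- s (a^2 w) + p a], each product pairing a weakly differentiable factor
   with a C^1 one. *)
have daw := deriv_onM (deriv_onM da da) Sw.
have cdaw : cont_on l (fun x => (- (s x * (a x * a x)) * a x + a x * - (s x * (a x * a x)))
    * sw S x + a x * a x * (sv S x + q x * su S x)) :=
  cont_onD (cont_onM (cont_onD (cont_onM caa a_cont) (cont_onM a_cont caa)) cw)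
    (cont_onM (cont_onM a_cont a_cont) cp).
have w1 := wderN l_gt0 (wderM l_gt0 ss' daw cdaw).
have w2 := wderM l_gt0 wp da caa.
have z1E : (fun x => - (s x * (a x * a x * sw S x)) + p x * a x) = z1.
  by apply/funext => x; rewrite /z1; ring.
have [z2 wz1] : exists k : R -> R, wder l z1 k.
  by have := wderD l_gt0 w1 w2; rewrite z1E => wz1; eexists; exact: wz1.
have ty := weak_toC l_gt0 wyu; have tu := weak_toC l_gt0 wuz.
have tz := weak_toC l_gt0 wzz; have tz1 := weak_toC l_gt0 wz1.
have cC f : cont_on l f -> continuous_on_itv l (toC f) := @continuous_toC R l f.
have [yu cyu Eu] := wD_eq l_gt0 (fun x _ => erefl (toC (sy S) x)) ty (cC _ cy) (cC _ cu).
have [uz cuz Ez] := wD_eq l_gt0 Eu tu (cC _ cu) (cC _ cz).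
have ev x : 0 <= x <= l -> sigma x * z x = sw S x.
  by move=> xl; rewrite /z /a mulrA mulfV ?mul1r// lt0r_neq0// sigma_gt0.
have Ew x : 0 <= x <= l ->
    toC sigma x * wD l (wD l (toC (sy S))) x = toC (sw S) x.
  by move=> xl; rewrite Ez// /toC -rmorphM /= ev.
have tw := weak_toC l_gt0 (deriv_on_wder l_gt0 Sw cp).
have [wp' cwp Ep] := wD_eq l_gt0 Ew tw (cC _ cw) (cC _ cp).
have Equ x : 0 <= x <= l ->
    toC q x * wD l (toC (sy S)) x = toC (fun x => q x * su S x) x.
  by move=> xl; rewrite Eu// /toC -rmorphM.
set P := wD l (fun t => toC sigma t * wD l (wD l (toC (sy S))) t) in wp' cwp Ep.
set QU := (fun t => toC q t * wD l (toC (sy S)) t).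
have cqu : continuous_on_itv l (toC (fun x => q x * su S x)).
  by apply: cC; exact: cont_onM.
have tp := weak_toC l_gt0 wp; have tqu := weak_toC l_gt0 wqu.
(* [PA] and [QA] contain the same terms [q' u + q a w]; in [opA] they cancel and leave
   [lam rho y]. *)
have PA : cae l (wD l P) (toC (fun x => lam * rho x * sy S x + 0 +
    (q' x * su S x + q x * (a x * sw S x)))).
  have [Lp Lp'] := weak_L2 tp.
  have e : cae l (toC (fun x => sv S x + q x * su S x)) P.
    by apply: eq_cae => x xl; rewrite Ep.
  have h := weak_ae l_gt0 tp e (cae_refl l _) (cont_L2 cwp) Lp'.
  by have [k _] := wD_weak h; exact: (weak_unique l_gt0 k h (cae_refl l _)).
have QA : cae l (wD l QU) (toC (fun x => q' x * su S x + q x * (a x * sw S x))).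
  have [Lp Lp'] := weak_L2 tqu.
  have cQU : continuous_on_itv l QU.
    by apply: eq_continuous_on_itv cqu => x xl; rewrite /QU Equ.
  have e : cae l (toC (fun x => q x * su S x)) QU.
    by apply: eq_cae => x xl; rewrite /QU Equ.
  have h := weak_ae l_gt0 tqu e (cae_refl l _) (cont_L2 cQU) Lp'.
  by have [k _] := wD_weak h; exact: (weak_unique l_gt0 k h (cae_refl l _)).
have il : 0 <= (0 : R) <= l by rewrite lexx ltW.
have ll : 0 <= l <= l by rewrite lexx ltW.
have L2z2 : L2 l (toC z2) by case: (weak_L2 tz1).
split.
  split; last split.
  - split; last exact: cC.
    exists (toC (su S)) => //; exists (toC z) => //; exists (toC z1) => //.
    by exists (toC z2).
  - split; last exact: cC.
    exists (toC (su S)) => //; exists (toC z) => //.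
    by case: (weak_L2 tz).
  - by rewrite !Eu// /toC y0 u0 yl ul.
move: PA QA => /caeP PA /caeP QA.
move: PA; apply: filterS2 QA => x HQ HP; rewrite in_itv/= => xl.
rewrite /opA -/P -/QU HP// HQ// /toC -rmorphB /=.
have r0 : rho x != 0.
  by case/andP: xl => x0 xl; rewrite lt0r_neq0// rho_gt0// !ltW.
rewrite -fmorphV -!rmorphM /=; congr (_%:C).
by field.
Qed.

End EigenSystem.

(** * Eigenvalues and eigenfunctions through the determinant *)

Section Eigenvalues.
Variable R : realType.
Implicit Types (x : R) (lam : R) (S T : state R).
Variables (l : R) (rho sigma q : R -> R).
Hypotheses (l_gt0 : 0 < l) (rhoH : Hsp l 2 (toC rho))
  (sigmaH : Hsp l 2 (toC sigma)) (qH : Hsp l 1 (toC q)).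
Hypotheses (sigma_gt0 : forall x, 0 <= x <= l -> 0 < sigma x)
  (rho_gt0 : forall x, 0 <= x <= l -> 0 < rho x)
  (q_ge0 : forall x, 0 <= x <= l -> 0 <= q x).

Let a x := (sigma x)^-1.
Let crho : cont_on l rho := Hsp_toC_cont rhoH.
Let cq : cont_on l q := Hsp_toC_cont qH.

Let ca : cont_on l a.
Proof. by apply: cont_onV (Hsp_toC_cont sigmaH) => x /sigma_gt0/lt0r_neq0. Qed.

Let a_gt0 x : 0 <= x <= l -> 0 < a x.
Proof. by move=> xl; rewrite invr_gt0 sigma_gt0. Qed.

Local Notation clamped0 lam S := (clamped l a q rho lam (fun=> 0) S).
Local Notation char_det := (char_det l_gt0 ca cq crho).

Lemma clamped_forcing lam (g h : R -> R) S : (forall x, g x = h x) ->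
  clamped l a q rho lam g S -> clamped l a q rho lam h S.
Proof.
by move=> gh [b ? ? ? ?]; split=> //; apply: beam_forcing b => x _; rewrite gh.
Qed.

Lemma real_eigenspace_states lam (y : R -> R[i]) :
  in_eigenspace l rho sigma q lam%:C y -> exists S T,
  [/\ sy S = re y, sy T = im y, clamped0 lam S, clamped0 lam T &
    forall x, 0 <= x <= l ->
      (sigma x)%:C * wD l (wD l y) x = sw S x +i* sw T x].
Proof.
move=> /(eigenspace_states l_gt0 rhoH sigmaH qH sigma_gt0 rho_gt0).
move=> [S [T [yS yT cS cT wST]]]; exists S, T; split=> //.
  by apply: clamped_forcing cS => x /=; rewrite oppr0 mul0r.
by apply: clamped_forcing cT => x /=; rewrite mul0r.
Qed.

Lemma nontrivial_re_im (y : R -> R[i]) S T x : sy S = re y -> sy T = im y ->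
  0 <= x <= l -> y x != 0 -> nontrivial l S \/ nontrivial l T.
Proof.
move=> yS yT xl; rewrite eq_complex negb_and /= => /orP[yx|yx].
  by left; exists x => //; rewrite yS.
by right; exists x => //; rewrite yT.
Qed.

Lemma eigenvalue_char (z : R[i]) : is_eigenvalue l rho sigma q z ->
  z = (complex.Re z)%:C /\ char_det (complex.Re z) = 0.
Proof.
move=> [y [Ey [x]]]; rewrite in_itv/= => xl yx.
have [S [T [yS yT cS cT _]]] :=
  eigenspace_states l_gt0 rhoH sigmaH qH sigma_gt0 rho_gt0 Ey.
have nt := nontrivial_re_im yS yT xl yx.
have [z0|z0] := eqVneq (complex.Im z) 0; last first.
  by have [? ?] := clamped_real_spectrum l_gt0 crho rho_gt0 cS cT z0; case: nt.
have zE : z = (complex.Re z)%:C by apply: eq_cplx.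
split=> //; rewrite zE in Ey.
have [S' [T' [yS' yT' cS' cT' _]]] := real_eigenspace_states Ey.
apply/char_det_eq0P => //.
by case: (nontrivial_re_im yS' yT' xl yx); [exists S'|exists T'].
Qed.

Lemma char_eigenfunction lam : char_det lam = 0 ->
  exists2 S, clamped0 lam S & nontrivial l S /\
    eigenfunction l rho sigma q lam%:C (toC (sy S)).
Proof.
move/(char_det_eq0P l_gt0 ca cq crho a_gt0) => [S cS nS]; exists S => //; split=> //.
split; first exact: (states_eigenspace l_gt0 rhoH sigmaH qH sigma_gt0 rho_gt0 cS).
have [x xl yx] := nS; exists x; first by rewrite in_itv.
by rewrite eq_complex negb_and /= yx.
Qed.

(** For real [lam] the real and imaginary parts of [psi] are real multiples, by [c] and [d], of one
    real eigenfunction; the complex factor is [c + i d]. *)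
Lemma char_simple lam : char_det lam = 0 ->
  simple_eigenvalue l rho sigma q lam%:C.
Proof.
move=> D0; have [S cS [nS eS]] := char_eigenfunction D0.
exists (toC (sy S)) => // psi /real_eigenspace_states[U [V [yU yV cU cV _]]].
have simple := clamped_simple l_gt0 ca cq crho a_gt0 q_ge0 rho_gt0 cS nS.
have [c cE] := simple _ cU; have [d dE] := simple _ cV.
exists (c +i* d) => x; rewrite in_itv/= => xl; apply: eq_cplx.
  by rewrite -[LHS]/(re psi x) -yU cE// re_real.
by rewrite -[LHS]/(im psi x) -yV dE// im_real.
Qed.

(** The real or the imaginary part of [y] is nontrivial, so its [w = sigma y''] is nonzero at
    [l]. *)
Lemma eigenfunction_bending_end lam (y : R -> R[i]) :
  eigenfunction l rho sigma q lam%:C y -> wD l (wD l y) l != 0.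
Proof.
move=> [Ey [x]]; rewrite in_itv/= => xl yx.
have [S [T [yS yT cS cT wST]]] := real_eigenspace_states Ey.
have ll : 0 <= l <= l by rewrite lexx ltW.
have end_neq0 U : clamped0 lam U -> nontrivial l U -> sw U l != 0.
  by move=> cU nU; exact: (clamped_moment_end l_gt0 ca cq crho a_gt0 q_ge0 rho_gt0 cU nU).
apply/eqP => w0; have := wST l ll; rewrite w0 mulr0 => -[Sl Tl].
have [nS|nT] := nontrivial_re_im yS yT xl yx.
  by have := end_neq0 S cS nS; rewrite -Sl eqxx.
by have := end_neq0 T cT nT; rewrite -Tl eqxx.
Qed.

Lemma eigenvalue_sequence : exists lam : nat -> R,
  [/\ forall s, char_det s = 0 <-> exists n, s = lam n,
      forall n, lam n < lam n.+1 & lam n @[n --> \oo] --> +oo].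
Proof.
apply: (enumerate_discrete (S := [set s | char_det s = 0])).
- by move=> s; exact: char_det_gt0.
- move=> t; have [d d0 dP] := char_det_discrete l_gt0 ca cq crho a_gt0 q_ge0 rho_gt0 t.
  by exists d.
- by move=> L; exact: char_det_unbounded.
Qed.

Lemma char_eigenvalue_gt0 lam : char_det lam = 0 -> 0 < lam.
Proof. exact: char_det_gt0. Qed.

End Eigenvalues.

(* [lam n] and [Phi] at index [n : nat] stand for lambda_(n+1), Phi_(n+1). *)
Theorem theorem3p1 (R : realType) (l : R) (rho sigma q : R -> R)
    (rho0 sigma0 : R) :
  0 < l ->
  Hsp l 2 (toC rho) -> Hsp l 2 (toC sigma) -> Hsp l 1 (toC q) ->
  0 < rho0 -> 0 < sigma0 ->
  (forall x, x \in `[0, l] -> rho0 <= rho x) ->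
  (forall x, x \in `[0, l] -> sigma0 <= sigma x) ->
  (forall x, x \in `[0, l] -> 0 <= q x) ->
  exists lam : nat -> R,
    [/\ forall z : R[i], is_eigenvalue l rho sigma q z <->
          exists n, z = (lam n)%:C,
        forall n, simple_eigenvalue l rho sigma q (lam n)%:C,
        0 < lam 0%N /\ (forall n, lam n < lam n.+1),
        lam n @[n --> \oo] --> +oo &
        forall n (Phi : R -> R[i]),
          eigenfunction l rho sigma q (lam n)%:C Phi ->
          wD l (wD l Phi) l != 0].
Proof.
move=> l0 rhoH sigmaH qH rho00 sigma00 rho_ge sigma_ge q_ge.
have rho_gt0 x : 0 <= x <= l -> 0 < rho x.
  by move=> xl; rewrite (lt_le_trans rho00)// rho_ge// in_itv.
have sigma_gt0 x : 0 <= x <= l -> 0 < sigma x.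
  by move=> xl; rewrite (lt_le_trans sigma00)// sigma_ge// in_itv.
have q_ge0 x : 0 <= x <= l -> 0 <= q x by move=> xl; rewrite q_ge// in_itv.
have [lam [lamP lam_lt lam_cvg]] :=
  eigenvalue_sequence l0 rhoH sigmaH qH sigma_gt0 rho_gt0 q_ge0.
have lam0 n := (lamP (lam n)).2 (ex_intro _ n erefl).
exists lam; split=> //.
- move=> z; split=> [Ez|[n ->]].
    have [zE /lamP[n zn]] := eigenvalue_char l0 rhoH sigmaH qH sigma_gt0 rho_gt0 Ez.
    by exists n; rewrite zE zn.
  have [S _ [_ eS]] := char_eigenfunction rho_gt0 (lam0 n).
  by exists (toC (sy S)).
- by move=> n; apply: char_simple (lam0 n).
- by split=> //; exact: char_eigenvalue_gt0 (lam0 0%N).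
- by move=> n Phi; exact: eigenfunction_bending_end.
Qed.
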